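(* Let $\Gamma\subset H$ be a regular convex set in the following sense: there exists a convex $C^\infty$ function $g:H\to\mathbb{R}$ with $g(0)=0$, $g'(0)=0$ and $D^2g$ strictly positive definite, that is, $\langle D^2g(x)h,h\rangle\ge\gamma|h|^2$ for all $x,h\in H$ and some $\gamma>0$, such that $$\Gamma=\{x\in H:g(x)\le1\},\qquad\partial\Gamma=\{x\in H:g(x)=1\},$$ $D^2g$ is bounded on $\Gamma$, and $|Q^{1/2}Dg|^{-1}\in\bigcap_{p>1}L^p(H,\mu)$. Then $I_\Gamma\in BV(H,H)\cap QR(H)$.
   Context: Setting: $H$ is a real separable Hilbert space with inner product $\langle\cdot,\cdot\rangle$ and norm $|\cdot|$. $A:D(A)\subset H\to H$ is a linear self-adjoint operator such that $\langle Ax,x\rangle\ge\delta|x|^2$ for all $x\in D(A)$ and some $\delta>0$, and $A^{-1}$ is of trace class. $\mu$ is the Gaussian measure on $H$ with mean $0$ and covariance operator $Q=\frac12A^{-1}$. $D\varphi$ denotes the Fréchet derivative (gradient). $C_b^1(H)$ is the set of bounded differentiable functions $H\to\mathbb{R}$ with continuous bounded derivative; for $K\subset H$, $C_b^1(K)$ is the set of restrictions to $K$ of functions in $C_b^1(H)$. $I_\Gamma$ is the indicator function of $\Gamma$. $BV(H,H)$: $(C_b^1)_{D(A)}$ is the set of maps $G(z)=\sum_{j=1}^m g_j(z)l^j$ with $m\in\mathbb{N}$, $g_j\in C_b^1(H)$, $l^j\in D(A)$. $D^*$ is the adjoint of $D:C_b^1(H)\subset L^2(H,\mu)\to L^2(H,\mu;H)$.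 $L(\log L)^{1/2}(H,\mu)$ is the set of Borel $f:H\to\mathbb{R}$ with $A_{1/2}(|f|)\in L^1(H,\mu)$, $A_{1/2}(x)=\int_0^x(\log(1+s))^{1/2}ds$. $BV(H,H)$ is the set of $\rho\in L(\log L)^{1/2}(H,\mu)$ such that $\sup\{\int_HD^*G\,\rho\,d\mu: G\in(C_b^1)_{D(A)},\ |G(z)|\le1\ \forall z\in H\}<\infty$. $QR(H)$: the set of nonnegative $\rho\in L^1(H,\mu)$ such that, with $F=\operatorname{Supp}[\rho\cdot\mu]$, the form $\mathcal{E}^\rho(u,v)=\frac12\int_H\langle Du,Dv\rangle\rho\,d\mu$, $u,v\in C_b^1(F)$, is closable on $L^2(F,\rho\cdot\mu)$. *)

(* Defs.v *)
From HB Require Import structures.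
From mathcomp Require Import all_boot all_order all_algebra.
From mathcomp Require Import sesquilinear.
From mathcomp Require Import all_classical all_reals all_analysis.
From mathcomp Require Import measurable_realfun.
Import Order.TTheory GRing.Theory Num.Theory.
Import numFieldNormedType.Exports.

Set Implicit Arguments.
Unset Strict Implicit.
Unset Printing Implicit Defensive.

Local Open Scope classical_set_scope.
Local Open Scope ring_scope.

(* A real Hilbert space is a complete normed module [H] with a positive
   definite symmetric form [dot] inducing the norm, see [is_hilbert]. *)

Definition borel (T : topologicalType) := g_sigma_algebraType (@open T).

Definition separable (T : topologicalType) : Prop :=
  exists S : set T, countable S /\ dense S.

Definition boundary (T : topologicalType) (S : set T) : set T :=
  closure S `\` interior S.

Section hilbert.
Context {R : realType} {H : completeNormedModType R}.
Variable dot : {dot H for idfun}.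

Definition is_hilbert : Prop := forall x : H, dot x x = `|x| ^+ 2.

(* Unbounded operators: [A : H -> H] is relevant only on its domain [DA]. *)
Definition linear_on (DA : set H) (A : H -> H) : Prop :=
  DA 0 /\
  forall (a : R) (x y : H), DA x -> DA y ->
    DA (a *: x + y) /\ A (a *: x + y) = a *: A x + A y.

(* Densely defined, and with the same graph (hence the same domain) as its
   adjoint. *)
Definition self_adjoint (DA : set H) (A : H -> H) : Prop :=
  [/\ linear_on DA A, dense DA &
      forall y z : H, (forall x, DA x -> dot (A x) y = dot x z) <->
                      (DA y /\ A y = z)].

Definition op_inverse (DA : set H) (A : H -> H) (x : H) : H :=
  get [set y | DA y /\ A y = x].

(* Trace class (nuclear) operators: [T x = \sum_k <x, a_k> b_k] with
   [\sum_k |a_k| |b_k| < oo]. *)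
Definition trace_class (T : H -> H) : Prop :=
  exists a b : nat -> H,
    cvgn (series (fun k => `|a k| * `|b k|)) /\
    forall x : H, series (fun k => dot x (a k) *: b k) @ \oo --> T x.

(* The nonnegative self-adjoint bounded square root of [T]. *)
Definition op_sqrt (T : H -> H) : H -> H :=
  get [set S : H -> H | [/\ linear S, continuous S,
    (forall x y, dot (S x) y = dot x (S y)), (forall x, 0 <= dot (S x) x) &
    forall x, S (S x) = T x]].

(* The Riesz representative of the Frechet derivative. *)
Definition grad (f : H -> R) (x : H) : H :=
  get [set v : H | forall h : H, 'd f x h = dot v h].

Definition hessian (f : H -> R) (x : H) : H -> H := 'd (grad f) x.

(* [D x [:: h_1; ...; h_k]] is the [k]-th Frechet derivative of [f] at [x]
   applied to [h_1, ..., h_k]: a bounded multilinear form, whose derivative in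
   [x], for the operator norm on [k]-linear forms, is the [k.+1]-st one. *)
Definition frechet_derivatives (f : H -> R) (D : H -> seq H -> R) : Prop :=
  [/\ forall x, D x [::] = f x,
      forall x (s t : seq H), linear (fun h : H => D x (s ++ h :: t) : R^o),
      forall x k, exists C : R, forall s : seq H, size s = k ->
        `|D x s| <= C * \prod_(v <- s) `|v| &
      forall x k (e : R), 0 < e -> \forall h \near (0 : H),
        forall s : seq H, size s = k ->
          `|D (x + h) s - D x s - D x (h :: s)|
            <= e * `|h| * \prod_(v <- s) `|v|].

Definition smooth (f : H -> R) : Prop :=
  exists D : H -> seq H -> R, frechet_derivatives f D.

(* [continuous (grad f)] is continuity of the derivative in operator norm,
   Riesz' isomorphism being isometric. *)
Definition Cb1 (f : H -> R) : Prop :=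
  [/\ exists M : R, forall x, `|f x| <= M,
      forall x, differentiable f x,
      continuous (grad f) &
      exists M : R, forall x, `|grad f x| <= M].

Definition Cb1_dom (DA : set H) (G : H -> H) : Prop :=
  exists (m : nat) (g : 'I_m -> H -> R) (l : 'I_m -> H),
    [/\ forall j, Cb1 (g j), forall j, DA (l j) &
        forall z, G z = \sum_(j < m) g j z *: l j].

Definition gaussian_law (m s : R) (B : set R) : \bar R :=
  if s == 0 then dirac m B else normal_prob m s B.

Section measure.
Variable mu : probability (borel H) R.

Definition is_gaussian : Prop :=
  forall h : H, exists m s : R, forall B : set R, measurable B ->
    mu [set x : H | B (dot h x)] = gaussian_law m s B.

Definition has_mean (m : H) : Prop :=
  forall h : H, (\int[mu]_x (dot h x)%:E = (dot h m)%:E)%E.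

Definition has_covariance (m : H) (Q : H -> H) : Prop :=
  forall h k : H,
    (\int[mu]_x (dot h (x - m) * dot k (x - m))%:E = (dot (Q h) k)%:E)%E.

Definition gaussian_measure (m : H) (Q : H -> H) : Prop :=
  [/\ is_gaussian, has_mean m & has_covariance m Q].

(* The image of the field [G] under the adjoint of
   [grad : Cb1 -> L^2(mu; H)], a representative of an element of [L^2(mu)]
   which is unique since [Cb1] is dense in [L^2(mu)]. *)
Definition div_adjoint (G : H -> H) : H -> R :=
  get [set w : H -> R | w \in Lfun mu 2%:E /\
    forall phi : H -> R, Cb1 phi ->
      \int[mu]_x dot (grad phi x) (G x) = \int[mu]_x (phi x * w x)].

Definition A_half (x : R) : R :=
  \int[lebesgue_measure]_(s in `[0, x]) Num.sqrt (ln (1 + s)).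

Definition LlogL_half (f : H -> R) : Prop :=
  measurable_fun [set: borel H] f /\
  mu.-integrable [set: borel H] (fun x => (A_half `|f x|)%:E).

Definition BV (DA : set H) (rho : H -> R) : Prop :=
  LlogL_half rho /\
  (ereal_sup [set \int[mu]_x (div_adjoint G x * rho x)%:E | G in
     [set G : H -> H | Cb1_dom DA G /\ forall z, (`|G z| <= 1)%R]] < +oo)%E.

(* Topological support of the measure [rho . mu]. *)
Definition weighted_supp (rho : H -> R) : set H :=
  [set x | forall U : set H, open U -> U x ->
     (0 < \int[mu]_(y in U) (rho y)%:E)%E].

Definition energy (rho u v : H -> R) : R :=
  2^-1 * \int[mu]_x (dot (grad u x) (grad v x) * rho x).

(* A sequence in [C_b^1(F)], the space of restrictions to [F] of functions in
   [C_b^1(H)], is given by extensions [u n] in [C_b^1(H)].  No choice of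
   extensions is favoured: for a constant sequence vanishing on the support,
   [energy_closable] yields energy [0], so the form is well-defined on
   restrictions. *)
Definition energy_closable (rho : H -> R) : Prop :=
  let F := weighted_supp rho in
  forall u : nat -> H -> R,
    (forall n, Cb1 (u n)) ->
    \int[mu]_(x in F) ((u n x) ^+ 2 * rho x) @[n --> \oo] --> 0 ->
    (forall e : R, 0 < e -> exists N : nat, forall n m : nat,
       (N <= n)%N -> (N <= m)%N ->
       energy rho (u n \- u m) (u n \- u m) < e) ->
    energy rho (u n) (u n) @[n --> \oo] --> 0.

Definition QR (rho : H -> R) : Prop :=
  [/\ forall x, 0 <= rho x,
      mu.-integrable [set: borel H] (EFin \o rho) &
      energy_closable rho].

Definition in_Lp (p : R) (f : borel H -> \bar R) : Prop :=
  measurable_fun [set: borel H] f /\ ('N[mu]_p%:E [f] < +oo)%E.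

(* The inverse in [in_Lp] is taken in [\bar R], where [0^-1 = +oo]. *)
Definition regular_convex (Q : H -> H) (Gam : set H) : Prop :=
  exists g : H -> R,
    [/\ convex_function (E := H) setT g /\ smooth g,
        g 0 = 0 /\ grad g 0 = 0,
        exists2 gam : R, 0 < gam &
          forall x h, gam * `|h| ^+ 2 <= dot (hessian g x h) h,
        Gam = [set x | g x <= 1] /\ boundary Gam = [set x | g x = 1] &
        (exists M : R, forall x, Gam x -> forall h,
           `|hessian g x h| <= M * `|h|) /\
        forall p : R, 1 < p ->
          in_Lp p (fun x => (`|op_sqrt Q (grad g x)|%:E^-1)%E)].

End measure.
End hilbert.

(* Main.v *)
From HB Require Import structures.
Require Import Defs.
From mathcomp Require Import all_boot all_order all_algebra.
From mathcomp Require Import sesquilinear.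
From mathcomp Require Import all_classical all_reals all_analysis.
From mathcomp Require Import measurable_realfun.
From mathcomp Require Import ring lra.
Import Order.TTheory GRing.Theory Num.Theory.
Import numFieldNormedType.Exports.
Set Implicit Arguments.
Unset Strict Implicit.
Unset Printing Implicit Defensive.
Local Open Scope classical_set_scope.
Local Open Scope ring_scope.

(** Everything rests on one estimate: the shells [1 - e < g <= 1] around the
    boundary of [Gam = {g <= 1}] have measure [O(e)].  The cut-off functions
    [chi_e = h ((1 - g) / e)], with [h] a smooth step, are in [C_b^1], vanish
    together with their gradients outside [Gam], tend to the indicator of
    [{g < 1}], and have slope [O(1 / e)] in the shell only; so the integrals of
    [|D chi_e|] remain bounded, and the level set [{g = 1}] is null.  This is
    recorded in [exhaustion], and both halves of the theorem follow from it.

    Bounded variation ([BV_exhaustion]).  For [l] in the domain of [A], the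
    vector [k = 2 A l] satisfies [Q k = l], so that [l] is a Cameron-Martin
    direction along which one can integrate by parts ([ibp_domain]).  Hence
    [D^*] is defined on the fields [G = sum_j g_j l^j], and the integral of
    [D^* G] over [Gam] is the limit of those of [chi_e D^* G = <D chi_e, G>],
    which are at most those of [|D chi_e|].

    Closability ([closable_exhaustion]).  Let [u_n] tend to 0 in [L^2(Gam)] and
    be Cauchy for the energy.  Its gradients are bounded in [L^2(Gam)]; tested
    against [psi chi_e l] with [psi] trigonometric and [l] in the domain of [A],
    they tend to 0, as the derivative can be moved away from [u_n].  The boundary
    layer lost by the cut-off is small uniformly in [n].  By a monotone class
    argument ([trig_monotone_class]) [D u_n] tends weakly to 0, and a Cauchy
    sequence that tends weakly to 0 tends to 0.

    The shell estimate ([shell_measure]).  If [Q k = l] and [<l, k> = 1], then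
    [z + (<k, w> - <k, z>) l], with [z] and [w] independent of law [mu], again has
    law [mu] ([resample_law]): both laws have the same characteristic function.
    As [<k, w>] is standard normal, conditionally on [z] the point has a bounded
    density on the line through [z] with direction [l].  Used along two
    independent directions, this bounds the measure of the shell by the areas of
    its sections with planes.  In a plane, let [m] be the minimum of [g]: by
    strong convexity the sublevel set at height 1 has area [O(1 - m)], and the
    dilation of ratio [1 - e / (1 - m)] about the minimiser maps it into the
    sublevel set at height [1 - e]; so the shell has area [O(e)], uniformly in
    [m] ([strongly_convex_shell]).  One direction would not be enough, as
    intervals only give [O(e / sqrt (1 - m))]; in dimension one there is a single
    line and its minimum is [m = 0] ([shell_measure_line]).

    The same resampling reduces integration by parts to Stein's identity for
    a normal variable ([ibp_unit], [gaussian_stein]). *)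

(** * Inner products *)

Section inner_product.
Context {R : realType} {H : completeNormedModType R}.
Variable dot : {dot H for idfun}.
Hypothesis hil : is_hilbert dot.

Lemma dotC x y : dot x y = dot y x.
Proof. by rewrite hermC expr0 mul1r. Qed.

Lemma dotDl x y z : dot (x + y) z = dot x z + dot y z.
Proof. exact: linearDl. Qed.

Lemma dotZl (a : R) (x z : H) : dot (a *: x) z = a * dot x z.
Proof. by rewrite linearZl_LR. Qed.

Lemma dotDr x y z : dot x (y + z) = dot x y + dot x z.
Proof. exact: linearDr. Qed.

Lemma dotZr (a : R) (x z : H) : dot x (a *: z) = a * dot x z.
Proof. by rewrite dotC dotZl dotC. Qed.

Lemma dotNl x z : dot (- x) z = - dot x z.
Proof. by rewrite -scaleN1r dotZl mulN1r. Qed.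

Lemma dotNr x z : dot x (- z) = - dot x z.
Proof. by rewrite -scaleN1r dotZr mulN1r. Qed.

Lemma dotBl x y z : dot (x - y) z = dot x z - dot y z.
Proof. by rewrite dotDl dotNl. Qed.

Lemma dotBr x y z : dot z (x - y) = dot z x - dot z y.
Proof. by rewrite dotDr dotNr. Qed.

Lemma dot0l z : dot 0 z = 0.
Proof. by rewrite -(scale0r 0) dotZl mul0r. Qed.

Lemma dot0r z : dot z 0 = 0.
Proof. by rewrite dotC dot0l. Qed.

Lemma dot_sumr I (s : seq I) (F : I -> H) z :
  dot z (\sum_(i <- s) F i) = \sum_(i <- s) dot z (F i).
Proof. exact: linear_sumr. Qed.

Lemma dot_sqr_ge0 x : 0 <= dot x x.
Proof. by rewrite hil sqr_ge0. Qed.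

Lemma dot_sqr_eq0 x : dot x x = 0 -> x = 0.
Proof. by rewrite hil => /eqP; rewrite sqrf_eq0 normr_eq0 => /eqP. Qed.

Lemma dot_inj x y : (forall z, dot x z = dot y z) -> x = y.
Proof.
move=> xy; apply/eqP; rewrite -subr_eq0; apply/eqP/dot_sqr_eq0.
by rewrite dotBl !xy subrr.
Qed.

Lemma dot_sqrD x y : dot (x + y) (x + y) = dot x x + 2 * dot x y + dot y y.
Proof. rewrite dotDl !dotDr (dotC y x); ring. Qed.

Lemma dot_sqrB x y : dot (x - y) (x - y) = dot x x - 2 * dot x y + dot y y.
Proof. rewrite !(dotBl, dotBr) (dotC y x); ring. Qed.

Lemma cauchy_schwarz x y : `|dot x y| <= `|x| * `|y|.
Proof.
have [->|y0] := eqVneq y 0; first by rewrite dot0r !normr0 mulr0.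
have ny : 0 < dot y y by rewrite hil exprn_gt0// normr_gt0.
rewrite -(@ler_pXn2r _ 2) ?nnegrE ?mulr_ge0// exprMn real_normK ?num_real//.
rewrite -!hil.
have := dot_sqr_ge0 (x - (dot x y / dot y y) *: y).
rewrite dot_sqrB !(dotZr, dotZl) => h.
have e : dot x x - 2 * (dot x y / dot y y * dot x y) +
  dot x y / dot y y * (dot x y / dot y y * dot y y) =
    dot x x - (dot x y) ^+ 2 / dot y y.
  by field; rewrite gt_eqF.
by move: h; rewrite e subr_ge0 ler_pdivrMr.
Qed.

Lemma dot_le_sqr x y : 2 * dot x y <= dot x x + dot y y.
Proof. by have := dot_sqr_ge0 (x - y); rewrite dot_sqrB; lra. Qed.

Lemma dot_sqrD_le x y : dot (x + y) (x + y) <= 2 * (dot x x + dot y y).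
Proof. by rewrite dot_sqrD; have := dot_le_sqr x y; lra. Qed.

Lemma continuous_dotr h : continuous (dot h : H -> R).
Proof.
move=> x; apply/cvgrPdist_le => e e0.
near=> y; rewrite -dotBr.
apply: (le_trans (cauchy_schwarz _ _)).
have h1 : 0 < `|h| + 1 by rewrite ltr_wpDl.
apply: (@le_trans _ _ ((`|h| + 1) * (e / (`|h| + 1)))); last first.
  by rewrite mulrC divfK// gt_eqF.
apply: ler_pM => //; first by rewrite lerDl.
near: y; apply: cvgr_dist_le => //; exact: divr_gt0.
Unshelve. all: by end_near. Qed.

Lemma continuous_dot (T : topologicalType) (f g : T -> H) :
  continuous f -> continuous g -> continuous (fun x => dot (f x) (g x)).
Proof.
move=> cf cg x.
have e y : dot (f y) (g y) = 2^-1 * (`|f y + g y| ^+ 2 - `|f y| ^+ 2 - `|g y| ^+ 2).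
  by rewrite -!hil dot_sqrD; field.
rewrite (_ : (fun x => dot (f x) (g x)) =
  (fun y => 2^-1 * (`|f y + g y| ^+ 2 - `|f y| ^+ 2 - `|g y| ^+ 2))); last exact/funext.
have c2 (u : T -> H) : u @ x --> u x -> (fun y => `|u y| ^+ 2) @ x --> `|u x| ^+ 2.
  move=> cu; rewrite expr2; under eq_fun do rewrite expr2.
  by apply: cvgM; apply: cvg_norm.
apply: cvgM; first exact: cvg_cst.
apply: cvgB; first (apply: cvgB).
- by apply: c2; apply: cvgD; [exact: cf|exact: cg].
- by apply: c2; exact: cf.
- by apply: c2; exact: cg.
Qed.

(** A continuous linear form [L] is represented by the minimiser of
    [|x|^2 / 2 - L x]: by the parallelogram identity minimising sequences are
    Cauchy, and the first variation of the functional at the minimiser is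
    [<x, .> - L]. *)
Lemma riesz_representation (L : H -> R) (C : R) :
  (forall a x y, L (a *: x + y) = a * L x + L y) ->
  (forall x, `|L x| <= C * `|x|) -> exists v, forall h, L h = dot v h.
Proof.
move=> linL bL.
have L0 : L 0 = 0 by have := linL 1 0 0; rewrite scale1r addr0 mul1r; lra.
have LD x y : L (x + y) = L x + L y by have := linL 1 x y; rewrite scale1r mul1r.
have LZ a x : L (a *: x) = a * L x by have := linL a x 0; rewrite L0 !addr0.
pose J (x : H) : R := dot x x / 2 - L x.
have Jlb x : - (C ^+ 2 / 2) <= J x.
  have := bL x; rewrite ler_norml /J => /andP[_ h].
  have : 0 <= (`|x| - C) ^+ 2 by rewrite sqr_ge0.
  by move: h; rewrite hil; set a : R := `|x|; rewrite sqrrB; lra.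
pose S : set R := range J.
have S0 : S !=set0 by exists (J 0); exists 0.
have Slb : has_lbound S by exists (- (C ^+ 2 / 2)) => _ [x _ <-].
have hS : has_inf S by split.
have Jge x : inf S <= J x by apply: ge_inf => //; exists x.
have near_min n : exists x, J x < inf S + n.+1%:R^-1.
  by have [_ [x _ <-] xS] := @inf_adherent _ S n.+1%:R^-1 ltac:(by []) hS; exists x.
have [u uP] := choice near_min.
have par x y : dot (x - y) (x - y) / 8 <= (J x - inf S) / 2 + (J y - inf S) / 2.
  have := Jge (2^-1 *: (x + y)).
  rewrite /J dotZl dotZr LZ LD dot_sqrD dot_sqrB.
  lra.
have cu : cauchy (u @ \oo).
  apply/cauchy_ballP => e e0.
  have [N _ NP] := near_infty_natSinv_lt (PosNum (divr_gt0 (exprn_gt0 2 e0) (ltr0n R 8))).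
  exists (u @` [set n | (N <= n)%N], u @` [set n | (N <= n)%N]) => /=.
    by split; exists N => // n /= Nn; exists n.
  move=> [_ _]/= [[n Nn <-] [m Nm <-]].
  rewrite -ball_normE/=.
  rewrite -(@ltr_pXn2r _ 2) ?nnegrE ?(ltW e0)// -hil.
  have := par (u n) (u m); have := uP n; have := uP m.
  have /= := NP _ Nn; have /= := NP _ Nm.
  have arith (p q a b i d E : R) : p < E / 8 -> q < E / 8 -> a < i + p ->
    b < i + q -> d / 8 <= (b - i) / 2 + (a - i) / 2 -> d < E by lra.
  exact: arith.
have /cvg_ex[v uv] : cvgn u by apply: cauchy_cvg.
have cJ : J (u n) @[n --> \oo] --> J v.
  apply: cvgB.
    apply: cvgM; last exact: cvg_cst.
    rewrite hil; under eq_fun do rewrite hil.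
    under eq_fun do rewrite expr2.
    by rewrite expr2; apply: cvgM; apply: cvg_norm.
  apply/cvgrPdist_le => e e0.
  have C1 : 0 < `|C| + 1 by rewrite ltr_wpDl.
  near=> n.
  rewrite (_ : L v - L (u n) = L (v - u n)); last first.
    by rewrite LD -(scaleN1r (u n)) LZ; ring.
  apply: (le_trans (bL _)).
  apply: (@le_trans _ _ ((`|C| + 1) * (e / (`|C| + 1)))); last first.
    by rewrite mulrC divfK// gt_eqF.
  apply: (@le_trans _ _ ((`|C| + 1) * `|v - u n|)).
    by rewrite ler_wpM2r// (le_trans (ler_norm _))// lerDl.
  rewrite ler_pM2l//.
  near: n; move/cvgrPdist_le : uv; apply; exact: divr_gt0.
have Jv : J v = inf S.
  apply/eqP; rewrite eq_le Jge andbT.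
  apply/ler_addgt0Pr => e e0.
  have [N _ NP] := near_infty_natSinv_lt (PosNum e0).
  apply: (cvgr_to_le cJ).
  near=> n; apply: (le_trans (ltW (uP n))); rewrite lerD2l.
  by apply: ltW; apply: NP; near: n; exists N.
exists v => h.
have var t : 0 <= t * (dot v h - L h) + t ^+ 2 * (dot h h / 2).
  have := Jge (v + t *: h); rewrite -Jv /J dot_sqrD LD LZ dotZr dotZl dotZr; lra.
set c := dot v h - L h in var; set q := dot h h / 2 in var.
suff : c = 0 by rewrite /c; lra.
have q0 : 0 < q + 1 by rewrite ltr_wpDl// divr_ge0// dot_sqr_ge0.
apply/eqP/negPn/negP => c0.
have := var (- (c / (q + 1))).
rewrite (_ : _ + _ = - (c ^+ 2 / (q + 1) ^+ 2)); last by field; rewrite gt_eqF.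
by rewrite oppr_ge0 leNgt divr_gt0 ?exprn_even_gt0//= gt_eqF.
Unshelve. all: by end_near. Qed.

End inner_product.

(** * Gradients and bounded differentiable functions *)

Section differential.
Context {R : realType} {V W : normedModType R}.

(** A differential exhibited by an error estimate: a bounded linear map is
    continuous, so that it may serve as the differential. *)
Lemma has_diff (f : V -> W) (L : V -> W) (C : R) (x : V) :
  linear L -> (forall h, `|L h| <= C * `|h|) ->
  (forall e : R, 0 < e -> \forall h \near (0 : V),
     `|f (x + h) - f x - L h| <= e * `|h|) ->
  differentiable f x /\ ('d f x = L :> (V -> W)).
Proof.
move=> linL bL fL.
pose LM := GRing.isLinear.Build _ _ _ _ _ linL.
pose Ll : {linear V -> W} := HB.pack L LM.
have cL : continuous Ll.
  apply: bounded_linear_continuous; apply/linear_boundedP.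
  exists C; split; first exact: num_real.
  move=> r Cr h; apply: (le_trans (bL h)).
  by apply: ler_wpM2r => //; exact: ltW.
have e : f \o shift x = cst (f x) + Ll +o_ 0 id.
  apply/eqaddoP => _/posnumP[e].
  have := fL e%:num ltac:(by []); apply: filterS => h /=.
  by rewrite -[(_ - _) h]/(f (h + x) - (f x + L h)) (addrC h) opprD addrA.
have dE : 'd f x = Ll :> (V -> W) by exact: diff_unique.
split=> //; apply/diff_locallyP; rewrite dE.
by split.
Qed.

Lemma diff_bounded (f : V -> W) (x : V) : differentiable f x ->
  exists C : R, forall h, `|'d f x h| <= C * `|h|.
Proof.
move=> df.
have /linear_boundedP : bounded_near ('d f x) (nbhs (0 : V)).
  by apply: continuous_linear_bounded; exact: diff_continuous.
by move=> [M [_ MP]]; exists (M + 1); apply: MP; rewrite ltrDl.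
Qed.

Lemma diff_line (a l : V) (t : R) :
  differentiable (fun s : R => a + s *: l) t /\
  'd (fun s : R => a + s *: l) t 1 = l.
Proof.
have dl : differentiable (fun s : R => s *: l) t.
  by apply: (@differentiableZl _ _ _ id l t).
split; first exact: differentiableD.
rewrite (_ : (fun s : R => a + s *: l) = cst a + (fun s : R => s *: l))// diffD//=.
rewrite diff_cst -[0 1]/(0 : V) add0r.
by rewrite (@diffZl _ _ _ id l t)//= diff_val scale1r.
Qed.

Lemma is_derive_line (f : V -> R) (a l : V) (t : R) :
  differentiable f (a + t *: l) ->
  is_derive t 1 (fun s : R => f (a + s *: l)) ('d f (a + t *: l) l).
Proof.
move=> df; pose u s : V := a + s *: l.
have [du dul] := diff_line a l t.
have dfu : differentiable (f \o u) t by exact: differentiable_comp.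
apply: DeriveDef; first exact: diff_derivable.
by rewrite deriveE// (_ : (fun s => f (a + s *: l)) = f \o u)// diff_comp//= dul.
Qed.

End differential.

(** The gradient, sealed: comparing two instances of [grad] up to conversion
    would unfold the choice of the differential. *)
HB.lock Definition nabla {R : realType} {H : completeNormedModType R}
  (dot : {dot H for idfun}) : (H -> R) -> H -> H := grad dot.

Section gradient.
Context {R : realType} {H : completeNormedModType R}.
Variable dot : {dot H for idfun}.
Hypothesis hil : is_hilbert dot.
Implicit Types f g : H -> R.

(** The choice made in the definition of the gradient is legitimate: a
    differential is bounded, so that it has a Riesz representative. *)
Lemma diff_grad f x : differentiable f x ->
  forall h, 'd f x h = dot (nabla dot f x) h.
Proof.
move=> df; have [C bC] := diff_bounded df.
rewrite nabla.unlock; have [v hv] : exists v, forall h, 'd f x h = dot v h.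
  apply: (@riesz_representation _ _ _ hil ('d f x) C) => // a y z.
  by rewrite linearP.
exact: (@getPex _ [set v | forall h, 'd f x h = dot v h] (ex_intro _ v hv)).
Qed.

Lemma gradE f x v : differentiable f x -> (forall h, 'd f x h = dot v h) ->
  nabla dot f x = v.
Proof.
by move=> df dv; apply: (dot_inj hil) => h; rewrite -diff_grad.
Qed.

Lemma has_grad f x v :
  (forall e : R, 0 < e -> \forall h \near (0 : H),
     `|f (x + h) - f x - dot v h| <= e * `|h|) ->
  differentiable f x /\ nabla dot f x = v.
Proof.
move=> hv.
have [] := @has_diff _ _ _ f (dot v : H -> R^o) `|v| x _ _ hv.
- by move=> a y z; rewrite dotDr dotZr.
- exact: cauchy_schwarz.
by move=> df dE; split=> //; apply: gradE => // h; rewrite dE.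
Qed.

Lemma grad_line f (a l : H) (t : R) : differentiable f (a + t *: l) ->
  is_derive t 1 (fun s : R => f (a + s *: l)) (dot (nabla dot f (a + t *: l)) l).
Proof. by move=> df; rewrite -diff_grad//; exact: is_derive_line. Qed.

Lemma grad_mul f g x : differentiable f x -> differentiable g x ->
  nabla dot (f \* g) x = f x *: nabla dot g x + g x *: nabla dot f x.
Proof.
move=> df dg; apply: gradE; first exact: differentiableM.
move=> h; transitivity (f x * 'd g x h + g x * 'd f x h).
  exact: (congr1 (fun L : H -> R => L h) (diffM df dg)).
by rewrite dotDl !dotZl; congr (_ * _ + _ * _); exact: diff_grad.
Qed.

Lemma grad_sub f g x : differentiable f x -> differentiable g x ->
  nabla dot (f \- g) x = nabla dot f x - nabla dot g x.
Proof.
move=> df dg; apply: gradE; first exact: differentiableB.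
move=> h; transitivity ('d f x h - 'd g x h).
  exact: (congr1 (fun L : H -> R => L h) (diffB df dg)).
by rewrite dotBl; congr (_ - _); exact: diff_grad.
Qed.

Lemma grad_comp (F dF : R -> R) f x :
  (forall t : R, is_derive t 1 F (dF t)) -> differentiable f x ->
  differentiable (F \o f) x /\ nabla dot (F \o f) x = dF (f x) *: nabla dot f x.
Proof.
move=> dFE df.
have dFf : differentiable F (f x) by apply/derivable1_diffP; case: (dFE (f x)).
have dc : differentiable (F \o f) x by exact: differentiable_comp.
split=> //; apply: gradE => // h.
transitivity ('d f x h * dF (f x)); last first.
  by rewrite dotZl mulrC; congr (_ * _); exact: diff_grad.
rewrite diff_comp//= diff1E//= derive1E.
by case: (dFE (f x)) => _ ->.
Qed.

Lemma differentiable_dot h x : differentiable (dot h : H -> R) x.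
Proof.
apply: (@has_grad _ _ h _).1 => e e0; near=> k.
by rewrite dotDr; rewrite (_ : _ - _ = 0) ?normr0 ?mulr_ge0// ?ltW//; ring.
Unshelve. all: by end_near. Qed.

Lemma grad_dot h x : nabla dot (dot h) x = h.
Proof.
apply: (@has_grad _ _ h _).2 => e e0; near=> k.
by rewrite dotDr; rewrite (_ : _ - _ = 0) ?normr0 ?mulr_ge0// ?ltW//; ring.
Unshelve. all: by end_near. Qed.

Lemma Cb1E f : Cb1 dot f <->
  [/\ exists M : R, forall x, `|f x| <= M,
      forall x, differentiable f x,
      continuous (nabla dot f) &
      exists M : R, forall x, `|nabla dot f x| <= M].
Proof. by rewrite nabla.unlock. Qed.

Lemma Cb1_continuous f : Cb1 dot f -> continuous f.
Proof. by move=> [_ df _ _] x; exact: differentiable_continuous. Qed.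

Lemma Cb1_mul f g : Cb1 dot f -> Cb1 dot g -> Cb1 dot (f \* g).
Proof.
move=> Cf Cg; apply/Cb1E.
have /Cb1E[[M fM] df cf [M' fM']] := Cf.
have /Cb1E[[N gN] dg cg [N' gN']] := Cg.
split.
- exists (M * N) => x; rewrite normrM; exact: ler_pM.
- by move=> x; exact: differentiableM.
- rewrite (_ : nabla _ _ = fun x => f x *: nabla dot g x + g x *: nabla dot f x).
    move=> x; apply: cvgD; apply: cvgZ; try exact: cf; try exact: cg.
      exact: Cb1_continuous.
    exact: Cb1_continuous.
  by apply/funext => x; rewrite grad_mul.
- exists (M * N' + N * M') => x; rewrite grad_mul//.
  apply: (le_trans (ler_normD _ _)); rewrite !normrZ.
  by apply: lerD; exact: ler_pM.
Qed.

Lemma Cb1_sub f g : Cb1 dot f -> Cb1 dot g -> Cb1 dot (f \- g).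
Proof.
move=> Cf Cg; apply/Cb1E.
have /Cb1E[[M fM] df cf [M' fM']] := Cf.
have /Cb1E[[N gN] dg cg [N' gN']] := Cg.
split.
- exists (M + N) => x; apply: (le_trans (ler_normB _ _)); exact: lerD.
- by move=> x; exact: differentiableB.
- rewrite (_ : nabla _ _ = fun x => nabla dot f x - nabla dot g x).
    by move=> x; apply: cvgB; [exact: cf|exact: cg].
  by apply/funext => x; rewrite grad_sub.
- exists (M' + N') => x; rewrite grad_sub//.
  apply: (le_trans (ler_normB _ _)); exact: lerD.
Qed.

Lemma Cb1_comp_dot (F dF : R -> R) h :
  (forall t : R, is_derive t 1 F (dF t)) -> continuous dF ->
  (forall t, `|F t| <= 1) -> (forall t, `|dF t| <= 1) ->
  Cb1 dot (F \o dot h) /\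
  forall x, nabla dot (F \o dot h) x = dF (dot h x) *: h.
Proof.
move=> dFE cdF bF bdF.
have gE x : differentiable (F \o dot h) x /\
    nabla dot (F \o dot h) x = dF (dot h x) *: h.
  by have := grad_comp dFE (differentiable_dot h x); rewrite grad_dot.
split; last by move=> x; case: (gE x).
apply/Cb1E; split.
- by exists 1 => x /=.
- by move=> x; case: (gE x).
- rewrite (_ : nabla _ _ = fun x => dF (dot h x) *: h).
    move=> x; apply: cvgZr_tmp.
    apply: (@continuous_comp _ _ _ (dot h) dF); last exact: cdF.
    exact: continuous_dotr.
  by apply/funext => x; case: (gE x).
- exists `|h| => x; case: (gE x) => _ ->.
  by rewrite normrZ ler_piMl.
Qed.

Lemma Cb1_cos h : Cb1 dot (fun x => cos (dot h x)).
Proof.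
have d (t : R) : is_derive t 1 (cos : R -> R) (- sin t) by exact: is_derive_cos.
have [] // := Cb1_comp_dot h d.
- by move=> t; apply: cvgN; exact: continuous_sin.
- by move=> t; rewrite ler_norml cos_geN1 cos_le1.
- by move=> t; rewrite normrN ler_norml sin_geN1 sin_le1.
Qed.

Lemma Cb1_sin h : Cb1 dot (fun x => sin (dot h x)).
Proof.
have d (t : R) : is_derive t 1 (sin : R -> R) (cos t) by exact: is_derive_sin.
have [] // := Cb1_comp_dot h d.
- exact: continuous_cos.
- by move=> t; rewrite ler_norml sin_geN1 sin_le1.
- by move=> t; rewrite ler_norml cos_geN1 cos_le1.
Qed.

End gradient.

(** * The Borel sets of a separable Hilbert space *)

Section borel_generation.
Context {R : realType} {H : completeNormedModType R}.
Variable dot : {dot H for idfun}.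
Hypothesis hil : is_hilbert dot.

Lemma separable_dense_seq : separable H -> exists s : nat -> H,
  forall (x : H) (e : R), 0 < e -> exists n, `|x - s n| < e.
Proof.
move=> [S [/countable_injP[f finj] dS]].
exists (fun n => get [set x | S x /\ f x = n]) => x e e0.
have [] := dS (ball x e); first by exists x; exact: ballxx.
  exact: ball_open.
move=> y [xy Sy]; exists (f y).
have [Sz zy] := @getPex _ [set z | S z /\ f z = f y] (ex_intro _ y (conj Sy erefl)).
rewrite (finj _ y _ _ zy) ?inE//.
by move: xy; rewrite -ball_normE.
Qed.

Lemma continuous_borel (f : H -> R) : continuous f ->
  measurable_fun [set: borel H] (f : borel H -> R).
Proof.
move=> cf; apply: (measurability _ (@RGenOpens.measurableE R)).
move=> _ [_ [a [b ->]] <-]; rewrite setTI; apply: sub_sigma_algebra.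
by apply: open_comp => //; exact: interval_open.
Qed.

Definition half_spaces : set (set H) :=
  [set B | exists (h : H) (c : R), B = [set x | dot h x < c]].

Lemma half_space_borel h c :
  @measurable _ (borel H) [set x | dot h x < c].
Proof.
apply: sub_sigma_algebra.
rewrite (_ : [set x | _] = (dot h : H -> R) @^-1` [set t | t < c])//.
apply: open_comp; last exact: open_lt.
by move=> x _; exact: continuous_dotr.
Qed.

(** An open set is a countable union of closed balls centred on a dense
    sequence [s], and such a ball is cut out by the half-spaces orthogonal to
    the members of the sequence. *)
Lemma borel_half_spaces (sep : separable H) (B : set H) :
  @measurable _ (borel H) B -> <<s half_spaces >> B.
Proof.
have [s sP] := separable_dense_seq sep.
pose T := g_sigma_algebraType half_spaces.
have mball (a : H) (r : R) : 0 <= r ->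
    measurable ([set x | `|x - a| <= r] : set T).
  move=> r0.
  rewrite (_ : [set x | _] =
    \bigcap_n [set x | dot (s n) x <= r * `|s n| + dot (s n) a]); last first.
    apply/seteqP; split=> x /=.
      move=> xa n _ /=; rewrite -lerBlDr -dotBr.
      apply: (le_trans (ler_norm _)); apply: (le_trans (cauchy_schwarz hil _ _)).
      by rewrite mulrC ler_wpM2r.
    move=> xs; rewrite leNgt; apply/negP => rx.
    pose y := x - a; pose d := `|y| - r.
    have d0 : 0 < d by rewrite subr_gt0.
    have y0 : 0 < `|y| by exact: le_lt_trans rx.
    (* if [s n] is within [eta] of [y], then
       [<s n, y> >= |y|^2 - eta |y|] and [|s n| <= |y| + eta] *)
    pose eta := d * `|y| / (2 * (`|y| + r)).
    have yr : 0 < `|y| + r by rewrite ltr_pwDl.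
    have eta0 : 0 < eta by rewrite divr_gt0 ?mulr_gt0.
    have [n sn] := sP y eta eta0.
    have /= := xs n I; rewrite -lerBlDr -dotBr -/y => le1.
    have le2 : dot y y - dot (s n) y <= eta * `|y|.
      rewrite -dotBl; apply: (le_trans (ler_norm _)).
      apply: (le_trans (cauchy_schwarz hil _ _)).
      by rewrite ler_wpM2r// ltW.
    have le3 : `|s n| <= `|y| + eta.
      rewrite -(subrK y (s n)) addrC; apply: (le_trans (ler_normD _ _)).
      by rewrite lerD2l distrC ltW.
    have le4 : r * `|s n| <= r * (`|y| + eta) by exact: ler_wpM2l.
    move: le2; rewrite hil => le2.
    have : `|y| ^+ 2 <= r * (`|y| + eta) + eta * `|y| by lra.
    have -> : r * (`|y| + eta) + eta * `|y| = r * `|y| + d * `|y| / 2.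
      by rewrite /eta; field; rewrite gt_eqF.
    have arith (N : R) : 0 < (N - r) * N ->
        N ^+ 2 <= r * N + (N - r) * N / 2 -> False by rewrite expr2; lra.
    by apply: arith; exact: mulr_gt0.
  apply: bigcapT_measurable => n.
  rewrite (_ : [set x | _] = \bigcap_k [set x |
    dot (s n) x < r * `|s n| + dot (s n) a + k.+1%:R^-1]).
    apply: bigcapT_measurable => k; apply: sub_sigma_algebra.
    by exists (s n), (r * `|s n| + dot (s n) a + k.+1%:R^-1).
  apply/seteqP; split=> x /=.
    by move=> xn k _ /=; rewrite (le_lt_trans xn)// ltrDl.
  move=> xk; apply/ler_addgt0Pr => e e0.
  have [N _ NP] := near_infty_natSinv_lt (PosNum e0).
  apply: ltW; apply: (lt_le_trans (xk N I)).
  by rewrite lerD2l ltW//; apply: NP => /=.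
move=> mB; suff : @open H `<=` <<s half_spaces >>.
  move=> oG; apply: (smallest_sub _ oG) mB; exact: smallest_sigma_algebra.
move=> U oU.
rewrite (_ : U = \bigcup_n \bigcup_(k in [set k | [set x | `|x - s n| <= k.+1%:R^-1] `<=` U])
  [set x | `|x - s n| <= k.+1%:R^-1]).
  apply: (@bigcupT_measurable _ T) => n.
  apply: (@bigcup_measurable _ T) => k _; exact: mball.
apply/seteqP; split=> x; last by move=> [n _ [k kU]]; exact: kU.
move=> Ux; have := oU; rewrite openE => /(_ _ Ux).
rewrite /interior/= nbhs_ballP => -[e /= e0 xeU].
have [k _ kP] := near_infty_natSinv_lt (PosNum (divr_gt0 e0 (ltr0n R 2))).
have [n xn] := sP x k.+1%:R^-1 ltac:(by []).
have ke := kP k (leqnn k); rewrite /= in ke.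
exists n => //; exists k => /=; last exact: ltW.
move=> y/= yn; apply: xeU; rewrite -ball_normE/=.
rewrite -(subrK (s n) x) -addrA; apply: (le_lt_trans (ler_normD _ _)).
rewrite (splitr e); apply: ltrD; first exact: lt_trans ke.
by apply: le_lt_trans ke; rewrite distrC.
Qed.

(** By [borel_half_spaces], a map is Borel as soon as its composition with every
    continuous linear form is. *)
Lemma measurable_to_borel (sep : separable H) d (T : measurableType d)
    (f : T -> H) : (forall h, measurable_fun setT (fun x => dot h (f x))) ->
  measurable_fun setT (f : T -> borel H).
Proof.
move=> mf; apply: (@measurability _ _ T (borel H) setT f half_spaces).
  apply/seteqP; split; first by move=> B; exact: borel_half_spaces.
  apply: smallest_sub; first exact: (@sigma_algebra_measurable _ (borel H)).
  by move=> _ [h [c ->]]; exact: half_space_borel.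
move=> _ [_ [h [c ->]] <-].
rewrite (_ : _ @^-1` _ = (fun x => dot h (f x)) @^-1` `]-oo, c[%classic).
  exact: mf.
by apply/seteqP; split => x /=; rewrite in_itv.
Qed.

End borel_generation.

(** * A monotone class theorem for trigonometric functions *)

Section trigonometric_class.
Context {R : realType} {H : completeNormedModType R}.
Variable dot : {dot H for idfun}.
Hypothesis hil : is_hilbert dot.

Inductive trig_poly : (H -> R) -> Prop :=
| trig_cos h : trig_poly (fun x => cos (dot h x))
| trig_sin h : trig_poly (fun x => sin (dot h x))
| trig_lin (a : R) f g : trig_poly f -> trig_poly g ->
    trig_poly (fun x => a * f x + g x).

Lemma trig_poly_cst (a : R) : trig_poly (fun=> a).
Proof.
rewrite (_ : (fun=> a) = fun x => (a - 1) * cos (dot 0 x) + cos (dot 0 x)).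
  by apply: trig_lin; exact: trig_cos.
by apply/funext => x; rewrite dot0l cos0; ring.
Qed.

Lemma trig_poly_scale (a : R) f : trig_poly f -> trig_poly (fun x => a * f x).
Proof.
move=> tf; rewrite (_ : (fun x => _) = fun x => a * f x + 0).
  by apply: trig_lin => //; exact: trig_poly_cst.
by apply/funext => x; rewrite addr0.
Qed.

Lemma trig_poly_add f g : trig_poly f -> trig_poly g ->
  trig_poly (fun x => f x + g x).
Proof.
move=> tf tg; rewrite (_ : (fun x => _) = fun x => 1 * f x + g x).
  exact: trig_lin.
by apply/funext => x; rewrite mul1r.
Qed.

(** Products of cosines and sines are linearised by the addition formulas, which
    is what makes [trig_sets] below a pi-system. *)
Lemma trig_poly_mul f g : trig_poly f -> trig_poly g ->
  trig_poly (fun x => f x * g x).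
Proof.
have lin (u : H -> R) : (forall h, trig_poly (fun x => u x * cos (dot h x))) ->
    (forall h, trig_poly (fun x => u x * sin (dot h x))) ->
    forall v, trig_poly v -> trig_poly (fun x => u x * v x).
  move=> uc us v; elim=> // a v1 v2 _ t1 _ t2.
  rewrite (_ : (fun x => _) = fun x => a * (u x * v1 x) + u x * v2 x).
    exact: trig_lin.
  by apply/funext => x; ring.
have cc h k : trig_poly (fun x => cos (dot h x) * cos (dot k x)).
  rewrite (_ : (fun x => _) =
    fun x => 2^-1 * cos (dot (h + k) x) + 2^-1 * cos (dot (h - k) x)).
    apply: trig_lin; first exact: trig_cos.
    apply: trig_poly_scale; exact: trig_cos.
  by apply/funext => x; rewrite dotDl dotBl cosD cosB; field.
have cs h k : trig_poly (fun x => cos (dot h x) * sin (dot k x)).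
  rewrite (_ : (fun x => _) =
    fun x => 2^-1 * sin (dot (h + k) x) + (- 2^-1) * sin (dot (h - k) x)).
    apply: trig_lin; first exact: trig_sin.
    apply: trig_poly_scale; exact: trig_sin.
  by apply/funext => x; rewrite dotDl dotBl sinD sinB; field.
have ss h k : trig_poly (fun x => sin (dot h x) * sin (dot k x)).
  rewrite (_ : (fun x => _) =
    fun x => 2^-1 * cos (dot (h - k) x) + (- 2^-1) * cos (dot (h + k) x)).
    apply: trig_lin; first exact: trig_cos.
    apply: trig_poly_scale; exact: trig_cos.
  by apply/funext => x; rewrite dotBl dotDl cosB cosD; field.
have comm (u v : H -> R) : trig_poly (fun x => u x * v x) ->
    trig_poly (fun x => v x * u x).
  by rewrite (_ : (fun x => v x * u x) = fun x => u x * v x)//;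
    apply/funext => x; rewrite mulrC.
by move=> tf tg; apply: (lin) => // h; apply: (comm); apply: (lin) => // k;
  apply: (comm).
Qed.

Lemma trig_poly_exp f n : trig_poly f -> trig_poly (fun x => f x ^+ n).
Proof.
move=> tf; elim: n => [|n IHn]; first exact: trig_poly_cst.
under eq_fun do rewrite exprS; exact: trig_poly_mul.
Qed.

Lemma bernoulli_inequality (x : R) m : 0 <= x -> 1 + m%:R * x <= (1 + x) ^+ m.
Proof.
move=> x0; elim: m => [|m IHm]; first by rewrite mul0r addr0 expr0.
rewrite exprS; apply: le_trans (ler_wpM2l _ IHm); last by rewrite addr_ge0.
rewrite -natr1.
have : 0 <= m%:R * x ^+ 2 by rewrite mulr_ge0// sqr_ge0.
rewrite expr2; lra.
Qed.

(** With [r = sqrt q], Bernoulli's inequality bounds [n r^n], hence [n q^n] is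
    [O(r^n)]. *)
Lemma natmul_exp_cvg0 (q : R) : 0 <= q -> q < 1 ->
  n%:R * q ^+ n @[n --> \oo] --> (0 : R).
Proof.
move=> q0 q1.
pose r := Num.sqrt q.
have r0 : 0 <= r by exact: sqrtr_ge0.
have rq : r ^+ 2 = q by exact: sqr_sqrtr.
have r1 : r < 1 by rewrite -(@ltr_pXn2r _ 2) ?nnegrE// rq expr1n.
have [rz|rn0] := eqVneq r 0.
  have qz : q = 0 by rewrite -rq rz expr0n.
  apply: cvg_near_cst; exists 1%N => // n /= n1.
  by rewrite qz expr0n gtn_eqF// mulr0.
have rp : 0 < r by rewrite lt_neqAle eq_sym rn0.
pose c := r^-1 - 1.
have c0 : 0 < c by rewrite subr_gt0 invf_gt1.
have bern n : n%:R * c <= r^-1 ^+ n.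
  have h := bernoulli_inequality n (ltW c0).
  rewrite (_ : r^-1 = 1 + c); last by rewrite /c; ring.
  by apply: le_trans h; rewrite lerDr.
have nr n : n%:R * r ^+ n <= c^-1.
  rewrite -(@ler_pM2r _ c)// mulVf ?gt_eqF//.
  rewrite mulrAC -ler_pdivlMr ?exprn_gt0// mul1r -exprVn; exact: bern.
apply: (@squeeze_cvgr _ _ _ _ (fun=> 0) (fun n => c^-1 * r ^+ n)).
- near=> n; rewrite mulr_ge0 ?exprn_ge0//=.
  rewrite -rq -exprM mulnC exprM expr2 mulrA.
  rewrite ler_wpM2r ?exprn_ge0//; exact: nr.
- exact: cvg_cst.
- rewrite -[0](mulr0 c^-1); apply: cvgMr.
  by apply: cvg_expr; rewrite ger0_norm.
Unshelve. all: by end_near. Qed.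

(** The polynomials [(1 - t^n)^(n 2^n)] converge boundedly on [0, 1] to the
    indicator of [0, 1/2); the extra factor [n] in the exponent kills the limit
    at [t = 1/2]. *)
Lemma step_approximation (t : R) : 0 <= t <= 1 ->
  (1 - t ^+ n) ^+ (n * 2 ^ n) @[n --> \oo] --> ((t < 2^-1)%R%:R : R).
Proof.
move=> /andP[t0 t1].
have e01 n : 0 <= 1 - t ^+ n <= 1.
  by rewrite subr_ge0 exprn_ile1//= lerBlDr lerDl exprn_ge0.
have bern' (x : R) m : 0 <= x <= 1 -> 1 - m%:R * x <= (1 - x) ^+ m.
  move=> /andP[x0 x1]; elim: m => [|m IHm]; first by rewrite mul0r subr0 expr0.
  rewrite exprS; apply: le_trans (ler_wpM2l _ IHm); last by rewrite subr_ge0.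
  rewrite -natr1.
  have : 0 <= m%:R * x ^+ 2 by rewrite mulr_ge0// sqr_ge0.
  rewrite expr2; lra.
have [th|th] := ltP t 2^-1.
  apply: (@squeeze_cvgr _ _ _ _ (fun n => 1 - n%:R * (2 * t) ^+ n) (fun=> 1)).
  - near=> n; have /andP[a b] := e01 n; rewrite exprn_ile1// andbT.
    apply: le_trans (bern' _ _ _); last by rewrite exprn_ge0//= exprn_ile1.
    by rewrite natrM natrX exprMn mulrA.
  - rewrite -[X in _ --> X]subr0; apply: cvgB; first exact: cvg_cst.
    by apply: natmul_exp_cvg0; [rewrite mulr_ge0|lra].
  - exact: cvg_cst.
apply: (@squeeze_cvgr _ _ _ _ (fun=> 0) (fun n => n.+1%:R^-1)).
- near=> n; have /andP[a b] := e01 n; rewrite exprn_ge0//=.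
  have t2 : (2^-1 : R) ^+ n <= t ^+ n by rewrite lerXn2r ?nnegrE.
  have inv2 : (0 : R) <= 2^-1 ^+ n by rewrite exprn_ge0.
  apply: (@le_trans _ _ ((1 + 2^-1 ^+ n) ^+ (n * 2 ^ n))^-1).
    have p1 : 0 <= 1 + (2^-1 : R) ^+ n by rewrite addr_ge0.
    rewrite -exprVn lerXn2r ?nnegrE ?a ?invr_ge0//.
    rewrite -[leRHS]mul1r ler_pdivlMr ?ltr_pwDl//.
    have : 0 <= (t ^+ n - 2^-1 ^+ n) by rewrite subr_ge0.
    have : 0 <= t ^+ n * 2^-1 ^+ n by rewrite mulr_ge0 ?exprn_ge0.
    nra.
  rewrite lef_pV2 ?posrE ?exprn_gt0 ?ltr_pwDl//.
  apply: le_trans (bernoulli_inequality _ inv2).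
  by rewrite natrM natrX -mulrA -exprMn divff// expr1n mulr1 -natr1 addrC.
- exact: cvg_cst.
- by move/cvgrPdist_lt: (@cvg_harmonic R) => h; apply/cvgrPdist_lt.
Unshelve. all: by end_near. Qed.

(** Sets whose indicator is the limit of trigonometric polynomials with values
    in [0, 1]: they form a pi-system. *)
Definition trig_sets : set (set H) := [set B | exists f : nat -> H -> R,
  [/\ forall n, trig_poly (f n), forall n x, 0 <= f n x <= 1 &
      forall x, f n x @[n --> \oo] --> (\1_B x : R)]].

Lemma trig_sets_setI : setI_closed trig_sets.
Proof.
move=> A B [f [tf f01 fA]] [g [tg g01 gB]].
exists (fun n x => f n x * g n x); split.
- by move=> n; exact: trig_poly_mul.
- move=> n x; have /andP[a b] := f01 n x; have /andP[c d] := g01 n x.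
  by rewrite mulr_ge0//= mulr_ile1.
- by move=> x; rewrite indicI; apply: cvgM; [exact: fA|exact: gB].
Qed.

(** [step_approximation] applies to [(1 + sin (<h, x> - c)) / 2], a trigonometric
    polynomial with values in [0, 1]. *)
Lemma trig_sets_sin (h : H) (c : R) :
  trig_sets [set x | sin (dot h x - c) < 0].
Proof.
pose t x := 2^-1 * (1 + sin (dot h x - c)).
have tt : trig_poly t.
  apply: trig_poly_scale; apply: trig_poly_add; first exact: trig_poly_cst.
  rewrite (_ : (fun x => _) =
    fun x => cos c * sin (dot h x) + (- sin c) * cos (dot h x)).
    by apply: trig_lin; [exact: trig_sin|apply: trig_poly_scale; exact: trig_cos].
  by apply/funext => x; rewrite sinB; ring.
have t01 x : 0 <= t x <= 1.
  have := sin_geN1 (dot h x - c); have := sin_le1 (dot h x - c).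
  by rewrite /t => a b; apply/andP; split; lra.
exists (fun n x => (1 - t x ^+ n) ^+ (n * 2 ^ n)); split.
- move=> n; apply: trig_poly_exp.
  rewrite (_ : (fun x => _) = fun x => (-1) * t x ^+ n + 1).
    by apply: trig_lin; [exact: trig_poly_exp|exact: trig_poly_cst].
  by apply/funext => x; ring.
- move=> n x; have /andP[a b] := t01 x.
  have e : 0 <= 1 - t x ^+ n <= 1.
    by rewrite subr_ge0 exprn_ile1//= lerBlDr lerDl exprn_ge0.
  by case/andP: e => e1 e2; rewrite exprn_ge0//= exprn_ile1.
- move=> x; have := step_approximation (t01 x).
  rewrite indicE mem_setE /= (_ : (t x < 2^-1) = (sin (dot h x - c) < 0))//.
  by rewrite /t; apply/idP/idP; lra.
Qed.

(** The sine is not injective, but a half-space is recovered from the signs of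
    [sin ((<h, x> - c) / n)] for all large [n]. *)
Lemma half_spaces_trig_sets : half_spaces dot `<=` <<s trig_sets >>.
Proof.
move=> _ [h [c ->]].
pose T := g_sigma_algebraType trig_sets.
pose S n : set T := [set x | sin (dot (n.+1%:R^-1 *: h) x - n.+1%:R^-1 * c) < 0].
have mS n : measurable (S n).
  by apply: sub_sigma_algebra; exact: trig_sets_sin.
rewrite (_ : [set x | _] = \bigcup_m \bigcap_(n in [set n | (m <= n)%N]) S n).
  apply: (@bigcupT_measurable _ T) => m.
  by apply: (@bigcap_measurable _ T) => //; exists m => /=.
have small y : exists m, forall n, (m <= n)%N -> `|n.+1%:R^-1 * y| < pi :> R.
  have y1 : 0 < `|y| + 1 by rewrite ltr_wpDl.
  have p0 : 0 < pi / (`|y| + 1) :> R by rewrite divr_gt0 ?pi_gt0.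
  have [m _ mP] := near_infty_natSinv_lt (PosNum p0).
  exists m => n mn; have /= := mP n mn.
  rewrite (ltr_pdivlMr _ _ y1) => le.
  apply: le_lt_trans le; rewrite normrM ger0_norm ?invr_ge0//.
  by rewrite ler_wpM2l ?invr_ge0// lerDl.
have E x n : dot (n.+1%:R^-1 *: h) x - n.+1%:R^-1 * c =
    n.+1%:R^-1 * (dot h x - c) by rewrite dotZl mulrBr.
apply/seteqP; split=> x /=.
  move=> xc; have [m mP] := small (dot h x - c).
  exists m => // n /= mn; rewrite /S /= E.
  have := mP n mn; set y := _ * _.
  have y0 : y < 0 by rewrite /y pmulr_rlt0 ?invr_gt0// subr_lt0.
  rewrite ltr0_norm// => ypi.
  by rewrite -oppr_gt0 -sinN sin_gt0_pi// oppr_gt0 y0.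
move=> [m _ xm]; rewrite ltNge; apply/negP => cx.
have [m' mP] := small (dot h x - c).
have := xm (maxn m m') (leq_maxl _ _); rewrite /S /= E.
have := mP (maxn m m') (leq_maxr _ _); set y := _ * _ => ypi.
have y0 : 0 <= y by rewrite mulr_ge0 ?invr_ge0// subr_ge0.
rewrite ltNge sin_ge0_pi// y0/= ltW//.
by move: ypi; rewrite ger0_norm.
Qed.

(** Functional monotone class theorem for the exponentials [e^(i <h, .>)]:
    this is how identities between Gaussian integrals, which are readily checked
    on these exponentials, are extended to all Borel sets. *)
Lemma trig_monotone_class (sep : separable H) (C : (H -> R) -> Prop) :
  (forall h, C (fun x => cos (dot h x))) ->
  (forall h, C (fun x => sin (dot h x))) ->
  (forall (a : R) f g, C f -> C g -> C (fun x => a * f x + g x)) ->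
  (forall (f : nat -> H -> R) g M, (forall n, C (f n)) ->
     (forall n x, `|f n x| <= M) ->
     (forall x, f n x @[n --> \oo] --> g x) -> C g) ->
  forall B : set H, @measurable _ (borel H) B -> C \1_B.
Proof.
move=> Ccos Csin Clin Clim.
have Ctrig f : trig_poly f -> C f by elim=> //; eauto.
have Cset : trig_sets `<=` [set B | C \1_B].
  move=> B [f [tf f01 fB]]; apply: (Clim f _ 1) => //.
    by move=> n; exact: Ctrig.
  by move=> n x; have /andP[a b] := f01 n x; rewrite ger0_norm.
have lam : lambda_system setT [set B | C \1_B].
  split=> //.
  - rewrite /= indicT; exact/Ctrig/trig_poly_cst.
  - move=> A B BA CA CB /=.
    rewrite (_ : \1_(A `\` B) = fun x => (-1) * \1_B x + \1_A x); first exact: Clin.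
    apply/funext => x; rewrite !indicE in_setD.
    have [xB|xB] := boolP (x \in B); last by rewrite andbT mulr0 add0r.
    by rewrite andbF (mem_set (BA _ (set_mem xB))) mulr1 addNr.
  - move=> F ndF CF /=; apply: (Clim (fun n => \1_(F n)) _ 1) => //.
      by move=> n x; rewrite indicE; case: (_ \in _); rewrite ?normr1 ?normr0.
    move=> x; have [[n _ Fnx]|nF] := pselect ((\bigcup_n F n) x).
      apply: cvg_near_cst; exists n => // m /= nm.
      rewrite !indicE !mem_set//; first by exists n.
      by move/subsetPset: (ndF n m nm); exact.
    apply: cvg_near_cst; exists 0%N => // m _.
    rewrite !indicE !memNset// => Fmx; apply: nF; by exists m.
move=> B /(borel_half_spaces hil sep) mB.
apply: (@lambda_system_subset _ _ trig_sets_setI setT _ lam Cset) => //.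
apply: (smallest_sub _ half_spaces_trig_sets) mB.
exact: smallest_sigma_algebra.
Qed.

End trigonometric_class.

(** * Integration *)

Section integration_toolbox.
Context d (T : measurableType d) {R : realType}.
Variable mu : {measure set T -> \bar R}.
Local Notation integrable f := (mu.-integrable setT (EFin \o f)).

Lemma integrable_scale (a : R) (f : T -> R) : integrable f ->
  integrable (fun x => a * f x).
Proof.
move=> fi; rewrite (_ : EFin \o _ = (fun x => a%:E * (EFin \o f) x))%E//.
exact: integrableZl.
Qed.

Lemma integrable_lin (a : R) (f g : T -> R) : integrable f -> integrable g ->
  integrable (fun x => a * f x + g x).
Proof.
move=> fi gi; rewrite (_ : EFin \o _ = (fun x => a%:E * (EFin \o f) x) \+ (EFin \o g))%E.
  by apply: integrableD => //; exact: integrableZl.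
by apply/funext => x /=; rewrite EFinD EFinM.
Qed.

Lemma Rintegral_lin (a : R) (f g : T -> R) : integrable f -> integrable g ->
  \int[mu]_x (a * f x + g x) = a * \int[mu]_x f x + \int[mu]_x g x.
Proof.
move=> fi gi; rewrite RintegralD//; first by rewrite RintegralZl.
exact: integrable_scale.
Qed.

Lemma integrable_measurable (f : T -> R) : integrable f -> measurable_fun setT f.
Proof. by move=> /measurable_int /measurable_EFinP. Qed.

Lemma integrable_le (f g : T -> R) : measurable_fun setT f -> integrable g ->
  (forall x, `|f x| <= g x) -> integrable f.
Proof.
move=> mf gi fg; apply: (le_integrable _ _ _ gi) => //.
  exact/measurable_EFinP.
move=> x _ /=; rewrite lee_fin (le_trans (fg x))//; exact: ler_norm.
Qed.

Lemma integrable_mul_bounded (f g : T -> R) (M : R) : integrable f ->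
  measurable_fun setT g -> (forall x, `|g x| <= M) ->
  integrable (fun x => f x * g x).
Proof.
move=> fi mg gM; apply: (@integrable_le _ (fun x => M * `|f x|)).
- by apply: measurable_funM => //; exact: integrable_measurable.
- apply: integrable_scale; exact: integrable_norm.
- by move=> x; rewrite normrM mulrC ler_wpM2r.
Qed.

Lemma Rintegral_cvg (f : nat -> T -> R) (g G : T -> R) :
  (forall n, measurable_fun setT (f n)) -> integrable G ->
  (forall n x, `|f n x| <= G x) -> (forall x, f n x @[n --> \oo] --> g x) ->
  integrable g /\ \int[mu]_x f n x @[n --> \oo] --> \int[mu]_x g x.
Proof.
move=> mf Gi fG fg.
have mg : measurable_fun setT g.
  by apply: (@measurable_fun_cvg _ _ _ _ f) => // x _; exact: fg.
have efg x : [set: T] x -> (f n x)%:E @[n --> \oo] --> (g x)%:E.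
  by move=> _; apply: cvg_EFin; [exact: nearW|exact: fg].
have [gi _ cv] := @dominated_convergence _ _ _ mu setT measurableT
  (fun n => EFin \o f n) (EFin \o g) (EFin \o G)
  (fun n => (measurable_EFinP _ _).2 (mf n)) ((measurable_EFinP _ _).2 mg)
  (aeW _ efg) Gi (aeW _ (fun x n _ => fG n x)).
split=> //; apply: fine_cvg; rewrite fineK//.
exact: integrable_fin_num.
Qed.

Lemma Rintegral_le (f g : T -> R) : integrable f -> integrable g ->
  (forall x, f x <= g x) -> \int[mu]_x f x <= \int[mu]_x g x.
Proof. by move=> fi gi fg; apply: le_Rintegral. Qed.

(** The quadratic bound [2 |a b| <= e a^2 + b^2 / e], integrated: a
    Cauchy-Schwarz inequality that is free of square roots. *)
Lemma Rintegral_young (e : R) (f g : T -> R) : 0 < e ->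
  measurable_fun setT f -> measurable_fun setT g ->
  integrable (fun x => f x ^+ 2) -> integrable (fun x => g x ^+ 2) ->
  integrable (fun x => f x * g x) /\
  `|\int[mu]_x (f x * g x)| <=
    e * \int[mu]_x (f x ^+ 2) + e^-1 * \int[mu]_x (g x ^+ 2).
Proof.
move=> e0 mf mg f2 g2.
have b x : `|f x * g x| <= e * f x ^+ 2 + e^-1 * g x ^+ 2.
  rewrite normrM.
  have h : 0 <= (e * `|f x| - `|g x|) ^+ 2 / e by rewrite divr_ge0 ?sqr_ge0// ltW.
  have e1 : (e * `|f x| - `|g x|) ^+ 2 / e =
      e * `|f x| ^+ 2 - 2 * (`|f x| * `|g x|) + e^-1 * `|g x| ^+ 2.
    by field; rewrite gt_eqF.
  rewrite e1 !real_normK ?num_real// in h.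
  have := normr_ge0 (f x); have := normr_ge0 (g x) => g0 f0.
  have : 0 <= `|f x| * `|g x| by rewrite mulr_ge0.
  lra.
have gi : integrable (fun x => e * f x ^+ 2 + e^-1 * g x ^+ 2).
  apply: integrable_lin => //.
  exact: integrable_scale.
have fgi : integrable (fun x => f x * g x).
  by apply: (integrable_le _ gi) => //; exact: measurable_funM.
split=> //; apply: (le_trans (le_normr_Rintegral measurableT fgi)).
apply: (@le_trans _ _ (\int[mu]_x (e * f x ^+ 2 + e^-1 * g x ^+ 2))).
  by apply: Rintegral_le => //; exact: integrable_norm.
rewrite Rintegral_lin//; last first.
  exact: integrable_scale.
by rewrite RintegralZl.
Qed.

End integration_toolbox.

Section finite_measure_toolbox.
Context d (T : measurableType d) {R : realType}.
Variable mu : {finite_measure set T -> \bar R}.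

Lemma integrable_bounded (f : T -> R) (M : R) :
  measurable_fun setT f -> (forall x, `|f x| <= M) ->
  mu.-integrable setT (EFin \o f).
Proof.
move=> mf fM; apply: (@integrable_le _ _ _ _ _ (fun=> M)) => //.
exact: finite_measure_integrable_cst.
Qed.

Lemma integrable_of_sqr (f : T -> R) : measurable_fun setT f ->
  mu.-integrable setT (EFin \o (fun x => f x ^+ 2)) ->
  mu.-integrable setT (EFin \o f).
Proof.
move=> mf f2; apply: (@integrable_le _ _ _ _ _ (fun x => 1 * f x ^+ 2 + 1)) => //.
  by apply: integrable_lin => //; exact: finite_measure_integrable_cst.
move=> x; rewrite mul1r -(real_normK (num_real (f x))).
have := normr_ge0 (f x); set a : R := `|f x| => a0.
have : 0 <= (a - 2^-1) ^+ 2 by rewrite sqr_ge0.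
rewrite sqrrB expr2; lra.
Qed.

Lemma Rintegral_bounded_cvg (f : nat -> T -> R) (g : T -> R) (M : R) :
  (forall n, measurable_fun setT (f n)) -> (forall n x, `|f n x| <= M) ->
  (forall x, f n x @[n --> \oo] --> g x) ->
  \int[mu]_x f n x @[n --> \oo] --> \int[mu]_x g x.
Proof.
move=> mf bf fg; apply: (@Rintegral_cvg _ _ _ _ f g (fun=> M) _ _ _ _).2 => //.
exact: finite_measure_integrable_cst.
Qed.

End finite_measure_toolbox.

Section pushforward_toolbox.
Context d d' (T : measurableType d) (U : measurableType d') {R : realType}.
Variables (mu : {measure set T -> \bar R}) (nu : {measure set U -> \bar R}).
Variable phi : T -> U.
Hypothesis mphi : measurable_fun setT phi.
Hypothesis law : forall B, measurable B -> nu B = mu (phi @^-1` B).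

Lemma ge0_integral_law (f : U -> \bar R) : measurable_fun setT f ->
  (forall x, 0 <= f x)%E -> (\int[nu]_y f y = \int[mu]_x f (phi x))%E.
Proof.
move=> mf f0.
rewrite (@eq_measure_integral _ _ _ setT (pushforward mu phi)); last first.
  by move=> A mA _; rewrite /pushforward law.
by rewrite ge0_integral_pushforward.
Qed.

Lemma integrable_law (f : U -> R) : measurable_fun setT f ->
  nu.-integrable setT (EFin \o f) <->
  mu.-integrable setT (EFin \o (fun x => f (phi x))).
Proof.
move=> mf.
have E : (\int[nu]_y `|(f y)%:E| = \int[mu]_x `|(f (phi x))%:E|)%E.
  by apply: (@ge0_integral_law (fun y => `|(f y)%:E|%E)) => //;
    apply: measurableT_comp => //; exact/measurable_EFinP.
split=> /integrableP[_ fi]; apply/integrableP; split.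
- apply/measurable_EFinP; exact: measurableT_comp.
- by rewrite -E.
- exact/measurable_EFinP.
- by rewrite E.
Qed.

Lemma Rintegral_law (f : U -> R) : measurable_fun setT f ->
  nu.-integrable setT (EFin \o f) ->
  \int[nu]_y f y = \int[mu]_x f (phi x).
Proof.
move=> mf fi; rewrite /Rintegral; congr fine.
rewrite (@eq_measure_integral _ _ _ setT (pushforward mu phi)); last first.
  by move=> A mA _; rewrite /pushforward law.
rewrite integral_pushforward//; first exact/measurable_EFinP.
by have := (integrable_law mf).1 fi.
Qed.

End pushforward_toolbox.

(** * Normal laws *)

Section normal_law.
Context {R : realType}.
Local Notation leb := (@lebesgue_measure R).

(** The normal density is a Radon-Nikodym derivative of the normal law. *)
Lemma integral_normal (m s : R) (f : R -> R) : s != 0 ->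
  measurable_fun setT f ->
  (normal_prob m s).-integrable setT (EFin \o f) ->
  (\int[normal_prob m s]_x (f x)%:E =
   \int[leb]_x (f x * normal_pdf m s x)%:E)%E.
Proof.
move=> s0 mf fi.
rewrite -(Radon_Nikodym_change_of_variables (normal_prob_dominates m s))//=.
have mp : measurable_fun setT (fun x => (normal_pdf m s x)%:E).
  by apply/measurable_EFinP; exact: measurable_normal_pdf.
apply: ae_eq_integral => //.
- apply: emeasurable_funM; first exact/measurable_EFinP.
  apply: (measurable_int leb).
  by apply: Radon_Nikodym_integrable; exact: normal_prob_dominates.
- by apply/measurable_EFinP; apply: measurable_funM => //;
    exact: measurable_normal_pdf.
- under [X in ae_eq _ _ _ X]eq_fun do rewrite EFinM.
  apply: ae_eqe_mul2l => /=.
  rewrite Radon_NikodymE//=; first exact: normal_prob_dominates.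
  move=> nd; case: cid => /= h [h1 h2 h3].
  apply: integral_ae_eq => //=.
  by move=> E _ mE; rewrite -h3.
Qed.

Lemma Rintegral_normal (m s : R) (f : R -> R) : s != 0 ->
  measurable_fun setT f ->
  (normal_prob m s).-integrable setT (EFin \o f) ->
  leb.-integrable setT (EFin \o (fun x => f x * normal_pdf m s x)) /\
  \int[normal_prob m s]_x f x = \int[leb]_x (f x * normal_pdf m s x).
Proof.
move=> s0 mf fi; split; last by rewrite /Rintegral integral_normal.
apply/integrableP; split.
  by apply/measurable_EFinP; apply: measurable_funM => //;
    exact: measurable_normal_pdf.
have /integrableP[_] := fi.
rewrite -[X in (X < _)%E]/(\int[normal_prob m s]_x (`|f x|%R)%:E)%E.
rewrite integral_normal//; last 2 first.
- exact: measurableT_comp.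
- exact: integrable_norm.
apply: le_lt_trans; rewrite le_eqVlt; apply/orP; left; apply/eqP.
apply: eq_integral => x _ /=.
by rewrite normrM (ger0_norm (normal_pdf_ge0 _ _ _)).
Qed.

Lemma is_derive_normal_pdf (m s x : R) : s != 0 ->
  is_derive x 1 (normal_pdf m s) (- ((x - m) / s ^+ 2) * normal_pdf m s x).
Proof.
move=> s0; rewrite normal_pdfE//.
rewrite /normal_fun.
set K := normal_peak s.
have -> : (fun y : R => K * expR (- (y - m) ^+ 2 / (s ^+ 2 *+ 2))) =
    (fun y : R => K * (expR \o (fun y => (- (s ^+ 2 *+ 2)^-1) * (y - m) ^+ 2)) y).
  by apply/funext => y /=; congr (_ * expR _); rewrite mulNr mulNr mulrC.
apply: is_derive_eq => /=.
have -> : expR (- (x - m) ^+ 2 / (s ^+ 2 *+ 2)) =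
    expR (- (s ^+ 2 *+ 2)^-1 * (x - m) ^+ 2).
  by congr expR; rewrite !mulNr mulrC.
have arith (k E S y : R) : S != 0 ->
    k * (E * (- (S *+ 2)^-1 * (y * (1 - 0) + y * (1 - 0)))) = - (y / S) * (k * E).
  by move=> S0; rewrite -mulr_natl; field.
by apply: arith; rewrite sqrf_eq0.
Qed.

(** [e^(-u) <= 1 / (1 + u)] is all the decay that is needed below. *)
Lemma normal_pdf_decay (m s x : R) : s != 0 -> x != m ->
  normal_pdf m s x <= normal_peak s * (s ^+ 2 *+ 2) / (x - m) ^+ 2.
Proof.
move=> s0 xm; rewrite normal_pdfE// /normal_fun -mulrA ler_wpM2l ?normal_peak_ge0//.
set S := s ^+ 2 *+ 2; set y := (x - m) ^+ 2.
have S0 : 0 < S by rewrite mulrn_wgt0// exprn_even_gt0.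
have y0 : 0 < y by rewrite exprn_even_gt0//= subr_eq0.
rewrite mulNr expRN -[leRHS]invrK lef_pV2 ?posrE ?expR_gt0 ?invr_gt0 ?divr_gt0//.
rewrite invf_div; apply: le_trans (expR_ge1Dx _); by rewrite lerDr.
Qed.

(** Integration by parts against a normal density, which decays fast enough at
    infinity to absorb functions of linear growth. *)
Lemma normal_stein (m s C : R) (F dF : R -> R) : s != 0 ->
  (forall x : R, is_derive x 1 F (dF x)) -> continuous dF ->
  (forall x, `|F x| <= C * (1 + `|x|)) ->
  (normal_prob m s).-integrable setT (EFin \o (fun x => (x - m) * F x)) ->
  (normal_prob m s).-integrable setT (EFin \o dF) ->
  \int[normal_prob m s]_x ((x - m) * F x) = s ^+ 2 * \int[normal_prob m s]_x dF x.
Proof.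
move=> s0 dFE cdF bF i1 i2.
have cF : continuous F.
  move=> x; apply/differentiable_continuous/derivable1_diffP.
  by case: (dFE x).
have mF : measurable_fun setT F by exact: continuous_measurable_fun.
have mxF : measurable_fun [set: R] (fun x : R => (x - m) * F x).
  by apply: measurable_funM => //; apply: measurable_funB.
have mdF : measurable_fun setT dF by exact: continuous_measurable_fun.
have [j1 ->] := Rintegral_normal s0 mxF i1.
have [j2 ->] := Rintegral_normal s0 mdF i2.
set p := normal_pdf m s in j1 j2 *.
pose G (x : R) := s ^+ 2 * (F x * p x).
pose g (x : R) := s ^+ 2 * (dF x * p x) - (x - m) * F x * p x.
have cp : continuous p by exact: continuous_normal_pdf.
have dG (x : R) : is_derive x 1 G (g x).
  have dp := @is_derive_normal_pdf m s x s0.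
  have dFx := dFE x.
  rewrite /G; apply: is_derive_eq; rewrite /g /GRing.scale/= -/p.
  by field.
have cg : continuous g.
  move=> x; apply: cvgB.
    apply: cvgM; first exact: cvg_cst.
    by apply: cvgM; [exact: cdF|exact: cp].
  apply: cvgM; last exact: cp.
  apply: cvgM; last exact: cF.
  by apply: cvgB => //; exact: cvg_cst.
have gi : leb.-integrable setT (EFin \o g).
  rewrite (_ : g = fun x => (-1) * ((x - m) * F x * p x) + s ^+ 2 * (dF x * p x)).
    by apply: integrable_lin => //; exact: integrable_scale.
  by apply/funext => x; rewrite /g; ring.
have -> : \int[leb]_x ((x - m) * F x * p x) =
    s ^+ 2 * \int[leb]_x (dF x * p x) - \int[leb]_x g x.
  have -> : \int[leb]_x g x = (-1) * \int[leb]_x ((x - m) * F x * p x) +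
      s ^+ 2 * \int[leb]_x (dF x * p x).
    rewrite -RintegralZl// -Rintegral_lin//; last exact: integrable_scale.
    by apply: eq_Rintegral => x _; rewrite /g; ring.
  ring.
(* [g] is the derivative of [G], which vanishes at infinity *)
suff -> : \int[leb]_x g x = 0 by rewrite subr0.
pose I n : set R := `[- n.+1%:R, n.+1%:R]%classic.
have mI n : measurable (I n) by exact: measurable_itv.
have [_ c1] : leb.-integrable setT (EFin \o g) /\
    \int[leb]_x (g x * \1_(I n) x) @[n --> \oo] --> \int[leb]_x g x.
  apply: (@Rintegral_cvg _ _ _ leb (fun n (x : R) => g x * \1_(I n) x) g (fun x : R => `|g x|)).
  - move=> n; apply: measurable_funM; first exact: continuous_measurable_fun.
    by apply: measurable_indic; exact: mI.
  - exact: (integrable_norm gi).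
  - by move=> n x; rewrite normrM ler_piMr// indicE; case: (_ \in _); rewrite ?normr1 ?normr0.
  - move=> x; apply: cvg_near_cst.
    near=> n; rewrite indicE mem_set ?mulr1//= /I /= in_itv/= -ler_norml.
    apply: (@le_trans _ _ n%:R); last by rewrite ler_nat.
    near: n; exact: nbhs_infty_ger.
have c2 n : \int[leb]_x (g x * \1_(I n) x) = G n.+1%:R - G (- n.+1%:R).
  have lt : - n.+1%:R < n.+1%:R :> R.
    by apply: (@lt_trans _ _ 0); rewrite ?oppr_lt0 ltr0n.
  have := @continuous_FTC2 R g G _ _ lt (continuous_subspaceT cg).
  rewrite -EFinB => FTC.
  rewrite /Rintegral -[RHS]/(fine (G n.+1%:R - G (- n.+1%:R))%:E) -FTC.
  - rewrite [in RHS]integral_mkcond; congr fine; apply: eq_integral => x _.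
    rewrite /= patchE indicE; case: ifPn => h; rewrite ?mulr1 ?mulr0//.
  - split.
    + by move=> x _; case: (dG x).
    + apply: cvg_at_right_filter; apply: differentiable_continuous.
      by apply/derivable1_diffP; case: (dG (- n.+1%:R)).
    + apply: cvg_at_left_filter; apply: differentiable_continuous.
      by apply/derivable1_diffP; case: (dG n.+1%:R).
  - by move=> x _; rewrite derive1E; case: (dG x) => _ ->.
(* [|G x| <= D / |x - m|] for [x] far from [m] *)
have [D D0 bG] : exists2 D : R, 0 <= D & forall x : R, 1 <= `|x - m| -> `|G x| <= D / `|x - m|.
  have C0 : 0 <= C by have := bF 0; rewrite normr0 addr0 mulr1; apply: le_trans.
  pose K := normal_peak s * (s ^+ 2 *+ 2).
  have K0 : 0 <= K by rewrite mulr_ge0 ?normal_peak_ge0// mulrn_wge0// sqr_ge0.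
  exists (s ^+ 2 * (C * (2 + `|m|) * K)).
    by apply: mulr_ge0; [exact: sqr_ge0|apply: mulr_ge0 => //; apply: mulr_ge0].
  move=> x x1; have x0 : 0 < `|x - m| by exact: lt_le_trans x1.
  rewrite /G normrM (ger0_norm (sqr_ge0 _)) -mulrA ler_wpM2l ?sqr_ge0//.
  rewrite normrM (ger0_norm (normal_pdf_ge0 _ _ _)).
  have h1 : `|F x| <= C * (2 + `|m|) * `|x - m|.
    apply: (le_trans (bF x)); rewrite -mulrA ler_wpM2l//.
    have h : `|x| <= `|x - m| + `|m| by rewrite -{1}(subrK m x) ler_normD.
    have : `|m| <= `|m| * `|x - m| by rewrite ler_peMr.
    lra.
  have h2 : p x <= K / `|x - m| ^+ 2.
    rewrite real_normK ?num_real//; apply: normal_pdf_decay => //.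
    by rewrite -subr_eq0 -normr_gt0.
  apply: (@le_trans _ _ (C * (2 + `|m|) * `|x - m| * (K / `|x - m| ^+ 2))).
    apply: ler_pM => //; exact: normal_pdf_ge0.
  rewrite le_eqVlt; apply/orP; left; apply/eqP.
  by field; rewrite gt_eqF.
have lim0 (u : nat -> R) : (forall n, n.+1%:R - `|m| <= `|u n - m|) ->
    G (u n) @[n --> \oo] --> 0.
  move=> un; apply/cvgrPdist_le => e e0; near=> n.
  rewrite sub0r normrN.
  have big : 1 + D / e <= `|u n - m|.
    apply: le_trans (un n); rewrite lerBrDr.
    apply: (@le_trans _ _ n%:R); last by rewrite ler_nat.
    near: n; exact: nbhs_infty_ger.
  have De : 0 <= D / e by rewrite divr_ge0// ltW.
  apply: (le_trans (bG _ _)); first by apply: le_trans big; rewrite lerDl.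
  rewrite ler_pdivrMr; last by apply: lt_le_trans big; rewrite ltr_pwDl.
  rewrite mulrC -ler_pdivrMr//; apply: le_trans big; by rewrite lerDr.
have c3 : \int[leb]_x (g x * \1_(I n) x) @[n --> \oo] --> (0 : R).
  have : (G n.+1%:R - G (- n.+1%:R)) @[n --> \oo] --> (0 - 0 : R).
    apply: cvgB; apply: (lim0) => n.
      by rewrite lerBlDr -{1}(@ger0_norm _ n.+1%:R)// -{1}(subrK m n.+1%:R) ler_normD.
    rewrite lerBlDr -{1}(@ger0_norm _ n.+1%:R)// -{1}(normrN n.+1%:R).
    by rewrite -{1}(subrK m (- n.+1%:R)) ler_normD.
  by rewrite subr0; under eq_fun do rewrite -c2.
by apply: (cvg_unique _ c1 c3).
Unshelve. all: by end_near. Qed.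

End normal_law.

(** * Gaussian random variables *)

Section gaussian_variable.
Context d (T : measurableType d) {R : realType}.
Variables (mu : probability T R) (X : T -> R).
Hypothesis mX : measurable_fun setT X.
Hypothesis X2 : mu.-integrable setT (EFin \o (fun x => X x ^+ 2)).

Let Xi : mu.-integrable setT (EFin \o X).
Proof. exact: integrable_of_sqr. Qed.

Let integrable_lin_growth (F : R -> R) (C : R) : measurable_fun setT F ->
  (forall x, `|F x| <= C * (1 + `|x|)) ->
  mu.-integrable setT (EFin \o (fun x => F (X x))) /\
  forall c : R, mu.-integrable setT (EFin \o (fun x => (X x - c) * F (X x))).
Proof.
move=> mF bF.
have C0 : 0 <= C by have := bF 0; rewrite normr0 addr0 mulr1; apply: le_trans.
have i0 : mu.-integrable setT (EFin \o (fun x => F (X x))).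
  apply: (@integrable_le _ _ _ _ _ (fun x => C * `|X x| + C)).
  - exact: measurableT_comp.
  - apply: integrable_lin; first exact: integrable_norm.
    exact: finite_measure_integrable_cst.
  - by move=> x; apply: (le_trans (bF _)); rewrite mulrDr mulr1 addrC.
have i1 : mu.-integrable setT (EFin \o (fun x => X x * F (X x))).
  apply: (@integrable_le _ _ _ _ _ (fun x => C * X x ^+ 2 + C * `|X x|)).
  - by apply: measurable_funM => //; exact: measurableT_comp.
  - apply: integrable_lin => //; apply: integrable_scale; exact: integrable_norm.
  - move=> x; rewrite normrM -[X x ^+ 2]real_normK ?num_real//.
    have := ler_wpM2l (normr_ge0 (X x)) (bF (X x)); rewrite expr2; lra.
split=> // c.
rewrite (_ : (fun x => _) = fun x => (- c) * F (X x) + X x * F (X x)).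
  exact: integrable_lin.
by apply/funext => x; ring.
Qed.

Variables m s : R.
Hypothesis lawX : forall B : set R, measurable B ->
  mu [set x | B (X x)] = gaussian_law m s B.

(** A Gaussian law is either a Dirac mass, for which both sides vanish, or a
    normal law, to which [normal_stein] applies. *)
Lemma gaussian_stein (C : R) (F dF : R -> R) :
  (forall x : R, is_derive x 1 F (dF x)) -> continuous dF ->
  (forall x, `|F x| <= C * (1 + `|x|)) -> (forall x, `|dF x| <= C) ->
  \int[mu]_x ((X x - m) * F (X x)) = s ^+ 2 * \int[mu]_x dF (X x).
Proof.
move=> dFE cdF bF bdF.
have cF : continuous F.
  move=> x; apply/differentiable_continuous/derivable1_diffP.
  by case: (dFE x).
have mF : measurable_fun [set: R] F by exact: continuous_measurable_fun.
have mdF : measurable_fun [set: R] dF by exact: continuous_measurable_fun.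
have mG : measurable_fun [set: R] (fun x : R => (x - m) * F x).
  by apply: measurable_funM => //; exact: measurable_funB.
have bdF' x : `|dF x| <= C * (1 + `|x|).
  apply: (le_trans (bdF x)); rewrite ler_peMr ?lerDl//.
  exact: le_trans (bdF 0).
have [_ /(_ m) i1] := integrable_lin_growth mF bF.
have [i2 _] := integrable_lin_growth mdF bdF'.
have [s0|s0] := eqVneq s 0.
  have law B : measurable B -> (\d_m : {measure set R -> \bar R}) B = mu (X @^-1` B).
    move=> mB; have h := lawX mB; rewrite /gaussian_law s0 eqxx in h.
    exact: esym h.
  have j1 := (integrable_law mX law mG).2 i1.
  rewrite s0 expr0n mul0r -(Rintegral_law mX law mG j1) /Rintegral.
  rewrite integral_dirac//; last exact/measurable_EFinP.
  by rewrite diracT mul1e/= subrr mul0r.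
pose nu : {measure set (measurableTypeR R) -> \bar R} := normal_prob m s.
have law B : measurable B -> nu B = mu (X @^-1` B).
  move=> mB; have h := lawX mB; rewrite /gaussian_law (negbTE s0) in h.
  exact: esym h.
have j1 := (@integrable_law _ _ T (measurableTypeR R) R mu nu X mX law _ mG).2 i1.
have j2 := (@integrable_law _ _ T (measurableTypeR R) R mu nu X mX law _ mdF).2 i2.
rewrite -(@Rintegral_law _ _ T (measurableTypeR R) R mu nu X mX law _ mG j1).
rewrite -(@Rintegral_law _ _ T (measurableTypeR R) R mu nu X mX law _ mdF j2).
exact: (normal_stein s0 dFE cdF bF j1 j2).
Qed.

Variable q : R.
Hypothesis meanX : \int[mu]_x X x = 0.
Hypothesis varX : \int[mu]_x (X x ^+ 2) = q.

Let int1 : \int[mu]_x (1 : R) = 1.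
Proof. by rewrite Rintegral_cst//= probability_setT mul1r. Qed.

(** The parameters of the law are read off from Stein's identity for the test
    functions [1] and [x]. *)
Lemma gaussian_mean0 : m = 0.
Proof.
have d1 (x : R) : is_derive x 1 (cst (1 : R)) 0 by exact: is_derive_cst.
have := @gaussian_stein 1 (cst 1) (cst 0) d1 (fun x => @cst_continuous _ _ _ _).
rewrite /cst/= normr1 normr0 => /(_ _ (fun=> ler01)) h.
have {h} := h (fun x => _).
under eq_Rintegral do rewrite mulr1.
rewrite RintegralB//; last exact: finite_measure_integrable_cst.
rewrite meanX !Rintegral_cst//= probability_setT/= !mulr1 mulr0 sub0r => h.
by apply/eqP; rewrite -oppr_eq0 h// => x; rewrite mul1r lerDl.
Qed.

Lemma gaussian_var : s ^+ 2 = q.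
Proof.
have d1 (x : R) : is_derive x 1 (id : R -> R) 1 by exact: is_derive_id.
have := @gaussian_stein 1 id (cst 1) d1 (fun x => @cst_continuous _ _ _ _).
rewrite gaussian_mean0 int1 mulr1 -varX => <-//.
- by apply: eq_Rintegral => x _; rewrite subr0 expr2.
- by move=> x; rewrite mul1r lerDr.
- by move=> x; rewrite normr1.
Qed.

Lemma centered_stein (C : R) (F dF : R -> R) :
  (forall x : R, is_derive x 1 F (dF x)) -> continuous dF ->
  (forall x, `|F x| <= C * (1 + `|x|)) -> (forall x, `|dF x| <= C) ->
  \int[mu]_x (X x * F (X x)) = q * \int[mu]_x dF (X x).
Proof.
move=> h1 h2 h3 h4; rewrite -gaussian_var -(gaussian_stein h1 h2 h3 h4).
by apply: eq_Rintegral => x _; rewrite gaussian_mean0 subr0.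
Qed.

(** Differentiation under the integral sign, the derivative in [t] being
    dominated by [|X|]. *)
Let trig_derive (S dS : R -> R) : (forall x : R, is_derive x 1 S (dS x)) ->
  continuous S -> continuous dS -> (forall x, `|S x| <= 1) ->
  (forall x, `|dS x| <= 1) -> forall t : R,
  is_derive t 1 (fun t => \int[mu]_x S (t * X x)) (\int[mu]_x (X x * dS (t * X x))).
Proof.
move=> dSE cS cdS bS bdS t.
have mtX (u : R) : measurable_fun setT (fun x => u * X x).
  by apply: measurable_funM => //; exact: measurable_cst.
have mS u : measurable_fun setT (fun x => S (u * X x)).
  by apply: (measurableT_comp _ (mtX u)); exact: continuous_measurable_fun.
have dE (u : R) x : is_derive u 1 (fun u : R => S (u * X x)) (X x * dS (u * X x)).
  have dX : is_derive u 1 (fun u : R => u * X x) (X x).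
    by apply: is_derive_eq; rewrite /GRing.scale/= mulr1 mulr0 add0r.
  have dS' := dSE (u * X x).
  by have := @is_derive1_comp _ S (fun u : R => u * X x) _ _ _ dS' dX; rewrite mulrC.
have Ia : (`]t - 1, t + 1[%classic : set R) t by rewrite /= in_itv/=; lra.
have int u : (`]t - 1, t + 1[%classic : set R) u ->
    mu.-integrable setT (EFin \o (fun x => S (u * X x))).
  by move=> _; exact: integrable_bounded (mS u) (fun x => bS _).
have der u x : (`]t - 1, t + 1[%classic : set R) u -> setT x ->
  derivable (fun u : R => S (u * X x)) u 1 by move=> _ _; case: (dE u x).
have part u x : partial1of2 (fun (u : R) x => S (u * X x)) u x = X x * dS (u * X x).
  by rewrite partial1of2E; case: (dE u x).
have G0 x : 0 <= `|X x| by [].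
have Gi := integrable_norm Xi.
have bd u x : (`]t - 1, t + 1[%classic : set R) u -> setT x ->
    `|partial1of2 (fun (u : R) x => S (u * X x)) u x| <= `|X x|.
  by move=> _ _; rewrite part normrM ler_piMr.
apply: DeriveDef.
  exact: (derivable_under_integral measurableT Ia int der G0 Gi bd).
rewrite -derive1E (differentiation_under_integral measurableT Ia int der G0 Gi bd).
by apply: eq_Rintegral => x _; rewrite part.
Qed.

Let dcos (x : R) : is_derive x 1 (cos : R -> R) (- sin x).
Proof. exact: is_derive_cos. Qed.

Let dsin (x : R) : is_derive x 1 (sin : R -> R) (cos x).
Proof. exact: is_derive_sin. Qed.

Let cNsin : continuous (fun x : R => - sin x).
Proof. by move=> x; apply: cvgN; exact: continuous_sin. Qed.

Let bcos (x : R) : `|cos x| <= 1.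
Proof. by rewrite ler_norml cos_geN1 cos_le1. Qed.

Let bsin (x : R) : `|sin x| <= 1.
Proof. by rewrite ler_norml sin_geN1 sin_le1. Qed.

Let bNsin (x : R) : `|- sin x| <= 1.
Proof. by rewrite normrN. Qed.

Let gaussian_ode (y : R -> R) :
  (forall t : R, is_derive t 1 y (- (q * t) * y t)) ->
  forall t, y t = y 0 * expR (- (q / 2) * t ^+ 2).
Proof.
move=> dy t.
pose z (u : R) := y u * expR ((q / 2) * u ^+ 2).
have dz (u : R) : is_derive u 1 z 0.
  have dyu := dy u.
  apply: is_derive_eq; rewrite /GRing.scale/=.
  by move: (expR _) => E; field.
have := is_derive_0_is_cst t 0 dz.
rewrite /z expr0n mulr0 expR0 mulr1 => <-.
by rewrite -mulrA -expRD -mulrDl subrr mul0r expR0 mulr1.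
Qed.

Let bound_lin (u x r : R) : `|r| <= 1 -> `|r| <= (1 + `|u|) * (1 + `|x|).
Proof.
move=> r1; apply: (le_trans r1).
by rewrite -[leLHS]mulr1 ler_pM// lerDl.
Qed.

Let bound_mul (u r : R) : `|r| <= 1 -> `|- (u * r)| <= 1 + `|u|.
Proof.
move=> r1; rewrite normrN normrM; apply: (@le_trans _ _ (`|u| * 1)).
  exact: ler_wpM2l.
by rewrite mulr1 lerDr.
Qed.

Let integrable_trig (S : R -> R) (u : R) : continuous S ->
  (forall x, `|S x| <= 1) -> mu.-integrable setT (EFin \o (fun x => S (u * X x))).
Proof.
move=> cS bS; apply: (@integrable_bounded _ _ _ _ _ 1) => //.
apply: measurableT_comp; first exact: continuous_measurable_fun.
by apply: measurable_funM => //; exact: measurable_cst.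
Qed.

Let continuous_trig (S : R -> R) (u : R) : continuous S ->
  continuous (fun x : R => - (u * S (u * x))).
Proof.
move=> cS x; apply: cvgN; apply: cvgM; first exact: cvg_cst.
apply: continuous_comp; last exact: cS.
by apply: cvgM; [exact: cvg_cst|exact: cvg_id].
Qed.

Let stein_ode (S : R -> R) (u : R) : continuous S -> (forall x, `|S x| <= 1) ->
  q * \int[mu]_x (- (u * S (u * X x))) = - (q * u) * \int[mu]_x S (u * X x).
Proof.
move=> cS bS; rewrite mulNr -mulrA -mulrN; congr (_ * _).
rewrite -mulNr -RintegralZl//; last exact: integrable_trig.
by apply: eq_Rintegral => x _; rewrite mulNr.
Qed.

(** The characteristic function [c] of a centred Gaussian variable solves
    [c' = - q t c]: differentiate under the integral sign and integrate by
    parts. *)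
Lemma gaussian_cos (t : R) : \int[mu]_x cos (t * X x) = expR (- (q / 2) * t ^+ 2).
Proof.
pose y (t : R) := \int[mu]_x cos (t * X x).
have dy (u : R) : is_derive u 1 y (- (q * u) * y u).
  have [dd ee] := trig_derive dcos (@continuous_cos R) cNsin bcos bNsin u.
  apply: DeriveDef => //; rewrite ee.
  have dF (x : R) : is_derive x 1 (fun x : R => - sin (u * x)) (- (u * cos (u * x))).
    by apply: is_derive_eq; rewrite /GRing.scale/=; ring.
  rewrite (centered_stein dF (@continuous_trig _ u (@continuous_cos R))
    (fun x : R => @bound_lin u x _ (bNsin _)) (fun x : R => @bound_mul u _ (bcos _))).
  exact: (@stein_ode _ u (@continuous_cos R) bcos).
rewrite -/(y t) (gaussian_ode dy) (_ : y 0 = 1) ?mul1r// -[RHS]int1.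
by apply: eq_Rintegral => x _; rewrite mul0r cos0.
Qed.

Lemma gaussian_sin (t : R) : \int[mu]_x sin (t * X x) = 0.
Proof.
pose y (t : R) := \int[mu]_x sin (t * X x).
have dy (u : R) : is_derive u 1 y (- (q * u) * y u).
  have [dd ee] := trig_derive dsin (@continuous_sin R) (@continuous_cos R) bsin bcos u.
  apply: DeriveDef => //; rewrite ee.
  have dF (x : R) : is_derive x 1 (fun x : R => cos (u * x)) (- (u * sin (u * x))).
    by apply: is_derive_eq; rewrite /GRing.scale/=; ring.
  rewrite (centered_stein dF (@continuous_trig _ u (@continuous_sin R))
    (fun x : R => @bound_lin u x _ (bcos _)) (fun x : R => @bound_mul u _ (bsin _))).
  exact: (@stein_ode _ u (@continuous_sin R) bsin).
rewrite -/(y t) (gaussian_ode dy) (_ : y 0 = 0) ?mul0r//.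
rewrite /y; under eq_Rintegral do rewrite mul0r sin0.
by rewrite Rintegral_cst//= mul0r.
Qed.

End gaussian_variable.

(** * Gaussian measures: resampling and integration by parts *)

Section square_of_a_probability.
Context d (T : measurableType d) {R : realType}.
Variable mu : probability T R.

Definition square_prob : subprobability (T * T)%type R :=
  product_subprobability (mu : subprobability T R, mu : subprobability T R).

Lemma Rintegral_square (f : T * T -> R) :
  square_prob.-integrable setT (EFin \o f) ->
  (forall z, mu.-integrable setT (EFin \o (fun w => f (z, w)))) ->
  \int[square_prob]_p f p = \int[mu]_z \int[mu]_w f (z, w).
Proof.
move=> fi fz; rewrite /Rintegral; congr fine.
transitivity (\int[mu]_z fubini_F mu (EFin \o f) z)%E.
  by rewrite (@integral12_prod_meas1 _ _ T T R mu mu (EFin \o f) fi).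
apply: eq_integral => z _; rewrite /fubini_F /=.
by rewrite fineK//; exact: (integrable_fin_num measurableT (fz z)).
Qed.

End square_of_a_probability.

Section gaussian_space.
Context {R : realType} {H : completeNormedModType R}.
Variable dot : {dot H for idfun}.
Hypothesis hil : is_hilbert dot.
Hypothesis sep : separable H.
Variables (mu : probability (borel H) R) (Q : H -> H).
Hypothesis gauss : gaussian_measure dot mu 0 Q.

Lemma measurable_dot h : measurable_fun [set: borel H] (dot h : borel H -> R).
Proof. by apply: continuous_borel; exact: continuous_dotr. Qed.

Lemma integrable_dot2 h :
  mu.-integrable [set: borel H] (EFin \o (fun x => dot h x ^+ 2)).
Proof.
apply/integrableP; split.
  by apply/measurable_EFinP; apply: measurable_funX; exact: measurable_dot.
have [_ _ /(_ h h)] := gauss.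
rewrite (_ : (\int[mu]_x (dot h (x - 0) * dot h (x - 0))%:E)%E =
  (\int[mu]_x `|((dot h x ^+ 2)%R)%:E|)%E) => [->|].
  by rewrite ltry.
apply: eq_integral => x _ /=; rewrite subr0 -expr2.
by rewrite ger0_norm// sqr_ge0.
Qed.

Lemma integrable_dot h : mu.-integrable [set: borel H] (EFin \o (dot h : borel H -> R)).
Proof. apply: integrable_of_sqr; [exact: measurable_dot|exact: integrable_dot2]. Qed.

Lemma integrable_dot_mul h k :
  mu.-integrable [set: borel H] (EFin \o (fun x => dot h x * dot k x)).
Proof.
apply: (@Rintegral_young _ _ _ mu 1 _ _ ltr01 _ _ _ _).1.
- exact: measurable_dot.
- exact: measurable_dot.
- exact: integrable_dot2.
- exact: integrable_dot2.
Qed.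

Lemma Rintegral_dot h : \int[mu]_x dot h x = 0.
Proof. by have [_ /(_ h) m _] := gauss; rewrite /Rintegral m dot0r. Qed.

Lemma Rintegral_dot_mul h k : \int[mu]_x (dot h x * dot k x) = dot (Q h) k.
Proof.
have [_ _ /(_ h k) c] := gauss; rewrite -[RHS]/(fine (dot (Q h) k)%:E) -c.
by rewrite /Rintegral; congr fine; apply: eq_integral => x _; rewrite !subr0.
Qed.

Lemma gaussian_dot h : exists m s : R, forall B : set R, measurable B ->
  mu [set x | B (dot h x)] = gaussian_law m s B.
Proof. by have [] := gauss. Qed.

Lemma Rintegral_cos_dot h :
  \int[mu]_x cos (dot h x) = expR (- (\int[mu]_x (dot h x ^+ 2) / 2)).
Proof.
have [m [s law]] := gaussian_dot h.
have := gaussian_cos (measurable_dot h) (integrable_dot2 h) law (Rintegral_dot h)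
  erefl 1.
rewrite expr1n mulr1 => <-.
by apply: eq_Rintegral => x _; rewrite mul1r.
Qed.

Lemma Rintegral_sin_dot h : \int[mu]_x sin (dot h x) = 0.
Proof.
have [m [s law]] := gaussian_dot h.
have := gaussian_sin (measurable_dot h) (integrable_dot2 h) law (Rintegral_dot h)
  erefl 1.
by under eq_Rintegral do rewrite mul1r.
Qed.

(** [l] is the Cameron-Martin direction dual to [k], that is, [l = Q k]. *)
Definition cameron_martin (l k : H) : Prop :=
  forall h, \int[mu]_x (dot k x * dot h x) = dot l h.

Lemma cameron_martin_scale (a : R) l k : cameron_martin l k ->
  cameron_martin (a *: l) (a *: k).
Proof.
move=> lk h; rewrite dotZl -lk -RintegralZl//; last exact: integrable_dot_mul.
by apply: eq_Rintegral => x _; rewrite dotZl mulrA.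
Qed.

Lemma cameron_martin_unit l k : cameron_martin l k -> 0 < dot l k ->
  exists2 s : R, 0 < s & cameron_martin (s *: l) (s *: k) /\ dot (s *: l) (s *: k) = 1.
Proof.
move=> lk lk0; have s0 : 0 < Num.sqrt (dot l k) by rewrite sqrtr_gt0.
exists (Num.sqrt (dot l k))^-1; first by rewrite invr_gt0.
split; first exact: cameron_martin_scale.
have s2 := sqr_sqrtr (ltW lk0); set s := Num.sqrt _ in s0 s2 *.
by rewrite dotZl dotZr -s2; field; rewrite gt_eqF.
Qed.

Section resampling.
Variables l k : H.
Hypothesis lk : cameron_martin l k.
Hypothesis lk1 : dot l k = 1.

(** Resampling of the component of [z] along [l]: it is replaced by that of an
    independent copy [w]. *)
Definition resample (z w : H) : H := z + (dot k w - dot k z) *: l.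

(** A linear form of the resampled point splits into independent contributions of
    [z] and [w], whose variances are computed in [variance_split]. *)
Lemma dot_resample h z w :
  dot h (resample z w) = dot (h - dot h l *: k) z + dot h l * dot k w.
Proof. by rewrite /resample dotDr dotZr dotBl dotZl; ring. Qed.

Lemma dot_resample_dual z w : dot k (resample z w) = dot k w.
Proof. by rewrite dot_resample (dotC dot k l) lk1 scale1r subrr dot0l mul1r add0r. Qed.

Lemma measurable_resample : measurable_fun setT
  ((fun p => resample p.1 p.2) : borel H * borel H -> borel H).
Proof.
apply: (measurable_to_borel hil sep) => h.
under eq_fun do rewrite dot_resample.
apply: measurable_funD.
  apply: (measurableT_comp (measurable_dot _)); exact: measurable_fst.
apply: measurable_funM; first exact: measurable_cst.
apply: (measurableT_comp (measurable_dot _)); exact: measurable_snd.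
Qed.

Lemma measurable_resample_r z :
  measurable_fun [set: borel H] (fun w : borel H => resample z w : borel H).
Proof.
apply: (measurable_to_borel hil sep) => h; under eq_fun do rewrite dot_resample.
apply: measurable_funD; first exact: measurable_cst.
by apply: measurable_funM; [exact: measurable_cst|exact: measurable_dot].
Qed.

Let meas_prod (f g : H -> R) : continuous f -> continuous g ->
  measurable_fun setT (fun p : borel H * borel H => f p.1 * g p.2).
Proof.
move=> cf cg; apply: measurable_funM.
  apply: (measurableT_comp (continuous_borel cf)); exact: measurable_fst.
apply: (measurableT_comp (continuous_borel cg)); exact: measurable_snd.
Qed.

Let prod_integral (f g : H -> R) : continuous f -> continuous g ->
  (forall x, `|f x| <= 1) -> (forall x, `|g x| <= 1) ->
  (square_prob mu).-integrable setT
    (EFin \o (fun p : borel H * borel H => f p.1 * g p.2)) /\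
  \int[square_prob mu]_p (f p.1 * g p.2) = \int[mu]_x f x * \int[mu]_x g x.
Proof.
move=> cf cg bf bg.
have fgi : (square_prob mu).-integrable setT
    (EFin \o (fun p : borel H * borel H => f p.1 * g p.2)).
  apply: (@integrable_bounded _ _ _ _ _ 1); first exact: meas_prod.
  by move=> p; rewrite normrM -[1]mulr1 ler_pM.
have gi : mu.-integrable [set: borel H] (EFin \o (g : borel H -> R)).
  exact: integrable_bounded (continuous_borel cg) bg.
have fi : mu.-integrable [set: borel H] (EFin \o (f : borel H -> R)).
  exact: integrable_bounded (continuous_borel cf) bf.
split=> //; rewrite Rintegral_square//; last first.
  by move=> z; exact: (@integrable_scale _ _ _ mu (f z) g gi).
rewrite -RintegralZr//; apply: eq_Rintegral => z _ /=.
by rewrite RintegralZl.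
Qed.

Let continuous_cos_dot h : continuous (fun x : H => cos (dot h x)).
Proof.
move=> x; apply: (@continuous_comp _ _ _ (dot h) cos).
  exact: continuous_dotr.
exact: continuous_cos.
Qed.

Let continuous_sin_dot h : continuous (fun x : H => sin (dot h x)).
Proof.
move=> x; apply: (@continuous_comp _ _ _ (dot h) sin).
  exact: continuous_dotr.
exact: continuous_sin.
Qed.

Let bcos (h x : H) : `|cos (dot h x)| <= 1.
Proof. by rewrite ler_norml cos_geN1 cos_le1. Qed.

Let bsin (h x : H) : `|sin (dot h x)| <= 1.
Proof. by rewrite ler_norml sin_geN1 sin_le1. Qed.

(** Pythagoras: [h - <h, l> k] and [k] are orthogonal for the covariance. *)
Let variance_split h : \int[mu]_x (dot h x ^+ 2) =
  \int[mu]_x (dot (h - dot h l *: k) x ^+ 2) +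
  \int[mu]_x (dot (dot h l *: k) x ^+ 2).
Proof.
set b := dot h l.
have ckh : \int[mu]_x (dot k x * dot h x) = b by rewrite lk dotC.
have ckk : \int[mu]_x (dot k x * dot k x) = 1 by rewrite lk.
have -> : \int[mu]_x (dot (b *: k) x ^+ 2) = b ^+ 2.
  transitivity (\int[mu]_x (b ^+ 2 * (dot k x * dot k x))).
    by apply: eq_Rintegral => x _; rewrite dotZl; ring.
  by rewrite RintegralZl ?ckk ?mulr1//; exact: integrable_dot_mul.
have -> : \int[mu]_x (dot (h - b *: k) x ^+ 2) =
    \int[mu]_x ((- 2 * b) * (dot k x * dot h x) +
      (b ^+ 2 * (dot k x * dot k x) + dot h x ^+ 2)).
  by apply: eq_Rintegral => x _; rewrite dotBl dotZl; ring.
have i1 := integrable_dot_mul k h; have i2 := integrable_dot_mul k k.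
have i3 := integrable_dot2 h; have i4 := integrable_lin (b ^+ 2) i2 i3.
rewrite (Rintegral_lin (- 2 * b) i1 i4) (Rintegral_lin _ i2 i3) ckh ckk; ring.
Qed.

(** Resampling preserves [mu]: by [variance_split] both sides have the same
    characteristic function. *)
Lemma resample_law (B : set H) : @measurable _ (borel H) B ->
  mu B = square_prob mu ((fun p => resample p.1 p.2) @^-1` B).
Proof.
pose Tr (p : borel H * borel H) : borel H := resample p.1 p.2.
pose C (f : H -> R) := [/\ measurable_fun [set: borel H] (f : borel H -> R),
  exists M : R, forall x, `|f x| <= M &
  \int[mu]_x f x = \int[square_prob mu]_p f (Tr p)].
have mT : measurable_fun setT Tr by exact: measurable_resample.
have Ci f : C f -> mu.-integrable [set: borel H] (EFin \o (f : borel H -> R)) /\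
    (square_prob mu).-integrable setT (EFin \o (f \o Tr)).
  move=> [mf [M bM] _]; split; first exact: integrable_bounded mf bM.
  have mfT : measurable_fun [set: borel H * borel H] (f \o Tr).
    exact: (measurableT_comp mf mT).
  apply: (@integrable_bounded _ _ _ (square_prob mu) (f \o Tr) M mfT) => p.
  exact: bM.
suff CB : forall B, @measurable _ (borel H) B -> C \1_B.
  move=> mB; have [_ _] := CB B mB.
  have mTB : measurable (Tr @^-1` B) by rewrite -[_ @^-1` _]setTI; exact: mT.
  rewrite /Rintegral integral_indic//= setIT.
  rewrite (_ : (\int[square_prob mu]_x (\1_B (Tr x))%:E)%E =
    square_prob mu (Tr @^-1` B)); last first.
    transitivity (\int[square_prob mu]_x (\1_(Tr @^-1` B) x)%:E)%E; first by [].
    by rewrite integral_indic// setIT.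
  move=> E; have := congr1 (fun r : R => r%:E) E.
  by rewrite !fineK//; exact: fin_num_measure.
apply: (trig_monotone_class hil sep).
- move=> h; split.
  + exact: continuous_borel.
  + by exists 1 => x; exact: bcos.
  + rewrite Rintegral_cos_dot variance_split.
    have [i1 e1] := prod_integral (@continuous_cos_dot (h - dot h l *: k))
      (@continuous_cos_dot (dot h l *: k)) (bcos _) (bcos _).
    have [i2 e2] := prod_integral (@continuous_sin_dot (h - dot h l *: k))
      (@continuous_sin_dot (dot h l *: k)) (bsin _) (bsin _).
    transitivity (\int[square_prob mu]_p ((-1) *
      (sin (dot (h - dot h l *: k) p.1) * sin (dot (dot h l *: k) p.2)) +
       cos (dot (h - dot h l *: k) p.1) * cos (dot (dot h l *: k) p.2))).
      rewrite Rintegral_lin// e1 e2 !Rintegral_sin_dot !Rintegral_cos_dot.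
      by rewrite -expRD mulr0 mulr0 add0r mulrDl opprD.
    by apply: eq_Rintegral => p _; rewrite dot_resample cosD dotZl; ring.
- move=> h; split.
  + exact: continuous_borel.
  + by exists 1 => x; exact: bsin.
  + rewrite Rintegral_sin_dot.
    have [i1 e1] := prod_integral (@continuous_sin_dot (h - dot h l *: k))
      (@continuous_cos_dot (dot h l *: k)) (bsin _) (bcos _).
    have [i2 e2] := prod_integral (@continuous_cos_dot (h - dot h l *: k))
      (@continuous_sin_dot (dot h l *: k)) (bcos _) (bsin _).
    transitivity (\int[square_prob mu]_p (1 *
      (sin (dot (h - dot h l *: k) p.1) * cos (dot (dot h l *: k) p.2)) +
       cos (dot (h - dot h l *: k) p.1) * sin (dot (dot h l *: k) p.2))).
      by rewrite Rintegral_lin// e1 e2 !Rintegral_sin_dot mulr0 mul0r mulr0 addr0.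
    by apply: eq_Rintegral => p _; rewrite dot_resample sinD dotZl; ring.
- move=> a f g Cf Cg.
  have [fi fTi] := Ci f Cf; have [gi gTi] := Ci g Cg.
  have [mf [M bM] ef] := Cf; have [mg [N bN] eg] := Cg.
  split.
  + by apply: measurable_funD => //; apply: measurable_funM => //; exact: measurable_cst.
  + exists (`|a| * M + N) => x; apply: (le_trans (ler_normD _ _)).
    by rewrite normrM lerD// ler_wpM2l.
  + by rewrite Rintegral_lin// ef eg -Rintegral_lin.
- move=> f g M Cf bM fg.
  have mf n : measurable_fun [set: borel H] (f n : borel H -> R) by case: (Cf n).
  have mg : measurable_fun [set: borel H] (g : borel H -> R).
    exact: (@measurable_fun_cvg _ (borel H) R setT f g mf (fun x _ => fg x)).
  have bg x : `|g x| <= M.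
    apply: (cvgr_to_le (cvg_norm (fg x))); exact: nearW.
  split=> //; first by exists M.
  have c1 := @Rintegral_bounded_cvg _ (borel H) R mu f g M mf bM fg.
  have mfT n : measurable_fun [set: borel H * borel H] (f n \o Tr).
    exact: (measurableT_comp (mf n) mT).
  have c2 := @Rintegral_bounded_cvg _ _ R (square_prob mu) (fun n => f n \o Tr)
    (g \o Tr) M mfT (fun n p => bM n _) (fun p => fg _).
  apply: (cvg_unique _ c1) => //.
  rewrite (_ : (fun n => \int[mu]_x f n x) =
    (fun n => \int[square_prob mu]_p f n (Tr p)))//.
  by apply/funext => n; case: (Cf n).
Qed.

Lemma resample_integral (F : H -> R) :
  mu.-integrable [set: borel H] (EFin \o (F : borel H -> R)) ->
  (forall z, mu.-integrable [set: borel H]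
     (EFin \o (fun w : borel H => F (resample z w)))) ->
  \int[mu]_x F x = \int[mu]_z \int[mu]_w F (resample z w).
Proof.
move=> Fi Fz.
have mF := integrable_measurable Fi.
have law (B : set (borel H)) : measurable B ->
    mu B = square_prob mu ((fun p => resample p.1 p.2) @^-1` B).
  exact: resample_law.
rewrite (Rintegral_law measurable_resample law mF Fi) Rintegral_square//.
exact: ((integrable_law measurable_resample law mF).1 Fi).
Qed.

Lemma resample_measure (B : set H) : @measurable _ (borel H) B ->
  (mu B = \int[mu]_z mu [set w | B (resample z w)])%E.
Proof.
move=> mB; rewrite resample_law//.
rewrite /square_prob/= /product_subprobability /product_measure1/=.
apply: eq_integral => z _; congr (mu _).
by apply/seteqP; split => w /=; rewrite /xsection/= inE.
Qed.

Lemma dot_dual_var : \int[mu]_x (dot k x ^+ 2) = 1.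
Proof. by rewrite -lk1 -lk; apply: eq_Rintegral => x _; rewrite expr2. Qed.

(** The law of [<k, .>] is standard normal, hence has a density bounded by 1. *)
Lemma dual_density (B : set R) : measurable B ->
  (mu [set x | B (dot k x)] <= lebesgue_measure B)%E.
Proof.
move=> mB; have [m [s law]] := gaussian_dot k.
have s1 : s ^+ 2 = 1.
  exact: (gaussian_var (measurable_dot k) (integrable_dot2 k) law
    (Rintegral_dot k) dot_dual_var).
have s0 : s != 0 by rewrite -sqrf_eq0 s1 oner_eq0.
rewrite law// /gaussian_law (negbTE s0) /normal_prob.
apply: (@le_trans _ _ (\int[lebesgue_measure]_(x in B) 1)%E); last first.
  by rewrite integral_cst// mul1e.
apply: ge0_le_integral => //=.
- by move=> x _; rewrite lee_fin normal_pdf_ge0.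
- apply/measurable_EFinP; apply: measurable_funTS; exact: measurable_normal_pdf.
- move=> x _; rewrite lee_fin; apply: (le_trans (normal_pdf_ub _ _ s0)).
  have p1 : 1 <= pi *+ 2 :> R by have := pi_ge2 R; rewrite mulr2n; lra.
  rewrite /normal_peak s1 mul1r invf_le1 ?sqrtr_gt0 ?(lt_le_trans ltr01 p1)//.
  by rewrite -[1]sqrtr1 ler_wsqrtr.
Qed.

(** Integration by parts along a unit Cameron-Martin direction: after
    resampling it is the one-dimensional formula. *)
Lemma ibp_unit (phi : H -> R) : Cb1 dot phi ->
  \int[mu]_x dot (nabla dot phi x) l = \int[mu]_x (phi x * dot k x).
Proof.
move=> Cphi; have cphi := Cb1_continuous Cphi.
have /Cb1E[[M bM] dphi cD [N bN]] := Cphi.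
have M0 : 0 <= M := le_trans (normr_ge0 _) (bM 0).
have N0 : 0 <= N := le_trans (normr_ge0 _) (bN 0).
have cDl : continuous (fun x => dot (nabla dot phi x) l).
  by apply: continuous_dot => // x; exact: cvg_cst.
have bDl x : `|dot (nabla dot phi x) l| <= N * `|l|.
  apply: (le_trans (cauchy_schwarz hil _ _)); exact: ler_wpM2r.
have mrs := measurable_resample_r.
have i1 : mu.-integrable [set: borel H]
    (EFin \o (fun x : borel H => dot (nabla dot phi x) l)).
  exact: integrable_bounded (continuous_borel cDl) bDl.
have i2 : mu.-integrable [set: borel H] (EFin \o (fun x : borel H => phi x * dot k x)).
  rewrite (_ : (fun x => _) = fun x => dot k x * phi x); last first.
    by apply/funext => x; rewrite mulrC.
  exact: (@integrable_mul_bounded _ (borel H) R mu (dot k) phi M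
    (integrable_dot k) (continuous_borel cphi) bM).
rewrite resample_integral//; last first.
  move=> z; apply: (@integrable_bounded _ _ _ _ _ (N * `|l|)) => //.
  exact: (measurableT_comp (continuous_borel cDl) (mrs z)).
rewrite [RHS]resample_integral//; last first.
  move=> z; under eq_fun do rewrite dot_resample_dual mulrC.
  exact: (@integrable_mul_bounded _ (borel H) R mu (dot k)
    (fun w => phi (resample z w)) M (integrable_dot k)
    (measurableT_comp (continuous_borel cphi) (mrs z)) (fun w => bM _)).
apply: eq_Rintegral => z _.
pose a := z - dot k z *: l.
have rE w : resample z w = a + dot k w *: l.
  by rewrite /resample /a scalerBl addrA addrAC.
pose F (t : R) := phi (a + t *: l).
pose dF (t : R) := dot (nabla dot phi (a + t *: l)) l.
have dFE (t : R) : is_derive t 1 F (dF t) by exact: grad_line.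
have cline : continuous (fun t : R => a + t *: l).
  by move=> t; apply: cvgD; [exact: cvg_cst|apply: cvgZr_tmp; exact: cvg_id].
have cdF : continuous dF.
  move=> t; apply: (@continuous_comp _ _ _ (fun t : R => a + t *: l)
    (fun x => dot (nabla dot phi x) l)); [exact: cline|exact: cDl].
pose C := M + N * `|l|.
have C0 : 0 <= N * `|l| by rewrite mulr_ge0.
have bF (t : R) : `|F t| <= C * (1 + `|t|).
  apply: (le_trans (bM _)); apply: (@le_trans _ _ C); first by rewrite lerDl.
  by rewrite ler_peMr ?addr_ge0// lerDl.
have bdF (t : R) : `|dF t| <= C.
  by apply: (le_trans (bDl _)); rewrite lerDr.
have [m [s law]] := gaussian_dot k.
have := centered_stein (measurable_dot k) (integrable_dot2 k) law
  (Rintegral_dot k) dot_dual_var dFE cdF bF bdF.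
rewrite mul1r => st.
transitivity (\int[mu]_w dF (dot k w)).
  by apply: eq_Rintegral => w _; rewrite rE.
rewrite -st; apply: eq_Rintegral => w _.
by rewrite dot_resample_dual rE mulrC.
Qed.

End resampling.

(** Rescaling the pair [(l, k)] reduces to [dot l k = 1]. *)
Lemma ibp (l k : H) (phi : H -> R) : cameron_martin l k ->
  0 < dot l k -> Cb1 dot phi ->
  \int[mu]_x dot (nabla dot phi x) l = \int[mu]_x (phi x * dot k x).
Proof.
move=> lk lk0 Cphi; have [s s0 [slk slk1]] := cameron_martin_unit lk lk0.
have := ibp_unit slk slk1 Cphi; have /Cb1E[[M bM] dphi cD [N bN]] := Cphi.
have i1 : mu.-integrable [set: borel H]
    (EFin \o (fun x : borel H => dot (nabla dot phi x) l)).
  apply: (@integrable_bounded _ _ _ _ _ (N * `|l|)).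
    by apply: continuous_borel; apply: continuous_dot => // x; exact: cvg_cst.
  by move=> x; apply: (le_trans (cauchy_schwarz hil _ _)); exact: ler_wpM2r.
have i2 : mu.-integrable [set: borel H] (EFin \o (fun x : borel H => dot k x * phi x)).
  exact: (@integrable_mul_bounded _ (borel H) R mu (dot k) phi M
    (integrable_dot k) (continuous_borel (Cb1_continuous Cphi)) bM).
under eq_Rintegral do rewrite dotZr.
under [X in _ = X]eq_Rintegral do rewrite dotZl mulrC -mulrA.
under [X in _ -> _ = X]eq_Rintegral do rewrite mulrC.
by rewrite !RintegralZl//; apply: mulfI; rewrite gt_eqF.
Qed.

End gaussian_space.

(** * Strongly convex functions on a Hilbert space *)

Section smooth_function.
Context {R : realType} {H : completeNormedModType R}.
Variable dot : {dot H for idfun}.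
Hypothesis hil : is_hilbert dot.
Variables (g : H -> R) (gamma : R).
Hypothesis smooth_g : smooth g.

Lemma norm_le_dual (u : H) (c : R) : 0 <= c ->
  (forall v, `|dot u v| <= c * `|v|) -> `|u| <= c.
Proof.
move=> c0 uc; have [->|u0] := eqVneq u 0; first by rewrite normr0.
have nu : 0 < `|u| by rewrite normr_gt0.
have := uc u; rewrite hil ger0_norm ?sqr_ge0// expr2.
by rewrite ler_pM2r.
Qed.

(** Of a smooth function only the first two derivatives matter.  The second one
    is a bounded bilinear form, represented by a bounded operator which is the
    differential of the gradient. *)
Lemma smooth_gradient : (forall x, differentiable g x) /\
  (forall x, differentiable (nabla dot g) x).
Proof.
have [D [D0 Dlin Dbd Dder]] := smooth_g.
have lin1 x : linear (fun h : H => D x [:: h] : R^o).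
  by have := Dlin x [::] [::].
have diffg x : differentiable g x /\ ('d g x = (fun h => D x [:: h]) :> (H -> R)).
  have [C bC] := Dbd x 1%N.
  apply: (@has_diff _ _ _ g (fun h => D x [:: h] : R^o) C x (lin1 x)).
    by move=> h; have := bC [:: h] erefl; rewrite big_seq1.
  move=> e e0; have := Dder x 0%N e e0; apply: filterS => h /(_ [::] erefl).
  by rewrite big_nil mulr1 !D0.
split=> x; first by case: (diffg x).
have gradD y h : dot (nabla dot g y) h = D y [:: h].
  by have [dg E] := diffg y; rewrite -(diff_grad hil dg) E.
have [C bC] := Dbd x 2%N.
have bC2 h v : `|D x [:: h; v]| <= `|C| * `|h| * `|v|.
  have := bC [:: h; v] erefl; rewrite big_cons big_seq1 mulrA => b.
  apply: (le_trans b); apply: ler_wpM2r => //; apply: ler_wpM2r => //.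
  exact: ler_norm.
have riesz h : exists w, forall v, D x [:: h; v] = dot w v.
  apply: (@riesz_representation _ _ _ hil (fun v => D x [:: h; v]) (`|C| * `|h|)).
    move=> a u v; have := Dlin x [:: h] [::] a u v; exact.
  exact: bC2.
have [B BE] := choice riesz.
have linB : linear B.
  move=> a u v; apply: (dot_inj hil) => w.
  rewrite dotDl dotZl -!BE; have := Dlin x [::] [:: w] a u v; exact.
apply: (@has_diff _ _ _ (nabla dot g) B `|C| x linB _ _).1.
  move=> h; apply: norm_le_dual; first by rewrite mulr_ge0.
  by move=> v; rewrite -BE.
move=> e e0; have := Dder x 1%N e e0; apply: filterS => h hb.
apply: norm_le_dual; first by rewrite mulr_ge0// ltW.
move=> v; have := hb [:: v] erefl; rewrite big_seq1.
by rewrite !dotBl !gradD BE.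
Qed.

Lemma diff_smooth x : differentiable g x.
Proof. by case: smooth_gradient => + _; apply. Qed.

Lemma diff_nabla_smooth x : differentiable (nabla dot g) x.
Proof. by case: smooth_gradient => _; apply. Qed.

Lemma continuous_smooth : continuous g.
Proof. by move=> x; exact/differentiable_continuous/diff_smooth. Qed.

Lemma continuous_nabla_smooth : continuous (nabla dot g).
Proof. by move=> x; exact/differentiable_continuous/diff_nabla_smooth. Qed.

Lemma nabla_line (a l v : H) (t : R) :
  is_derive t 1 (fun s : R => dot (nabla dot g (a + s *: l)) v)
    (dot (hessian dot g (a + t *: l) l) v).
Proof.
pose u s := nabla dot g (a + s *: l).
have [dl dline] := diff_line a l t.
have du : differentiable u t.
  apply: differentiable_comp => //; exact: diff_nabla_smooth.
have dv : differentiable (dot v \o u) t.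
  apply: differentiable_comp => //; exact: differentiable_dot.
rewrite (_ : (fun s => _) = dot v \o u); last first.
  by apply/funext => s; rewrite /= dotC.
apply: DeriveDef; first exact: diff_derivable.
rewrite deriveE// diff_comp//=; last exact: differentiable_dot.
have -> : 'd u t 1 = hessian dot g (a + t *: l) l.
  rewrite /u (@diff_comp _ _ _ _ (fun s : R => a + s *: l) (nabla dot g))//=.
    by rewrite dline nabla.unlock.
  exact: diff_nabla_smooth.
rewrite (diff_grad hil)// ?grad_dot// 1?dotC//; exact: differentiable_dot.
Qed.

Hypothesis gamma0 : 0 < gamma.
Hypothesis hess_ge : forall x h, gamma * `|h| ^+ 2 <= dot (hessian dot g x h) h.

Let mvt (f df : R -> R) (a b : R) : a < b -> (forall x : R, is_derive x 1 f (df x)) ->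
  exists2 c, a < c < b & f b - f a = df c * (b - a).
Proof.
move=> ab fE.
have cf : {within `[a, b], continuous f}.
  by apply: derivable_within_continuous => x _; case: (fE x).
have [c + E] := MVT ab (fun x _ => fE x) cf.
by rewrite in_itv/= => cab; exists c.
Qed.

Let slope_line (a l : H) (s t : R) : s <= t ->
  gamma * `|l| ^+ 2 * (t - s) <=
  dot (nabla dot g (a + t *: l)) l - dot (nabla dot g (a + s *: l)) l.
Proof.
rewrite le_eqVlt => /predU1P[->|st]; first by rewrite !subrr mulr0.
have [c _ ->] := mvt st (nabla_line a l l).
by apply: ler_wpM2r; [rewrite subr_ge0 ltW|exact: hess_ge].
Qed.

(** Subtracting [gamma |y - x|^2 t^2 / 2] from the restriction of [g] to the
    segment leaves a function with nondecreasing derivative; its mean slopes on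
    the two halves of the segment are compared. *)
Lemma strong_midpoint (x y : H) :
  g (2^-1 *: (x + y)) <= (g x + g y) / 2 - gamma / 8 * `|x - y| ^+ 2.
Proof.
pose l := y - x; pose phi (t : R) := g (x + t *: l).
pose dphi (t : R) := dot (nabla dot g (x + t *: l)) l.
have dE (t : R) : is_derive t 1 phi (dphi t).
  by apply: grad_line => //; exact: diff_smooth.
have h0 : (0 : R) < 2^-1 by [].
have h1 : (2^-1 : R) < 1 by rewrite invf_lt1// ltr1n.
pose L := `|l| ^+ 2 : R.
pose psi (t : R) := phi t - gamma * L / 2 * t ^+ 2.
pose dpsi (t : R) := dphi t - gamma * L * t.
have dpsiE (t : R) : is_derive t 1 psi (dpsi t).
  have := dE t => dEt.
  apply: is_derive_eq; rewrite /GRing.scale/= /dpsi.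
  by move: (dphi t) (gamma * L) => p q; field.
have [b0 /andP[b00 b01] F0] := mvt h0 (fun t => dpsiE t).
have [b1 /andP[b10 b11] F1] := mvt h1 (fun t => dpsiE t).
have b0b1 : b0 <= b1 by exact/ltW/(lt_trans b01).
have := slope_line x l b0b1; rewrite -/L -/(dphi b0) -/(dphi b1) => sl.
have inc : dpsi b0 <= dpsi b1 by rewrite /dpsi; lra.
have p0 : phi 0 = g x by rewrite /phi scale0r addr0.
have p1 : phi 1 = g y by rewrite /phi scale1r /l addrC subrK.
have ph : phi 2^-1 = g (2^-1 *: (x + y)).
  congr g; rewrite /l scalerBr scalerDr addrCA addrC; congr (_ + _).
  by rewrite -[X in X - _]scale1r -scalerBl; congr (_ *: _); field.
rewrite distrC -/l -/L -p0 -p1 -ph.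
move: F0 F1 inc; rewrite /psi.
have arith (P0 Ph P1 d0 d1 G : R) :
  Ph - G / 2 * 2^-1 ^+ 2 - (P0 - G / 2 * 0 ^+ 2) = d0 * (2^-1 - 0) ->
  P1 - G / 2 * 1 ^+ 2 - (Ph - G / 2 * 2^-1 ^+ 2) = d1 * (1 - 2^-1) ->
  d0 <= d1 -> Ph <= (P0 + P1) / 2 - G / 8.
  by rewrite !expr2; lra.
by move=> F0 F1 inc; rewrite mulrAC; exact: arith F0 F1 inc.
Qed.

Hypothesis g00 : g 0 = 0.
Hypothesis dg00 : nabla dot g 0 = 0.

(** The derivative of [g] along a ray from the origin is nonnegative. *)
Lemma smooth_ge0 x : 0 <= g x.
Proof.
pose phi (t : R) := g (0 + t *: x).
have dE (t : R) : is_derive t 1 phi (dot (nabla dot g (0 + t *: x)) x).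
  by apply: grad_line => //; exact: diff_smooth.
have [c /andP[c0 _] E] := mvt ltr01 dE.
have := slope_line 0 x (ltW c0).
rewrite scale0r addr0 dg00 dot0l !subr0 => le.
move: E; rewrite /phi scale1r scale0r !add0r g00 !subr0 mulr1 => ->.
rewrite add0r in le.
apply: le_trans le; apply: mulr_ge0; last exact: ltW.
by apply: mulr_ge0; [exact: ltW|exact: sqr_ge0].
Qed.

Lemma sublevel_bounded x : `|x| ^+ 2 <= 4 / gamma * g x.
Proof.
have := strong_midpoint x 0; rewrite g00 !addr0 subr0 => le.
have := smooth_ge0 (2^-1 *: x) => ge.
have h : gamma / 8 * `|x| ^+ 2 <= g x / 2.
  have arith (a b c : R) : 0 <= a -> a <= b - c -> c <= b by lra.
  exact: arith ge le.
rewrite mulrAC ler_pdivlMr//.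
have arith (c X G : R) : c / 8 * X <= G / 2 -> X * c <= 4 * G by lra.
exact: arith h.
Qed.

Hypothesis convex_g : convex_function (E := H) setT g.

Lemma convex_smooth (t : R) (x y : H) : 0 <= t <= 1 ->
  g (t *: x + (1 - t) *: y) <= t * g x + (1 - t) * g y.
Proof.
move=> t01; have t01' : t \in `[0, 1] by rewrite in_itv.
have := @convex_g (Itv01 (andP t01).1 (andP t01).2) x y.
by rewrite !inE => /(_ I I).
Qed.

(** The gradient vanishes at the origin and the sublevel set is bounded and
    contains the segment from the origin to each of its points, along which the
    bound on the Hessian is integrated. *)
Lemma nabla_bounded_sublevel (M : R) :
  (forall x, g x <= 1 -> forall h, `|hessian dot g x h| <= M * `|h|) ->
  exists2 K, 0 <= K & forall x, g x <= 1 -> `|nabla dot g x| <= K.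
Proof.
move=> bM.
exists (`|M| * (1 + 4 / gamma)).
  by rewrite mulr_ge0// addr_ge0// divr_ge0// ltW.
move=> x gx.
have xb : `|x| <= 1 + 4 / gamma.
  have h : `|x| ^+ 2 <= 4 / gamma.
    apply: (le_trans (sublevel_bounded x)).
    by rewrite -[leRHS]mulr1 ler_wpM2l// divr_ge0// ltW.
  have arith (a b : R) : a ^+ 2 <= b -> a <= 1 + b.
    by have := sqr_ge0 (a - 2^-1); rewrite sqrrB expr2; lra.
  exact: arith.
apply: (@le_trans _ _ (`|M| * `|x|)); last exact: ler_wpM2l.
apply: norm_le_dual; first by rewrite mulr_ge0.
move=> v.
have [c /andP[c0 c1]] := mvt ltr01 (nabla_line 0 x v).
rewrite scale1r scale0r !add0r dg00 dot0l !subr0 mulr1 => ->.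
have gc : g (c *: x) <= 1.
  have := @convex_smooth c x 0; rewrite (ltW c0) (ltW c1) scaler0 addr0 g00 mulr0 addr0.
  move=> /(_ isT) le; apply: (le_trans le).
  apply: (@le_trans _ _ (1 * g x)); last by rewrite mul1r.
  by apply: ler_wpM2r; [exact: smooth_ge0|exact: ltW].
apply: (le_trans (cauchy_schwarz hil _ _)); apply: ler_wpM2r => //.
apply: (le_trans (bM _ gc x)); apply: ler_wpM2r => //; exact: ler_norm.
Qed.

End smooth_function.

(** * Shells of strongly convex functions of two variables *)

Section planar_dilations.
Context {R : realType}.
Local Notation leb := (@lebesgue_measure R).

Lemma measurable_affine (a b : R) : measurable_fun [set: R] (fun x : R => a * x + b).
Proof. by apply: measurable_funD => //; exact: measurable_funM. Qed.

Lemma lebesgue_measure_affine (a b : R) (B : set R) : 0 < a -> measurable B ->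
  leb B = (a%:E * leb ((fun x : R => (a * x + b)%R) @^-1` B))%E.
Proof.
move=> a0 mB.
pose phi : measurableTypeR R -> measurableTypeR R := fun x => a * x + b.
have mphi : measurable_fun setT phi by exact: measurable_affine.
have a0' : 0 <= a by exact: ltW.
pose nu : {measure set _ -> \bar R} := mscale (NngNum a0') (pushforward leb phi).
suff -> : leb B = nu mphi B by [].
apply: lebesgue_measure_unique => //= _ [[c d]] _ <-.
rewrite /nu /mscale/= /pushforward.
have -> : phi @^-1` `]c, d]%classic = `](c - b) / a, (d - b) / a]%classic.
  apply/seteqP; split => x /=; rewrite !in_itv/= /phi;
  by rewrite ltr_pdivrMr// ler_pdivlMr// ltrBlDr lerBrDr (mulrC x).
rewrite !lebesgue_measure_itv/= !lte_fin ltr_pM2r ?invr_gt0// ltrD2r.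
case: ifP => _; last by rewrite mule0.
by rewrite -EFinB -EFinM; congr (_%:E); field; rewrite gt_eqF.
Qed.

Lemma lebesgue_preimage_affine (a b : R) (B : set R) : 0 < a -> measurable B ->
  leb ((fun x : R => a * x + b) @^-1` B) = ((a^-1)%:E * leb B)%E.
Proof.
move=> a0 mB; rewrite (lebesgue_measure_affine b a0 mB) muleA -EFinM mulVf ?mul1e//.
by rewrite gt_eqF.
Qed.

Local Notation plane := (measurableTypeR R * measurableTypeR R)%type.
Local Notation area := (leb \x leb)%E.

Definition dilation (a : R) (p : R * R) (x : R * R) : R * R :=
  (a * x.1 + (1 - a) * p.1, a * x.2 + (1 - a) * p.2).

Lemma measurable_dilation (a : R) (p : R * R) :
  measurable_fun [set: plane] (dilation a p : plane -> plane).
Proof.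
apply: measurable_fun_pair.
  apply: (measurableT_comp (measurable_affine a ((1 - a) * p.1))).
  exact: measurable_fst.
apply: (measurableT_comp (measurable_affine a ((1 - a) * p.2))).
exact: measurable_snd.
Qed.

Lemma area_dilation (a : R) (p : R * R) (S : set plane) : 0 < a -> measurable S ->
  area (dilation a p @^-1` S) = ((a^-1 ^+ 2)%:E * area S)%E.
Proof.
move=> a0 mS; have a0' : 0 <= a^-1 by rewrite invr_ge0 ltW.
pose phi i (x : measurableTypeR R) : measurableTypeR R := a * x + (1 - a) * i.
have mphi i : measurable_fun [set: measurableTypeR R] (phi i).
  exact: measurable_affine.
pose F (y : measurableTypeR R) := leb (xsection S y).
have mF : measurable_fun setT F by exact: measurable_fun_xsection.
transitivity (\int[leb]_y ((a^-1)%:E * F (phi p.1 y)))%E.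
  apply: eq_integral => y _ /=.
  rewrite (_ : xsection _ y = phi p.2 @^-1` (xsection S (phi p.1 y))).
    by rewrite lebesgue_preimage_affine//; exact: measurable_xsection.
  by apply/seteqP; split => x /=; rewrite /xsection /= !inE.
rewrite ge0_integralZl//; last exact: (measurableT_comp mF (mphi p.1)).
rewrite -(@ge0_integral_law _ _ _ _ _ leb (mscale (NngNum a0') leb)
  (phi p.1) (mphi _) _ F)//; first by rewrite ge0_integral_mscale// muleA -EFinM expr2.
- by move=> B mB; rewrite /mscale/= lebesgue_preimage_affine.
Qed.

Lemma area_square (p : R * R) (r : R) (K : set plane) : 0 <= r -> measurable K ->
  (forall x, K x -> `|x.1 - p.1| <= r /\ `|x.2 - p.2| <= r) ->
  (area K <= (4 * r ^+ 2)%:E)%E.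
Proof.
move=> r0 mK Kr.
have squareE (q : R) : leb `[q - r, q + r]%classic = (2 * r)%:E.
  rewrite lebesgue_measure_itv/= lte_fin; case: ifPn => [_|].
    by rewrite -EFinB; congr (_%:E); ring.
  rewrite -leNgt => h; congr (_%:E); have : r <= 0 by lra.
  by move=> r0'; have -> : r = 0 by [apply/eqP; rewrite eq_le r0 r0'|]; rewrite mulr0.
have -> : ((4 * r ^+ 2)%:E = (2 * r)%:E * (2 * r)%:E)%E.
  by rewrite -EFinM; congr (_%:E); ring.
rewrite -{1}(squareE p.1) -(squareE p.2).
rewrite -product_measure1E//; apply: le_measure; rewrite ?inE//.
  exact: measurableX.
move=> x /Kr[h1 h2]; split; rewrite /= in_itv/=.
  by move: h1; rewrite ler_distl.
by move: h2; rewrite ler_distl.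
Qed.

(** The subset [K'] of [K] contains a dilate of [K] of ratio [a], hence has at
    least the fraction [a^2] of its area; and [1 - a^2 <= 2 (1 - a)]. *)
Lemma area_star_shell (a r : R) (p : R * R) (K K' : set plane) :
  0 < a <= 1 -> 0 <= r -> measurable K -> measurable K' -> K' `<=` K ->
  (forall x, K x -> `|x.1 - p.1| <= r /\ `|x.2 - p.2| <= r) ->
  (forall x, K x -> K' (dilation a p x)) ->
  (area (K `\` K') <= (2 * (1 - a) * (4 * r ^+ 2))%:E)%E.
Proof.
move=> /andP[a0 a1] r0 mK mK' K'K Kr KK'.
have Kfin := area_square r0 mK Kr.
have areaK : (area K <= (a^-1 ^+ 2)%:E * area K')%E.
  rewrite -(area_dilation p a0 mK'); apply: le_measure; rewrite ?inE//.
  by rewrite -[_ @^-1` _]setTI; exact: measurable_dilation.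
have K'fin : (area K' <= area K)%E by apply: le_measure; rewrite ?inE.
have Kf : area K \is a fin_num.
  by rewrite ge0_fin_numE//; apply: (le_lt_trans Kfin); rewrite ltry.
have K'f : area K' \is a fin_num.
  by rewrite ge0_fin_numE//; apply: (le_lt_trans K'fin); rewrite -ge0_fin_numE.
rewrite measureD//=; last by rewrite -ge0_fin_numE.
rewrite setIidr//.
move: Kfin areaK; rewrite -(fineK Kf) -(fineK K'f) -EFinB -EFinM !lee_fin.
have : 0 <= fine (area K) by exact: fine_ge0.
move: (fine (area K)) (fine (area K')) => A A' A0 A4 AA'.
have h : a ^+ 2 * A <= A'.
  have := ler_wpM2l (sqr_ge0 a) AA'.
  by rewrite mulrA -exprMn divff ?gt_eqF// expr1n mul1r.
have h2 : A - A' <= 2 * (1 - a) * A.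
  have : 0 <= (1 - a) ^+ 2 * A by rewrite mulr_ge0 ?sqr_ge0.
  by move: h; rewrite !expr2; lra.
apply: (le_trans h2); apply: ler_wpM2l => //.
by rewrite mulr_ge0// subr_ge0.
Qed.

(** The bound does not depend on the minimum [m] of [G].  Indeed the sublevel
    set [K] at height 1 has diameter of order [sqrt (1 - m)], hence area
    [O(1 - m)], and a dilation of ratio [1 - e / (1 - m)] maps it into the
    sublevel set at height [1 - e].  In dimension one the same argument only
    gives [O(e / sqrt (1 - m))]. *)
Lemma strongly_convex_shell (c e : R) (G : R * R -> R) : 0 < c -> 0 < e ->
  measurable_fun [set: plane] (G : plane -> R) -> (forall x, 0 <= G x) ->
  (forall x y, G (2^-1 * (x.1 + y.1), 2^-1 * (x.2 + y.2)) <=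
     (G x + G y) / 2 - c / 8 * ((x.1 - y.1) ^+ 2 + (x.2 - y.2) ^+ 2)) ->
  (forall a p x, 0 <= a <= 1 -> G (dilation a p x) <= a * G x + (1 - a) * G p) ->
  (area [set x | (1 - e < G x <= 1)%R] <= (128 / c * e)%:E)%E.
Proof.
move=> c0 e0 mG G0 midG convG.
have mle (h : R) : measurable [set x : plane | G x <= h].
  rewrite (_ : [set x | _] = G @^-1` `]-oo, h]%classic).
    by rewrite -[_ @^-1` _]setTI; exact: mG.
  by apply/seteqP; split => x /=; rewrite in_itv.
pose K : set plane := [set x | G x <= 1].
pose K' : set plane := [set x | G x <= 1 - e].
have -> : [set x | (1 - e < G x <= 1)%R] = K `\` K'.
  apply/seteqP; split => x /=; rewrite /K /K'/=.
    by move=> /andP[h ->]; split=> //; rewrite leNgt h.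
  by move=> [-> /negP]; rewrite -ltNge => ->.
have K'K : K' `<=` K by move=> x /=; rewrite /K /K'/= => h; lra.
(* the minimum may not be attained: [p0] below is a near minimiser *)
pose m := inf (range G).
have hG : has_inf (range G).
  split; first by exists (G (0, 0)); exists (0, 0).
  by exists 0 => _ [x _ <-].
have mle' x : m <= G x by apply: ge_inf; [case: hG|exists x].
(* both coordinates are controlled by the midpoint inequality *)
have close (h : R) x y : G x <= 1 -> G y <= 1 -> 1 - m <= 2 * h -> 0 <= h ->
    `|x.1 - y.1| <= Num.sqrt (16 * h / c) /\ `|x.2 - y.2| <= Num.sqrt (16 * h / c).
  move=> Gx Gy mh h0.
  have sq : (x.1 - y.1) ^+ 2 + (x.2 - y.2) ^+ 2 <= 16 * h / c.
    rewrite ler_pdivlMr// mulrC.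
    have := midG x y; have := mle' (2^-1 * (x.1 + y.1), 2^-1 * (x.2 + y.2)); lra.
  split; rewrite -sqrtr_sqr ler_wsqrtr//; apply: le_trans sq;
    by rewrite ?lerDl ?lerDr sqr_ge0.
have shell (a h : R) p : 0 < a <= 1 -> 0 <= h -> G p <= 1 -> 1 - m <= 2 * h ->
    (forall x, K x -> K' (dilation a p x)) ->
    (area (K `\` K') <= (2 * (1 - a) * (64 * h / c))%:E)%E.
  move=> a01 h0 Gp mh KK'.
  have r2 : 0 <= 16 * h / c by apply: divr_ge0; [exact: mulr_ge0|exact: ltW].
  apply: (le_trans (@area_star_shell a (Num.sqrt (16 * h / c)) p K K' a01 _ _ _ K'K _ KK')) => //.
  - exact: mle.
  - exact: mle.
  - by move=> x Kx; exact: close.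
  - rewrite sqr_sqrtr// lee_fin; apply: ler_wpM2l.
      by case/andP: a01 => _ a1; rewrite mulr_ge0// subr_ge0.
    by rewrite le_eqVlt; apply/orP; left; apply/eqP; ring.
have small (h : R) p : 0 <= h -> G p <= 1 -> 1 - m <= 2 * h -> h <= e ->
    (area (K `\` K') <= (128 / c * e)%:E)%E.
  (* crude bound: the whole of [K] is small *)
  move=> h0 Gp mh he.
  have mD : measurable (K `\` K') by apply: measurableD; exact: mle.
  have r2 : 0 <= 16 * h / c by apply: divr_ge0; [exact: mulr_ge0|exact: ltW].
  apply: (@le_trans _ _ (area K)).
    apply: le_measure; rewrite ?inE//; exact: mle.
  apply: (@le_trans _ _ (4 * Num.sqrt (16 * h / c) ^+ 2)%:E); last first.
    rewrite sqr_sqrtr// lee_fin.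
    have -> : 128 / c * e = 128 * e / c by ring.
    have -> : 4 * (16 * h / c) = 64 * h / c by ring.
    by rewrite ler_pM2r ?invr_gt0//; lra.
  apply: (@area_square p) => [||x Kx]; first exact: sqrtr_ge0.
    exact: mle.
  exact: (close h).
have [[p Gp1]|noK] := pselect (exists p, G p <= 1); last first.
  have C0 : 0 <= 128 / c * e by apply: mulr_ge0; [apply: divr_ge0|]; rewrite ?ltW.
  rewrite (_ : K `\` K' = set0) ?measure0 ?lee_fin//.
  by rewrite -subset0 => x [Kx _]; apply: noK; exists x.
have [m1|m1] := leP 1 m.
  apply: (small 0 p) => //; last exact: ltW.
  by rewrite mulr0 subr_le0.
have gap : 0 < (1 - m) / 2 by rewrite divr_gt0// subr_gt0.
have [_ [p0 _ <-] Gp0] := inf_adherent gap hG.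
rewrite -/m in Gp0.
pose q := 1 - G p0.
have q0 : 0 < q by rewrite /q; lra.
have mq : 1 - m <= 2 * q by rewrite /q; lra.
have Gp0' : G p0 <= 1 by rewrite /q in q0; lra.
have [qe|eq] := leP q e; first exact: (small q p0 (ltW q0) Gp0' mq qe).
pose a := 1 - e / q.
have eq1 : e / q < 1 by rewrite ltr_pdivrMr// mul1r.
have eq0 : 0 < e / q by rewrite divr_gt0.
have a01 : 0 < a <= 1 by rewrite /a; apply/andP; split; lra.
apply: (le_trans (shell a q p0 a01 (ltW q0) Gp0' mq _)).
  move=> x Kx; rewrite /K'/=.
  have a01' : 0 <= a <= 1 by case/andP: a01 => /ltW -> ->.
  apply: (le_trans (convG a p0 x a01')).
  have h1 : a * G x <= a * 1 by apply: ler_wpM2l => //; case/andP: a01'.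
  have h2 : (1 - a) * G p0 = e / q * (1 - q) by rewrite /a /q; ring.
  have h3 : e / q * (1 - q) = e / q - e by field; rewrite gt_eqF.
  by rewrite h2 h3; move: h1; rewrite /a; lra.
rewrite lee_fin /a le_eqVlt; apply/orP; left; apply/eqP.
by field; rewrite !gt_eqF.
Qed.

End planar_dilations.

(** * Gaussian measure of shells *)

Section shell_measure.
Context {R : realType} {H : completeNormedModType R}.
Variable dot : {dot H for idfun}.
Hypothesis hil : is_hilbert dot.
Hypothesis sep : separable H.
Variables (mu : probability (borel H) R) (Q : H -> H).
Hypothesis gauss : gaussian_measure dot mu 0 Q.
Local Notation leb := (@lebesgue_measure R).
Local Notation plane := (measurableTypeR R * measurableTypeR R)%type.
Local Notation CM := (cameron_martin dot mu).

(** The smallest eigenvalue of the Gram matrix of [u] and [v] is at least the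
    quotient of its determinant by its trace. *)
Lemma gram_lower_bound (u v : H) (s t : R) :
  (dot u u * dot v v - dot u v ^+ 2) * (s ^+ 2 + t ^+ 2) <=
  (dot u u + dot v v) * `|s *: u + t *: v| ^+ 2.
Proof.
rewrite -hil dotDl !dotDr !dotZl !dotZr (dotC dot v u).
move: (dot u u) (dot u v) (dot v v) => a b c.
have : 0 <= (s * a + t * b) ^+ 2 + (s * b + t * c) ^+ 2 by rewrite addr_ge0 ?sqr_ge0.
rewrite !expr2; lra.
Qed.

Lemma gram_gt0 (u v : H) : u != 0 -> (forall a : R, v <> a *: u) ->
  0 < dot u u * dot v v - dot u v ^+ 2.
Proof.
move=> u0 nv; have uu : 0 < dot u u by rewrite hil exprn_gt0// normr_gt0.
rewrite ltNge; apply/negP => le0; apply: (nv (dot u v / dot u u)).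
apply/eqP; rewrite -subr_eq0; apply/eqP; apply: (dot_sqr_eq0 hil).
apply/eqP; rewrite eq_le (dot_sqr_ge0 hil) andbT.
rewrite dot_sqrB !(dotZl, dotZr) (dotC dot v u).
have -> : dot v v - 2 * (dot u v / dot u u * dot u v) +
    dot u v / dot u u * (dot u v / dot u u * dot u u) =
    (dot u u * dot v v - dot u v ^+ 2) / dot u u.
  by field; rewrite gt_eqF.
by rewrite ler_pdivrMr// mul0r.
Qed.

Lemma resample_ge0_integral (l k : H) (F : borel H -> \bar R) :
  CM l k -> dot l k = 1 -> measurable_fun [set: borel H] F ->
  (forall x, 0 <= F x)%E ->
  (\int[mu]_x F x = \int[mu]_z \int[mu]_w F (resample dot l k z w))%E.
Proof.
move=> lk lk1 mF F0.
have mT := measurable_resample hil sep l k.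
have law (B : set (borel H)) : measurable B ->
    mu B = square_prob mu ((fun p => resample dot l k p.1 p.2) @^-1` B).
  exact: (resample_law hil sep gauss lk lk1).
rewrite (ge0_integral_law mT law mF F0).
pose f (p : borel H * borel H) := F (resample dot l k p.1 p.2).
have mf : measurable_fun setT f by exact: (measurableT_comp mF mT).
exact: (@fubini_tonelli1 _ _ (borel H) (borel H) R mu mu f mf (fun p => F0 _)).
Qed.

Lemma measurable_resample_integral (l k : H) (F : borel H -> \bar R) :
  measurable_fun [set: borel H] F -> (forall x, 0 <= F x)%E ->
  measurable_fun [set: borel H] (fun z => \int[mu]_w F (resample dot l k z w))%E.
Proof.
move=> mF F0; have mT := measurable_resample hil sep l k.
pose f (p : borel H * borel H) := F (resample dot l k p.1 p.2).
have mf : measurable_fun setT f by exact: (measurableT_comp mF mT).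
exact: (@measurable_fun_fubini_tonelli_F _ _ (borel H) (borel H) R mu f mf
  (fun p => F0 _)).
Qed.

Variables (g : H -> R) (gamma : R).
Hypothesis gamma0 : 0 < gamma.
Hypothesis cg : continuous g.
Hypothesis g_ge0 : forall x, 0 <= g x.
Hypothesis g_mid : forall x y,
  g (2^-1 *: (x + y)) <= (g x + g y) / 2 - gamma / 8 * `|x - y| ^+ 2.
Hypothesis g_conv : forall (t : R) (x y : H), 0 <= t <= 1 ->
  g (t *: x + (1 - t) *: y) <= t * g x + (1 - t) * g y.

Definition shell (e : R) : set H := [set x | 1 - e < g x <= 1].

Lemma measurable_level (I : interval R) :
  @measurable _ (borel H) [set x | g x \in I].
Proof.
have mg : measurable_fun [set: borel H] (g : borel H -> R) by exact: continuous_borel.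
have := mg measurableT [set` I] (measurable_itv I).
by rewrite setTI.
Qed.

Lemma measurable_shell e : @measurable _ (borel H) (shell e).
Proof.
rewrite (_ : shell e = [set x | g x \in `]1 - e, 1]]); first exact: measurable_level.
by apply/seteqP; split => x /=; rewrite in_itv.
Qed.

Definition planar (a u v : H) (x : R * R) : H := a + x.1 *: u + x.2 *: v.

Lemma measurable_planar (a u v : H) :
  measurable_fun [set: plane] (planar a u v : plane -> borel H).
Proof.
apply: (measurable_to_borel hil sep) => h.
rewrite (_ : (fun x : plane => dot h (planar a u v x)) =
  fun x : plane => dot h a + x.1 * dot h u + x.2 * dot h v); last first.
  by apply/funext => x; rewrite /planar !dotDr !dotZr.
apply: measurable_funD.
  apply: measurable_funD; first exact: measurable_cst.
  by apply: measurable_funM; [exact: measurable_fst|exact: measurable_cst].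
by apply: measurable_funM; [exact: measurable_snd|exact: measurable_cst].
Qed.

Lemma measurable_planar_shell (a u v : H) (e : R) :
  measurable [set x : plane | shell e (planar a u v x)].
Proof.
rewrite -[X in measurable X]setTI.
apply: (measurable_planar a u v) => //; exact: measurable_shell.
Qed.

(** [strongly_convex_shell] on the affine plane through [a] with directions [u]
    and [v]. *)
Lemma planar_shell_area (a u v : H) (c0 e : R) : 0 < c0 -> 0 < e ->
  (forall s t : R, c0 * (s ^+ 2 + t ^+ 2) <= `|s *: u + t *: v| ^+ 2) ->
  ((leb \x leb) [set x : plane | shell e (planar a u v x)] <=
    (128 / (gamma * c0) * e)%:E)%E.
Proof.
move=> c00 e0 uv.
pose G (x : R * R) := g (planar a u v x).
have mG : measurable_fun [set: plane] (G : plane -> R).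
  exact: (measurableT_comp (continuous_borel cg) (measurable_planar a u v)).
apply: (@strongly_convex_shell R (gamma * c0) e G) => //.
- exact: mulr_gt0.
- by move=> x; exact: g_ge0.
- move=> x y.
  have -> : G (2^-1 * (x.1 + y.1), 2^-1 * (x.2 + y.2)) =
      g (2^-1 *: (planar a u v x + planar a u v y)).
    congr g; apply: (dot_inj hil) => h.
    by rewrite /planar/= !(dotDl, dotZl); field.
  apply: (le_trans (g_mid _ _)); rewrite lerD2l lerN2.
  have -> : planar a u v x - planar a u v y = (x.1 - y.1) *: u + (x.2 - y.2) *: v.
    by apply: (dot_inj hil) => h; rewrite /planar !(dotBl, dotDl, dotZl); ring.
  have := uv (x.1 - y.1) (x.2 - y.2) => le.
  rewrite (_ : gamma * c0 / 8 * _ =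
    gamma / 8 * (c0 * ((x.1 - y.1) ^+ 2 + (x.2 - y.2) ^+ 2))); last by ring.
  by apply: ler_wpM2l => //; apply: divr_ge0 => //; exact: ltW.
- move=> t p x t01.
  have -> : G (dilation t p x) = g (t *: planar a u v x + (1 - t) *: planar a u v p).
    congr g; apply: (dot_inj hil) => h.
    by rewrite /planar/= !(dotDl, dotZl); ring.
  exact: g_conv.
Qed.

(** The density bound of [dual_density] in integrated form. *)
Lemma dual_integral_le (l k : H) (f : R -> \bar R) : CM l k -> dot l k = 1 ->
  measurable_fun [set: measurableTypeR R] (f : measurableTypeR R -> \bar R) ->
  (forall t, 0 <= f t)%E ->
  (\int[mu]_x f (dot k x) <= \int[leb]_t f t)%E.
Proof.
move=> lk lk1 mf f0.
pose phi : borel H -> measurableTypeR R := dot k.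
have mphi : measurable_fun setT phi by exact: measurable_dot.
pose nu : {measure set _ -> \bar R} := pushforward mu phi.
have -> : (\int[mu]_x f (dot k x) = \int[nu mphi]_t f t)%E.
  by rewrite (@ge0_integral_law _ _ _ _ _ mu (nu mphi) phi mphi).
apply: ge0_le_measure_integral => // S mS.
exact: (dual_density hil gauss lk lk1).
Qed.

(** In dimension at least two: resampling two independent coordinates reduces the
    estimate to planar sections. *)
Lemma shell_measure_plane (l1 k1 l2 k2 : H) :
  CM l1 k1 -> dot l1 k1 = 1 -> CM l2 k2 -> dot l2 k2 = 1 ->
  l1 != 0 -> (forall a : R, l2 <> a *: l1) ->
  exists C : R, forall e : R, 0 < e -> (mu (shell e) <= (C * e)%:E)%E.
Proof.
move=> lk1 d1 lk2 d2 l10 indep.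
pose u := l2 - dot k1 l2 *: l1.
have indep' (a : R) : u <> a *: l1.
  move=> ua; apply: (indep (a + dot k1 l2)).
  by rewrite scalerDl -ua /u subrK.
have det0 := gram_gt0 l10 indep'.
have tr0 : 0 < dot l1 l1 + dot u u.
  by apply: ltr_pwDl; [rewrite hil exprn_gt0// normr_gt0|exact: dot_sqr_ge0].
pose c0 := (dot l1 l1 * dot u u - dot l1 u ^+ 2) / (dot l1 l1 + dot u u).
have c00 : 0 < c0 by exact: divr_gt0.
have bound (s t : R) : c0 * (s ^+ 2 + t ^+ 2) <= `|s *: u + t *: l1| ^+ 2.
  rewrite /c0 mulrAC ler_pdivrMr// [leRHS]mulrC.
  rewrite (addrC (s *: u)) (addrC (s ^+ 2)).
  exact: gram_lower_bound.
exists (128 / (gamma * c0)) => e e0.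
have mS := measurable_shell e.
pose F (z : borel H) := mu [set w | shell e (resample dot l1 k1 z w)].
have mF : measurable_fun [set: borel H] F.
  have mT := measurable_resample hil sep l1 k1.
  have mB : measurable ((fun p : borel H * borel H =>
      resample dot l1 k1 p.1 p.2 : borel H) @^-1` shell e).
    by rewrite -[_ @^-1` _]setTI; exact: mT.
  rewrite (_ : F = fun z => mu (xsection ((fun p : borel H * borel H =>
      resample dot l1 k1 p.1 p.2 : borel H) @^-1` shell e) z)).
    exact: measurable_fun_xsection.
  apply/funext => z; congr (mu _).
  by apply/seteqP; split => w /=; rewrite /xsection/= inE.
rewrite (resample_measure hil sep gauss lk1 d1 mS).
rewrite (resample_ge0_integral lk2 d2 mF)//.
have mu1 : ((128 / (gamma * c0) * e)%:E =
    \int[mu]_z (cst (128 / (gamma * c0) * e)%:E) z)%E.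
  by rewrite integral_cst// [X in (_ * X)%E](_ : _ = 1%E) ?mule1//; exact: probability_setT.
rewrite [leRHS]mu1.
have C0 : 0 <= 128 / (gamma * c0) * e.
  apply: mulr_ge0; last exact: ltW.
  by apply: divr_ge0 => //; apply: mulr_ge0; exact: ltW.
apply: ge0_le_integral => //=.
- by move=> z _; apply: integral_ge0.
- exact: measurable_resample_integral.
move=> z _.
pose b := z - dot k2 z *: l2.
pose a := b - dot k1 b *: l1.
pose S : set plane := [set x : plane | shell e (planar a u l1 x)].
have mS' : measurable S by exact: measurable_planar_shell.
apply: (le_trans _ (planar_shell_area a c00 e0 bound)).
apply: (@le_trans _ _ (\int[mu]_w leb (xsection S (dot k2 w)))%E); last first.
  apply: (dual_integral_le lk2 d2) => //.
  exact: measurable_fun_xsection.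
apply: ge0_le_integral => //=.
- exact: (measurableT_comp mF (measurable_resample_r hil sep l2 k2 z)).
- have mx : measurable_fun [set: measurableTypeR R] (fun t => leb (xsection S t)).
    exact: measurable_fun_xsection.
  have mk : measurable_fun [set: borel H] (dot k2 : borel H -> measurableTypeR R).
    exact: measurable_dot.
  exact: (measurableT_comp mx mk).
- move=> w _.
  rewrite /F (_ : [set _ | _] = [set w' | xsection S (dot k2 w) (dot k1 w')]).
    by apply: (dual_density hil gauss lk1 d1); exact: measurable_xsection.
  apply/funext => w'; rewrite /xsection/= in_setE /S/=.
  congr (shell e _); apply: (dot_inj hil) => h; rewrite /planar /resample /a /u /b/=.
  by rewrite !(dotNl, dotNr, dotDl, dotZl, dotDr, dotZr); ring.
Qed.

(** In dimension one: [g] is nondecreasing away from its minimum at the origin,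
    where it vanishes.  The estimate of the shell of an interval is read off from
    that of a planar strip. *)
Lemma shell_measure_line (l k : H) : g 0 = 0 -> CM l k -> dot l k = 1 ->
  (forall x, x = dot k x *: l) ->
  exists C : R, forall e : R, 0 < e < 1 -> (mu (shell e) <= (C * e)%:E)%E.
Proof.
move=> g00 lk lk1 line.
have l0 : 0 < `|l|.
  rewrite normr_gt0; apply/eqP => l0; move: lk1; rewrite l0 dot0l => /eqP.
  by rewrite eq_sym oner_eq0.
pose r := 1 + Num.sqrt (4 / gamma) / `|l|.
have r0 : 0 <= Num.sqrt (4 / gamma) / `|l|.
  by apply: divr_ge0; [exact: sqrtr_ge0|exact: ltW].
have tr (t : R) : g (t *: l) <= 1 -> `|t| <= r.
  move=> gt; apply: (@le_trans _ _ (Num.sqrt (4 / gamma) / `|l|)); last by rewrite lerDr.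
  rewrite ler_pdivlMr// -normrZ -[leLHS]ger0_norm// -sqrtr_sqr.
  apply: ler_wsqrtr; rewrite ler_pdivlMr//.
  have := g_mid (t *: l) 0; have := g_ge0 (2^-1 *: (t *: l + 0)).
  by rewrite g00 subr0; move: (`|t *: l| ^+ 2) => q; lra.
exists (8 * r ^+ 2) => e /andP[e0 e1].
have mlev (I : interval R) : measurable [set t : measurableTypeR R | g (t *: l) \in I].
  have cl : continuous (fun t : R => g (t *: l)).
    move=> t; apply: (@continuous_comp _ _ _ (fun t : R => t *: l) g); last exact: cg.
    by apply: cvgZr_tmp; exact: cvg_id.
  have := continuous_measurable_fun cl measurableT (measurable_itv I).
  by rewrite setTI.
pose K h : set plane :=
  [set t : measurableTypeR R | g (t *: l) \in `]-oo, h]] `*` `[0, 1]%classic.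
have mK h : measurable (K h) by apply: measurableX => //; exact: mlev.
pose B := [set t : measurableTypeR R | g (t *: l) \in `]1 - e, 1]].
have mB : measurable B by exact: mlev.
have -> : shell e = [set x | B (dot k x)].
  by apply/seteqP; split => x; rewrite /B/= in_itv/= -line.
apply: (le_trans (dual_density hil gauss lk lk1 mB)).
pose I01 : set (measurableTypeR R) := `[0, 1]%classic.
have -> : (leb B = (leb \x leb) (B `*` I01))%E.
  have m01 : measurable I01 by exact: measurable_itv.
  have I1 : leb I01 = 1%E.
    by rewrite /I01 lebesgue_measure_itv/= lte_fin ltr01 oppr0 adde0.
  apply: (etrans _ (esym (product_measure1E leb leb mB m01))).
  by rewrite -[LHS]mule1; congr (_ * _)%E; exact: esym I1.
have -> : B `*` I01 = K 1 `\` K (1 - e).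
  rewrite /K; apply/seteqP; split => x /=; rewrite /B/= !in_itv/=.
    by move=> [/andP[h1 h2] h3]; split=> // -[]; rewrite leNgt h1.
  move=> [[h1 h2] h3]; split=> //; rewrite h1 andbT ltNge; apply/negP => h4.
  exact: h3.
have -> : 8 * r ^+ 2 * e = 2 * (1 - (1 - e)) * (4 * r ^+ 2) by ring.
apply: (@area_star_shell R (1 - e) r (0, 0)) => //=.
- by apply/andP; split; lra.
- by rewrite /r; lra.
- move=> x; rewrite /K/= !in_itv/= => -[h1 h2]; split=> //; apply: (le_trans h1); lra.
- move=> x; rewrite /K/= !in_itv/= !subr0 => -[/tr h1 /andP[h2 h3]]; split=> //.
  by rewrite ger0_norm// /r; lra.
- move=> x; rewrite /K/= !in_itv/= !mulr0 !addr0 => -[h1 /andP[h2 h3]]; split.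
    have e01 : 0 <= 1 - e <= 1 by apply/andP; split; lra.
    have := g_conv (x.1 *: l) 0 e01.
    rewrite scaler0 addr0 g00 mulr0 addr0 scalerA => /le_trans; apply.
    have e1' : 0 <= 1 - e by lra.
    by have := ler_wpM2l e1' h1; rewrite mulr1.
  have e1' : 0 <= 1 - e by lra.
  apply/andP; split; first exact: mulr_ge0.
  have := ler_wpM2l e1' h3; rewrite mulr1 => /le_trans; apply; lra.
Qed.

(** Shells have measure [O(e)]: according to the number of independent directions
    among those of [D], one of the previous two estimates applies. *)
Lemma shell_measure (D : set H) : g 0 = 0 -> dense D ->
  (forall l, D l -> l != 0 -> exists2 k, CM l k & 0 < dot l k) ->
  exists C : R, forall e : R, 0 < e < 1 -> (mu (shell e) <= (C * e)%:E)%E.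
Proof.
move=> g00 dD CMD.
have dirs (l : H) : D l -> l != 0 -> exists s : R, exists k : H,
    [/\ s != 0, CM (s *: l) k & dot (s *: l) k = 1].
  move=> Dl l0; have [k lk lk0] := CMD l Dl l0.
  have [s s0 [? ?]] := cameron_martin_unit hil gauss lk lk0.
  by exists s, (s *: k); split=> //; rewrite gt_eqF.
have [[x0 x00]|triv] := pselect (exists x : H, x != 0); last first.
  exists 0 => e /andP[e0 e1].
  rewrite (_ : shell e = set0) ?measure0 ?mul0r// -subset0 => x /andP[h _].
  have x0 : x = 0 by apply/eqP; apply/negPn/negP => h'; apply: triv; exists x.
  by move: h; rewrite x0 g00; lra.
have op : open [set x : H | x != 0].
  rewrite (_ : [set x : H | x != 0] = ~` [set 0]).
    exact/closed_openC/accessible_closed_set1/hausdorff_accessible/norm_hausdorff.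
  by apply/seteqP; split => x /=; [move=> /eqP|move=> /eqP].
have [l1 [/= l10 Dl1]] : [set x : H | x != 0] `&` D !=set0 by apply: dD => //; exists x0.
have [s1 [k1 [s10 lk1 d1]]] := dirs l1 Dl1 l10.
set u := s1 *: l1 in lk1 d1.
have u0 : u != 0 by rewrite scaler_eq0 negb_or s10.
have [[l2 [Dl2 indep]]|dep] := pselect (exists l2, D l2 /\ forall a : R, l2 <> a *: u).
  have l20 : l2 != 0.
    by apply/eqP => l20; apply: (indep 0); rewrite scale0r.
  have [s2 [k2 [s20 lk2 d2]]] := dirs l2 Dl2 l20.
  have indep2 (a : R) : s2 *: l2 <> a *: u.
    move=> h; apply: (indep (s2^-1 * a)).
    by rewrite -scalerA -h scalerA mulVf// scale1r.
  have [C HC] := shell_measure_plane lk1 d1 lk2 d2 u0 indep2.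
  by exists C => e /andP[e0 _]; exact: HC.
apply: (shell_measure_line g00 lk1 d1) => x; apply: contrapT => nx.
have cf : continuous (fun x : H => x - dot k1 x *: u).
  move=> y; apply: cvgB; first exact: cvg_id.
  by apply: cvgZr_tmp; exact: continuous_dotr.
have op2 : open ((fun x : H => x - dot k1 x *: u) @^-1` [set x : H | x != 0]).
  by apply: open_comp => // y _; exact: cf.
have [|l2 [/= h Dl2]] := dD _ _ op2.
  by exists x => /=; rewrite subr_eq0; exact/eqP.
apply: dep; exists l2; split=> // a l2E; move: h.
by rewrite l2E dotZr (dotC dot k1 u) d1 mulr1 subrr eqxx.
Qed.

End shell_measure.

(** * A smooth step *)

Section smoothstep.
Context {R : realType}.

(** A quadratic error estimate is inherited by combinations and rescalings, and
    for the square of a positive part it is elementary. *)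
Lemma is_derive_quadratic (F : R -> R) (x d C : R) :
  (forall h, `|F (x + h) - F x - d * h| <= C * h ^+ 2) -> is_derive x 1 F d.
Proof.
move=> Fd; have C0 : 0 <= C.
  by have := le_trans (normr_ge0 _) (Fd 1); rewrite expr1n mulr1.
have [] := @has_diff R R R F ( *%R d : R -> R) `|d| x _ _ _.
- by move=> a y z; rewrite mulrDr; congr (_ + _); rewrite /= mulrCA.
- by move=> h; rewrite normrM.
- move=> e e0; have r0 : 0 < e / (C + 1) by apply: divr_gt0 => //; lra.
  have : \forall h \near (0 : R), `|h| <= e / (C + 1) by exact: nbhs0_le.
  apply: filterS => h hr; apply: (le_trans (Fd h)).
  rewrite -[h ^+ 2]real_normK ?num_real// expr2 mulrA; apply: ler_wpM2r => //.
  apply: (@le_trans _ _ ((C + 1) * `|h|)); first by apply: ler_wpM2r => //; lra.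
  by rewrite mulrC -ler_pdivlMr//; lra.
move=> dF dE; apply: DeriveDef; first exact: diff_derivable.
by rewrite deriveE// dE mulr1.
Qed.

Definition sqr_pos (x : R) : R := Num.max x 0 ^+ 2.

Lemma sqr_pos_quadratic (x h : R) :
  `|sqr_pos (x + h) - sqr_pos x - 2 * Num.max x 0 * h| <= h ^+ 2.
Proof.
rewrite /sqr_pos; case: (leP x 0) => x0; case: (leP (x + h) 0) => y0.
- by rewrite !expr2 !(mulr0, mul0r) subrr subr0 normr0 -expr2 sqr_ge0.
- rewrite !expr2 !(mulr0, mul0r) !subr0 ger0_norm; last by rewrite -expr2 sqr_ge0.
  by nra.
- by rewrite ler_norml !expr2; apply/andP; split; nra.
- by rewrite ler_norml !expr2; apply/andP; split; nra.
Qed.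

(** A [C^1] transition from 0 to 1 with derivative at most 2: it is quadratic on
    each half of the unit interval. *)
Definition smoothstep (x : R) : R :=
  2 * (sqr_pos x - 2 * sqr_pos (x - 2^-1) + sqr_pos (x - 1)).

Definition dsmoothstep (x : R) : R :=
  4 * (Num.max x 0 - 2 * Num.max (x - 2^-1) 0 + Num.max (x - 1) 0).

Lemma smoothstep_quadratic (x h : R) :
  `|smoothstep (x + h) - smoothstep x - dsmoothstep x * h| <= 8 * h ^+ 2.
Proof.
have := sqr_pos_quadratic x h; have := sqr_pos_quadratic (x - 2^-1) h.
have := sqr_pos_quadratic (x - 1) h.
rewrite /smoothstep /dsmoothstep (addrAC x h) (addrAC x h (- 1)) !ler_norml.
by move=> /andP[? ?] /andP[? ?] /andP[? ?]; apply/andP; split; lra.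
Qed.

Lemma smoothstep_bounds (x : R) : 0 <= smoothstep x <= 1.
Proof.
rewrite /smoothstep /sqr_pos.
case: (leP x 0) => h1; case: (leP (x - 2^-1) 0) => h2;
case: (leP (x - 1) 0) => h3; rewrite ?expr0n/= ?expr2; nra.
Qed.

Lemma smoothstep0 (x : R) : x <= 0 -> smoothstep x = 0.
Proof.
move=> x0; rewrite /smoothstep /sqr_pos !max_r; lra.
Qed.

Lemma smoothstep1 (x : R) : 1 <= x -> smoothstep x = 1.
Proof.
move=> x1; rewrite /smoothstep /sqr_pos !max_l; lra.
Qed.

Lemma dsmoothstep0 (x : R) : ~~ (0 < x < 1) -> dsmoothstep x = 0.
Proof.
rewrite negb_and -!leNgt => /orP[] h; rewrite /dsmoothstep.
  by rewrite !max_r; lra.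
by rewrite !max_l; lra.
Qed.

Lemma dsmoothstep_le (x : R) : `|dsmoothstep x| <= 2.
Proof.
rewrite /dsmoothstep ler_norml.
case: (leP x 0) => h1; case: (leP (x - 2^-1) 0) => h2;
case: (leP (x - 1) 0) => h3; apply/andP; split; lra.
Qed.

Lemma continuous_dsmoothstep : continuous dsmoothstep.
Proof.
have cm (c : R) : continuous (fun x : R => Num.max (x - c) 0).
  move=> x; apply: (@continuous_max _ _ (fun x : R => x - c) (fun=> 0)).
    by apply: cvgB; [exact: cvg_id|exact: cvg_cst].
  exact: cvg_cst.
move=> x; apply: cvgMl_tmp; apply: cvgD; last exact: cm.
apply: cvgB; last by apply: cvgMl_tmp; exact: cm.
have := cm 0 x; under eq_fun do rewrite subr0; exact.
Qed.

Lemma is_derive_rescaled_smoothstep (e t : R) :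
  is_derive t 1 (fun t => smoothstep ((1 - t) / e)) (- (dsmoothstep ((1 - t) / e) / e)).
Proof.
apply: (@is_derive_quadratic _ _ _ (8 / e ^+ 2)) => h.
have := smoothstep_quadratic ((1 - t) / e) (- h / e).
have -> : (1 - t) / e + - h / e = (1 - (t + h)) / e by ring.
have -> : - (dsmoothstep ((1 - t) / e) / e) * h = dsmoothstep ((1 - t) / e) * (- h / e).
  by ring.
by have -> : 8 * (- h / e) ^+ 2 = 8 / e ^+ 2 * h ^+ 2 by rewrite -exprVn; ring.
Qed.

End smoothstep.

(** * Cut-off functions *)

Section exhaustion.
Context {R : realType} {H : completeNormedModType R}.
Variable dot : {dot H for idfun}.
Hypothesis hil : is_hilbert dot.
Variable mu : probability (borel H) R.

(** The only information on the set [Gam] that is used below: cut-off functions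
    supported in [Gam], of uniformly bounded total variation, which exhaust [Gam]
    up to a null set. *)
Definition exhaustion (Gam : set H) (chi : nat -> H -> R) (V : R) : Prop :=
  [/\ @measurable _ (borel H) Gam,
      forall n, Cb1 dot (chi n),
      forall n x, 0 <= chi n x <= \1_Gam x /\ (~ Gam x -> nabla dot (chi n) x = 0),
      forall n, \int[mu]_x `|nabla dot (chi n) x| <= V &
      forall f : borel H -> R, mu.-integrable setT (EFin \o f) ->
        \int[mu]_x (f x * chi n x) @[n --> \oo] --> \int[mu]_x (f x * \1_Gam x)].

Lemma Rintegral_indic (A : set H) : @measurable _ (borel H) A ->
  mu.-integrable [set: borel H] (EFin \o (\1_A : borel H -> R)) /\
  \int[mu]_x (\1_A x : R) = fine (mu A).
Proof.
move=> mA; split; last by rewrite /Rintegral integral_indic// setIT.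
have mi : measurable_fun [set: borel H] (\1_A : borel H -> R) by exact: measurable_indic.
apply: (@integrable_bounded _ (borel H) R mu \1_A 1 mi).
by move=> x; rewrite indicE; case: (_ \in _); rewrite ?normr1 ?normr0.
Qed.

Variables (g : H -> R) (K C : R).
Hypothesis dg : forall x, differentiable g x.
Hypothesis cDg : continuous (nabla dot g).
Hypothesis K0 : 0 <= K.
Hypothesis bDg : forall x, g x <= 1 -> `|nabla dot g x| <= K.
Hypothesis shellC : forall e : R, 0 < e < 1 -> (mu (shell g e) <= (C * e)%:E)%E.

Let cg : continuous g.
Proof. by move=> x; exact: differentiable_continuous. Qed.

Let mlev (I : interval R) : @measurable _ (borel H) [set x | g x \in I].
Proof. exact: measurable_level. Qed.

Let mlev1 : @measurable _ (borel H) [set x | g x = 1].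
Proof.
rewrite (_ : [set x | _] = [set x | g x \in `[1, 1]]); first exact: mlev.
apply/seteqP; split => x /=; rewrite in_itv/=; first by move=> ->; rewrite lexx.
by move=> ?; apply/eqP; rewrite eq_le andbC.
Qed.

(** The level set lies in all the shells. *)
Lemma level_null : mu [set x | g x = 1] = 0%E.
Proof.
apply/eqP; rewrite eq_le measure_ge0 andbT; apply/lee_addgt0Pr => d d0.
rewrite add0e.
have C1 : 0 < `|C| + 1 + d by apply: addr_gt0 => //; apply: ltr_wpDl.
pose e := d / (`|C| + 1 + d).
have e01 : 0 < e < 1.
  rewrite divr_gt0//= ltr_pdivrMr// mul1r ltrDr.
  by apply: ltr_wpDl.
apply: (@le_trans _ _ (mu (shell g e))).
  apply: le_measure; rewrite ?inE//; first exact: measurable_shell.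
  by move=> x /= gx; rewrite /shell/= gx lexx andbT; move: e01; lra.
apply: (le_trans (shellC e01)); rewrite lee_fin /e mulrA ler_pdivrMr// mulrC.
by apply: ler_wpM2l; [exact: ltW|have := ler_norm C; lra].
Qed.

(** A [C_b^1] approximation of the indicator of the sublevel set, which varies in
    the shell only. *)
Definition cutoff (e : R) (x : H) : R := smoothstep ((1 - g x) / e).

Lemma cutoff_diff (e : R) x : differentiable (cutoff e) x /\
  nabla dot (cutoff e) x = (- (dsmoothstep ((1 - g x) / e) / e)) *: nabla dot g x.
Proof.
exact: (grad_comp hil (@is_derive_rescaled_smoothstep R e) (dg x)).
Qed.

Lemma cutoff_out (e : R) x : 0 < e -> 1 <= g x ->
  cutoff e x = 0 /\ nabla dot (cutoff e) x = 0.
Proof.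
move=> e0 gx; have h : (1 - g x) / e <= 0 by rewrite ler_pdivrMr// mul0r; lra.
split; first exact: smoothstep0.
have [_ ->] := cutoff_diff e x.
by rewrite dsmoothstep0 ?mul0r ?oppr0 ?scale0r//; rewrite ltNge h.
Qed.

Lemma cutoff_slope (e : R) x : 0 < e ->
  `|nabla dot (cutoff e) x| <= 2 * K / e * \1_(shell g e) x.
Proof.
move=> e0; have [_ ->] := cutoff_diff e x; rewrite normrZ normrN normrM.
have [sx|nsx] := pselect (shell g e x); last first.
  rewrite dsmoothstep0 ?normr0 ?mul0r ?indicE ?memNset ?mulr0//.
  apply/negP => /andP[h1 h2]; apply: nsx; rewrite /shell/=.
  move: h1 h2; rewrite ltr_pdivlMr// mul0r ltr_pdivrMr// mul1r => h1 h2.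
  by apply/andP; split; lra.
have e1 : 0 <= e^-1 by rewrite invr_ge0 ltW.
rewrite indicE mem_set// mulr1 (ger0_norm e1).
rewrite mulrAC; apply: ler_wpM2r => //.
apply: ler_pM => //; first exact: dsmoothstep_le.
by apply: bDg; case/andP: sx.
Qed.

Lemma Cb1_cutoff (e : R) : 0 < e -> Cb1 dot (cutoff e).
Proof.
move=> e0; apply/Cb1E; split.
- exists 1 => x; have /andP[h1 h2] := smoothstep_bounds ((1 - g x) / e).
  by rewrite ger0_norm.
- by move=> x; case: (cutoff_diff e x).
- rewrite (_ : nabla _ _ = fun x =>
    (- (dsmoothstep ((1 - g x) / e) / e)) *: nabla dot g x); last first.
    by apply/funext => x; case: (cutoff_diff e x).
  move=> x; apply: cvgZ; last exact: cDg.
  apply: cvgN; apply: cvgMr_tmp.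
  apply: (@continuous_comp _ _ _ (fun x => (1 - g x) / e) dsmoothstep); last first.
    exact: continuous_dsmoothstep.
  by apply: cvgMr_tmp; apply: cvgB; [exact: cvg_cst|exact: cg].
- exists (2 * K / e) => x; apply: (le_trans (cutoff_slope x e0)).
  have : 0 <= 2 * K / e by apply: divr_ge0; [exact: mulr_ge0|exact: ltW].
  by move=> h; rewrite ler_piMr// indicE; case: (_ \in _).
Qed.

(** The slope [O(1 / e)] of the cut-off function is compensated by the measure
    [O(e)] of the shell. *)
Lemma cutoff_variation (e : R) : 0 < e < 1 ->
  \int[mu]_x `|nabla dot (cutoff e) x| <= 2 * K * C.
Proof.
move=> e01; have /andP[e0 e1] := e01.
have mS : @measurable _ (borel H) (shell g e) by exact: measurable_shell.
have [iS ES] := Rintegral_indic mS.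
have /Cb1E[_ _ cD [M bM]] := Cb1_cutoff e0.
have iD : mu.-integrable [set: borel H]
    (EFin \o (fun x : borel H => `|nabla dot (cutoff e) x|)).
  apply: (@integrable_bounded _ _ _ _ _ M); last by move=> x; rewrite normr_id.
  by apply: continuous_borel => x; apply: cvg_norm; exact: cD.
apply: (le_trans (Rintegral_le iD (integrable_scale (2 * K / e) iS) _)).
  by move=> x; exact: cutoff_slope.
rewrite RintegralZl// ES.
have le : fine (mu (shell g e)) <= C * e.
  by rewrite -lee_fin fineK ?shellC// fin_num_measure.
have h : 0 <= 2 * K / e by apply: divr_ge0; [exact: mulr_ge0|exact: ltW].
apply: (le_trans (ler_wpM2l h le)).
by rewrite le_eqVlt; apply/orP; left; apply/eqP; field; rewrite gt_eqF.
Qed.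

Lemma cutoff_cvg x : cutoff n.+2%:R^-1 x @[n --> \oo] --> (\1_[set x | g x < 1] x : R).
Proof.
have [gx|gx] := ltP (g x) 1; last first.
  rewrite indicE memNset/= ?ltNge ?gx//.
  apply: cvg_near_cst; near=> n.
  by have [|->] := @cutoff_out n.+2%:R^-1 x _ gx.
rewrite indicE mem_set//; apply: cvg_near_cst.
exists (Num.truncn (1 - g x)^-1) => // n /= hn.
apply: smoothstep1; rewrite invrK -ler_pdivrMl ?subr_gt0// mulr1.
have h : 0 <= (1 - g x)^-1 by rewrite invr_ge0 subr_ge0 ltW.
have /andP[_ h2] := truncn_itv h.
apply: (le_trans (ltW h2)); rewrite ler_nat.
exact: (leq_trans (n := n.+1)).
Unshelve. all: by end_near. Qed.

Lemma sublevel_exhaustion : exhaustion [set x | g x <= 1]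
  (fun n => cutoff n.+2%:R^-1) (2 * K * C).
Proof.
have e01 n : 0 < (n.+2%:R^-1 : R) < 1.
  by rewrite invr_gt0 ltr0n/= invf_lt1// ltr1n.
have e0 n : 0 < n.+2%:R^-1 :> R by case/andP: (e01 n).
have mG : @measurable _ (borel H) [set x | g x <= 1].
  rewrite (_ : [set x | _] = [set x | g x \in `]-oo, 1]]); first exact: mlev.
  by apply/seteqP; split => x /=; rewrite in_itv.
have mG' : @measurable _ (borel H) [set x | g x < 1].
  rewrite (_ : [set x | _] = [set x | g x \in `]-oo, 1[]); first exact: mlev.
  by apply/seteqP; split => x /=; rewrite in_itv.
split=> //.
- by move=> n; exact: Cb1_cutoff.
- move=> n x; split.
    have [gx|gx] := leP (g x) 1.
      by rewrite indicE mem_set//; exact: smoothstep_bounds.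
    by rewrite (cutoff_out (e0 n) (ltW gx)).1 lexx indicE ler0n.
  by move=> /negP; rewrite -ltNge => /ltW gx; exact: (cutoff_out (e0 n) gx).2.
- by move=> n; exact: cutoff_variation.
- move=> f fi; have mf := integrable_measurable fi.
  have mc n : measurable_fun [set: borel H] (cutoff n.+2%:R^-1 : borel H -> R).
    exact: continuous_borel (Cb1_continuous (Cb1_cutoff (e0 n))).
  have -> : \int[mu]_x (f x * \1_[set x | g x <= 1] x) =
      \int[mu]_x (f x * \1_[set x | g x < 1] x).
    rewrite /Rintegral; congr fine; apply: ae_eq_integral => //.
    + apply/measurable_EFinP; apply: measurable_funM => //.
    + apply/measurable_EFinP; apply: measurable_funM => //.
    + exists [set x | g x = 1]; split; [exact: mlev1|exact: level_null|].
      move=> x /= nE; apply: contrapT => gx1; apply: nE => _.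
      congr (_ * _)%:E; rewrite !indicE; congr (_%:R); congr nat_of_bool.
      apply/idP/idP; rewrite !inE/=; last exact: ltW.
      by move=> h; rewrite lt_neqAle h andbT; exact/eqP.
  have bnd n x : `|f x * cutoff n.+2%:R^-1 x| <= `|f x|.
    have /andP[h1 h2] := smoothstep_bounds ((1 - g x) / n.+2%:R^-1).
    by rewrite normrM ler_piMr// ger0_norm.
  have cvg x : f x * cutoff n.+2%:R^-1 x @[n --> \oo] -->
      f x * \1_[set x | g x < 1] x.
    by apply: cvgMl_tmp; exact: cutoff_cvg.
  exact: (@Rintegral_cvg _ (borel H) R mu _ _ _
    (fun n => measurable_funM mf (mc n)) (integrable_norm fi) bnd cvg).2.
Qed.

End exhaustion.

(** * Divergence and bounded variation *)

Section divergence.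
Context {R : realType} {H : completeNormedModType R}.
Variable dot : {dot H for idfun}.
Hypothesis hil : is_hilbert dot.
Hypothesis sep : separable H.
Variables (DA : set H) (A : H -> H) (delta : R).
Hypothesis selfA : self_adjoint dot DA A.
Hypothesis delta0 : 0 < delta.
Hypothesis coercive : forall x, DA x -> delta * `|x| ^+ 2 <= dot (A x) x.
Variable mu : probability (borel H) R.
Hypothesis gauss : gaussian_measure dot mu 0 (fun x : H => 2^-1 *: op_inverse DA A x).

Lemma operator0 : DA 0 /\ A 0 = 0.
Proof.
have [[DA0 lin] _ _] := selfA; split=> //.
have [_] := lin 1 0 0 DA0 DA0; rewrite scaler0 addr0 scale1r => e.
by apply: (addrI (A 0)); rewrite -e addr0.
Qed.

Lemma operatorZ (a : R) x : DA x -> DA (a *: x) /\ A (a *: x) = a *: A x.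
Proof.
move=> Dx; have [[DA0 lin] _ _] := selfA; have [_ A0] := operator0.
by have := lin a x 0 Dx DA0; rewrite A0 !addr0.
Qed.

Lemma op_inverseK x : DA x -> op_inverse DA A (A x) = x.
Proof.
move=> Dx; have [[DA0 lin] _ _] := selfA.
have [Dy Ay] := @getPex _ [set y | DA y /\ A y = A x] (ex_intro _ x (conj Dx erefl)).
rewrite -/(op_inverse DA A (A x)) in Dy Ay; set y := op_inverse _ _ _ in Dy Ay *.
have [Dz Az] := lin (-1) x y Dx Dy.
have := coercive Dz; rewrite Az Ay (scaleN1r (A x)) addNr dot0l => le.
have := sqr_ge0 `|-1 *: x + y| => ge.
have /eqP : `|-1 *: x + y| ^+ 2 = 0.
  by apply/eqP; rewrite eq_le ge andbT -(ler_pM2l delta0) mulr0.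
by rewrite sqrf_eq0 normr_eq0 scaleN1r addrC subr_eq0 => /eqP.
Qed.

(** [Q = A^-1 / 2] maps [2 A l] to [l]. *)
Lemma cameron_martin_domain l : DA l -> cameron_martin dot mu l (2 *: A l).
Proof.
move=> Dl h; rewrite (Rintegral_dot_mul gauss).
have [D2 <-] := operatorZ 2 Dl.
by rewrite op_inverseK// scalerA mulVf ?scale1r.
Qed.

Lemma domain_dual_gt0 l : DA l -> l != 0 -> 0 < dot l (2 *: A l).
Proof.
move=> Dl l0; rewrite dotZr (dotC dot l) mulr_gt0//.
by apply: lt_le_trans (coercive Dl); rewrite mulr_gt0// exprn_gt0// normr_gt0.
Qed.

Lemma ibp_domain l (phi : H -> R) : DA l -> Cb1 dot phi ->
  \int[mu]_x dot (nabla dot phi x) l = \int[mu]_x (phi x * dot (2 *: A l) x).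
Proof.
move=> Dl Cphi; have [->|l0] := eqVneq l 0.
  have [_ ->] := operator0; rewrite scaler0; apply: eq_Rintegral => x _.
  by rewrite dot0r dot0l mulr0.
apply: (ibp hil sep gauss) => //; first exact: cameron_martin_domain.
exact: domain_dual_gt0.
Qed.

Lemma Lfun2_of_sqr (f : borel H -> R) : measurable_fun setT f ->
  mu.-integrable setT (EFin \o (fun x => f x ^+ 2)) -> f \in Lfun mu 2%:E.
Proof.
move=> mf /integrableP[_ fi]; apply/andP; split; apply/mem_set => //=.
rewrite /finite_norm Lnorm.unlock; apply: poweR_lty.
apply: le_lt_trans fi; rewrite le_eqVlt; apply/orP; left; apply/eqP.
apply: eq_integral => x _ /=.
by rewrite powR_mulrn// real_normK ?num_real// ger0_norm ?sqr_ge0.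
Qed.

Lemma Lfun2_integrable (f : borel H -> R) : f \in Lfun mu 2%:E ->
  mu.-integrable setT (EFin \o f).
Proof.
move=> f2; apply/Lfun1_integrable; apply: Lfun_subset12 => //.
exact: fin_num_measure.
Qed.

Lemma nabla_dot_bounded (phi : H -> R) l : Cb1 dot phi ->
  continuous (fun x => dot (nabla dot phi x) l) /\
  exists N : R, forall x, `|dot (nabla dot phi x) l| <= N.
Proof.
move=> /Cb1E[_ _ cD [N bN]]; split.
  by apply: continuous_dot => // x; exact: cvg_cst.
exists (N * `|l|) => x; apply: (le_trans (cauchy_schwarz hil _ _)).
exact: ler_wpM2r.
Qed.

(** The adjoint of [D] applied to the field [g l]. *)
Definition divergence_term (g : H -> R) (l x : H) : R :=
  g x * dot (2 *: A l) x - dot (nabla dot g x) l.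

Lemma divergence_term_Lfun (g : H -> R) l : Cb1 dot g ->
  divergence_term g l \in Lfun mu 2%:E.
Proof.
move=> Cg; have [cD [N bN]] := nabla_dot_bounded l Cg.
have cg := Cb1_continuous Cg; have /Cb1E[[M bM] _ _ _] := Cg.
have mdot := measurable_dot hil (2 *: A l).
have mt : measurable_fun [set: borel H] (divergence_term g l : borel H -> R).
  apply: measurable_funB; last exact: continuous_borel.
  by apply: measurable_funM => //; exact: continuous_borel.
apply: Lfun2_of_sqr => //.
apply: (@integrable_le _ (borel H) R mu _
  (fun x => 2 * M ^+ 2 * dot (2 *: A l) x ^+ 2 + 2 * N ^+ 2)).
- exact: measurable_funX.
- apply: integrable_lin; first exact: (integrable_dot2 hil gauss).
  exact: finite_measure_integrable_cst.
- move=> x; rewrite ger0_norm ?sqr_ge0// /divergence_term.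
  move: (bM x) (bN x); move: (g x) (dot _ _) (dot _ x) => a b c aM bN'.
  have h1 : (a * c) ^+ 2 <= M ^+ 2 * c ^+ 2.
    rewrite exprMn; apply: ler_wpM2r; first exact: sqr_ge0.
    rewrite -[leLHS]real_normK ?num_real//; apply: lerXn2r => //; rewrite nnegrE//.
    exact: le_trans aM.
  have h2 : b ^+ 2 <= N ^+ 2.
    rewrite -[leLHS]real_normK ?num_real//; apply: lerXn2r => //; rewrite nnegrE//.
    exact: le_trans bN'.
  have h3 : 0 <= (a * c + b) ^+ 2 by exact: sqr_ge0.
  by move: h1 h2 h3; rewrite !expr2; lra.
Qed.

(** Green's formula along a single direction: integrate the derivative of the
    product [phi g] by parts. *)
Lemma ibp_product l (phi g : H -> R) : DA l -> Cb1 dot phi -> Cb1 dot g ->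
  [/\ mu.-integrable [set: borel H]
        (EFin \o (fun x : borel H => g x * dot (nabla dot phi x) l)),
      mu.-integrable [set: borel H]
        (EFin \o (fun x : borel H => phi x * divergence_term g l x)) &
      \int[mu]_x (g x * dot (nabla dot phi x) l) =
      \int[mu]_x (phi x * divergence_term g l x)].
Proof.
move=> Dl Cphi Cg.
have [M bM] : exists M : R, forall x, `|phi x| <= M by case: Cphi.
have [M' bM'] : exists M : R, forall x, `|g x| <= M by case: Cg.
have cphi := Cb1_continuous Cphi; have cg := Cb1_continuous Cg.
have i1 : mu.-integrable [set: borel H]
    (EFin \o (fun x : borel H => g x * dot (nabla dot phi x) l)).
  have [cD [N bN]] := nabla_dot_bounded l Cphi.
  apply: (@integrable_bounded _ (borel H) R mu _ (M' * N)).
    by apply: measurable_funM; apply: continuous_borel.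
  by move=> x; rewrite normrM ler_pM.
have i2 : mu.-integrable [set: borel H]
    (EFin \o (fun x : borel H => phi x * divergence_term g l x)).
  rewrite (_ : (fun x => _) = fun x => divergence_term g l x * phi x); last first.
    by apply/funext => x; rewrite mulrC.
  apply: (integrable_mul_bounded (M := M)) => //; last exact: continuous_borel.
  exact: Lfun2_integrable (divergence_term_Lfun l Cg).
split=> //.
pose c (x : borel H) := phi x * dot (nabla dot g x) l.
have ic : mu.-integrable [set: borel H] (EFin \o c).
  have [cD [N bN]] := nabla_dot_bounded l Cg.
  apply: (@integrable_bounded _ (borel H) R mu _ (M * N)).
    by apply: measurable_funM; apply: continuous_borel.
  by move=> x; rewrite normrM ler_pM.
apply: (addIr (\int[mu]_x c x)); rewrite -!RintegralD//.
transitivity (\int[mu]_x dot (nabla dot (phi \* g) x) l).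
  apply: eq_Rintegral => x _; rewrite grad_mul//; last 2 first.
  - by have /Cb1E[] := Cphi.
  - by have /Cb1E[] := Cg.
  by rewrite dotDl !dotZl addrC.
rewrite (ibp_domain Dl (Cb1_mul hil Cphi Cg)).
by apply: eq_Rintegral => x _; rewrite /c /divergence_term/=; ring.
Qed.

Lemma Rintegral_sum (m : nat) (F : 'I_m -> borel H -> R) :
  (forall j, mu.-integrable setT (EFin \o F j)) ->
  mu.-integrable setT (EFin \o (fun x => \sum_(j < m) F j x)) /\
  \int[mu]_x (\sum_(j < m) F j x) = \sum_(j < m) \int[mu]_x F j x.
Proof.
move=> Fi; elim: m F Fi => [|m IH] F Fi.
  have -> : (fun x => \sum_(j < 0) F j x) = cst 0 by apply/funext => x; rewrite big_ord0.
  rewrite big_ord0; split; first exact: finite_measure_integrable_cst.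
  by rewrite Rintegral_cst// mul0r.
have [iS eS] := IH (fun j => F (lift ord0 j)) (fun j => Fi _).
have -> : (fun x => \sum_(j < m.+1) F j x) =
    fun x => 1 * F ord0 x + \sum_(j < m) F (lift ord0 j) x.
  by apply/funext => x; rewrite big_ord_recl mul1r.
split; first exact: integrable_lin.
by rewrite Rintegral_lin// eS big_ord_recl mul1r.
Qed.

(** The adjoint of [D] is defined at [G]: its value there is the sum of the terms
    [divergence_term (g j) (l j)], each square integrable. *)
Lemma div_adjoint_spec (G : H -> H) : Cb1_dom dot DA G ->
  div_adjoint dot mu G \in Lfun mu 2%:E /\
  forall phi, Cb1 dot phi ->
    \int[mu]_x dot (nabla dot phi x) (G x) =
    \int[mu]_x (phi x * div_adjoint dot mu G x).
Proof.
move=> [m [g [l [Cg Dl GE]]]].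
suff : exists w : H -> R, w \in Lfun mu 2%:E /\ forall phi, Cb1 dot phi ->
    \int[mu]_x dot (grad dot phi x) (G x) = \int[mu]_x (phi x * w x).
  move=> ex; rewrite nabla.unlock.
  exact: (@getPex _ [set w : H -> R | w \in Lfun mu 2%:E /\ forall phi, Cb1 dot phi ->
    \int[mu]_x dot (grad dot phi x) (G x) = \int[mu]_x (phi x * w x)] ex).
exists (fun x => \sum_(j < m) divergence_term (g j) (l j) x); split.
  have [L0 LD] := @Lfun_addr_closed _ (borel H) R mu 2%:E ltac:(by rewrite lee_fin ler1n).
  rewrite (_ : (fun x => _) = \sum_(j < m) divergence_term (g j) (l j)); last first.
    by apply/funext => x; rewrite fct_sumE.
  apply: (big_ind (fun f : borel H -> R => f \in Lfun mu 2%:E)) => // j _.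
  exact: divergence_term_Lfun.
move=> phi Cphi.
have -> : grad dot = nabla dot by rewrite nabla.unlock.
have green j := ibp_product (Dl j) Cphi (Cg j).
transitivity (\int[mu]_x (\sum_(j < m) g j x * dot (nabla dot phi x) (l j))).
  apply: eq_Rintegral => x _; rewrite GE dot_sumr.
  by apply: eq_bigr => j _; rewrite dotZr.
transitivity (\int[mu]_x (\sum_(j < m) phi x * divergence_term (g j) (l j) x)).
  rewrite (Rintegral_sum _).2; last by move=> j; case: (green j).
  rewrite (Rintegral_sum _).2; last by move=> j; case: (green j).
  by apply: eq_bigr => j _; case: (green j).
by apply: eq_Rintegral => x _; rewrite mulr_sumr.
Qed.

(** Replace the indicator by the cut-off functions: by duality the integral of
    [D^* G] is that of [<D (chi n), G>], which is at most the variation of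
    [chi n] since [|G| <= 1]. *)
Lemma BV_exhaustion (Gam : set H) (chi : nat -> H -> R) (V : R) :
  exhaustion dot mu Gam chi V -> BV dot mu DA \1_Gam.
Proof.
move=> [mG Cchi chi01 varV cvgG].
have [iG _] := Rintegral_indic mu mG.
split.
  split; first exact: (integrable_measurable iG).
  rewrite (_ : (fun x => _) = EFin \o (fun x : borel H =>
    (A_half 1 - A_half 0) * \1_Gam x + A_half 0)).
    by apply: integrable_lin => //; exact: finite_measure_integrable_cst.
  apply/funext => x /=; congr (_%:E); rewrite indicE.
  by case: (x \in Gam); rewrite /= ?normr1 ?normr0 ?mulr1 ?mulr0 ?subrK ?add0r.
apply: (@le_lt_trans _ _ V%:E); last exact: ltry.
apply: ub_ereal_sup => _ [G [domG G1] <-].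
have [wL ibpG] := div_adjoint_spec domG.
set w := div_adjoint dot mu G in wL ibpG *.
have wi := Lfun2_integrable wL.
have wGi : mu.-integrable [set: borel H] (EFin \o (fun x : borel H => w x * \1_Gam x)).
  have mi : measurable_fun [set: borel H] (\1_Gam : borel H -> R).
    exact: (integrable_measurable iG).
  apply: (@integrable_mul_bounded _ (borel H) R mu w \1_Gam 1 wi mi).
  by move=> x; rewrite indicE; case: (_ \in _); rewrite ?normr1 ?normr0.
rewrite -[leLHS]fineK; last exact: (integrable_fin_num measurableT wGi).
rewrite lee_fin; apply: (cvgr_to_le (cvgG w wi)); apply: nearW => n.
have -> : \int[mu]_x (w x * chi n x) = \int[mu]_x dot (nabla dot (chi n) x) (G x).
  by rewrite ibpG//; apply: eq_Rintegral => x _; rewrite mulrC.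
apply: (le_trans _ (varV n)).
have /Cb1E[_ _ cD [N bN]] := Cchi n.
have iD : mu.-integrable [set: borel H]
    (EFin \o (fun x : borel H => `|nabla dot (chi n) x|)).
  apply: (@integrable_bounded _ _ _ _ _ N); last by move=> x; rewrite normr_id.
  by apply: continuous_borel => x; apply: cvg_norm; exact: cD.
have cG : continuous G.
  have [m [g [l [Cg Dl GE]]]] := domG.
  have -> : G = fun z => \sum_(j < m) g j z *: l j by apply/funext.
  move=> x; apply: cvg_big => [|j _]; first exact: add_continuous.
  apply: cvgZr_tmp.
  exact: Cb1_continuous (Cg j) x.
apply: Rintegral_le => //.
  apply: (@integrable_le _ (borel H) R mu _ _ _ iD).
    by apply: continuous_borel; exact: continuous_dot.
  move=> x; apply: (le_trans (cauchy_schwarz hil _ _)).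
  by rewrite ler_piMr.
move=> x; apply: (le_trans (ler_norm _)).
apply: (le_trans (cauchy_schwarz hil _ _)).
by rewrite ler_piMr.
Qed.

End divergence.

(** * Support of a weighted measure *)

Section support.
Context {R : realType} {H : completeNormedModType R}.
Hypothesis sep : separable H.
Variable mu : probability (borel H) R.

(** The complement of the support is a countable union of null balls, [H] being
    separable; hence it carries no mass. *)
Lemma weighted_supp_full (Gam : set H) : @measurable _ (borel H) Gam ->
  @measurable _ (borel H) (weighted_supp mu \1_Gam) /\
  mu (Gam `\` weighted_supp mu \1_Gam) = 0%E.
Proof.
move=> mG; have [s sP] := separable_dense_seq sep.
have mopen (U : set H) : open U -> @measurable _ (borel H) U.
  by move=> oU; apply: sub_sigma_algebra.
have intE (U : set H) : open U -> (\int[mu]_(y in U) (\1_Gam y)%:E = mu (Gam `&` U))%E.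
  by move=> oU; rewrite integral_indic//; exact: mopen.
pose r m : R := m.+1%:R^-1.
have r0 m : 0 < r m by rewrite invr_gt0.
have bo n m : open (ball (s n) (r m)) by exact: ball_open.
pose B n m : set H := if `[< mu (Gam `&` ball (s n) (r m)) = 0%E >]
  then ball (s n) (r m) else set0.
have mB n m : @measurable _ (borel H) (B n m).
  by rewrite /B; case: ifP => // _; apply: mopen; exact: bo.
have nB n m : mu (Gam `&` B n m) = 0%E.
  by rewrite /B; case: ifPn => [/asboolP//|_]; rewrite setI0 measure0.
pose Z : set H := \bigcup_n \bigcup_m B n m.
have mZ : @measurable _ (borel H) Z.
  by apply: bigcupT_measurable => n; apply: bigcupT_measurable => m.
have FZ : weighted_supp mu \1_Gam = ~` Z.
  apply/seteqP; split => x /=.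
    move=> Fx [n _ [m _]]; rewrite /B; case: ifPn => // /asboolP nu xB.
    have := Fx _ (bo n m) xB.
    by rewrite intE ?nu ?ltxx//; exact: bo.
  move=> nZ U oU Ux; rewrite intE// lt0e measure_ge0 andbT; apply/eqP => U0.
  apply: nZ; have /nbhs_ballP[e /= e0 eU] := open_nbhs_nbhs (conj oU Ux).
  have e2 : 0 < e / 2 by exact: divr_gt0.
  have [m _ /(_ m (leqnn m)) rm] := near_infty_natSinv_lt (PosNum e2).
  have [n xn] := sP x (r m) (r0 m).
  exists n => //; exists m => //.
  have sub : ball (s n) (r m) `<=` U.
    move=> y; rewrite -ball_normE/= => yn; apply: eU; rewrite -ball_normE/=.
    rewrite -(subrKA (s n)); apply: (le_lt_trans (ler_normD _ _)).
    by rewrite (splitr e) ltrD// (lt_trans _ rm).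
  rewrite /B; case: ifPn => [_|/asboolPn]; first by rewrite -ball_normE/= distrC.
  case; apply/eqP; rewrite eq_le measure_ge0 andbT -U0.
  apply: le_measure; rewrite ?inE.
  - by apply: measurableI => //; apply: mopen; exact: bo.
  - by apply: measurableI => //; exact: mopen.
  - exact: setIS.
split; first by rewrite FZ; exact: measurableC.
rewrite FZ setDE setCK.
apply/negligibleP; first exact: measurableI.
rewrite /Z setI_bigcupr; apply: negligible_bigcup => n.
rewrite setI_bigcupr; apply: negligible_bigcup => m.
by apply/negligibleP; [exact: measurableI|exact: nB].
Qed.

End support.

(** * Closability *)

Section vanishing.
Context {R : realType}.

(** The next three lemmas turn quadratic bounds with a free parameter [e], as they
    are produced by [Rintegral_young], into limits. *)
Lemma cvg0_small (I : nat -> R) (b : R) :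
  (forall e, 0 < e -> \forall n \near \oo, `|I n| <= e * b) -> I n @[n --> \oo] --> 0.
Proof.
move=> sm; apply/cvgrPdist_le => e e0.
have b1 : 0 < `|b| + 1 by apply: ltr_wpDl.
have := sm (e / (`|b| + 1)) (divr_gt0 e0 b1); apply: filterS => n In.
rewrite sub0r normrN; apply: (le_trans In).
rewrite mulrAC ler_pdivrMr//; apply: ler_wpM2l; first exact: ltW.
by have := ler_norm b; lra.
Qed.

Lemma cvg0_young (I r : nat -> R) (b : R) :
  (forall e n, 0 < e -> `|I n| <= e * b + e^-1 * r n) ->
  r n @[n --> \oo] --> 0 -> I n @[n --> \oo] --> 0.
Proof.
move=> Ir r0; apply: (@cvg0_small _ (b + 1)) => e e0.
move/cvgrPdist_le : r0 => /(_ (e ^+ 2) (exprn_gt0 2 e0)); apply: filterS => n rn.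
apply: (le_trans (Ir e n e0)); rewrite mulrDr mulr1 lerD2l.
rewrite ler_pdivrMl// -expr2; apply: le_trans rn.
by rewrite sub0r normrN ler_norm.
Qed.

Lemma cvg0_approx (I r : nat -> R) (J : nat -> nat -> R) (b : R) (N : nat) :
  (forall k n e, 0 < e -> (N <= n)%N -> `|I n - J k n| <= e * b + e^-1 * r k) ->
  r k @[k --> \oo] --> 0 -> (forall k, J k n @[n --> \oo] --> 0) ->
  I n @[n --> \oo] --> 0.
Proof.
move=> IJ r0 J0; apply: (@cvg0_small _ (b + 2)) => e e0.
move/cvgrPdist_le : r0 => /(_ (e ^+ 2) (exprn_gt0 2 e0))[k _ /(_ k (leqnn k))] rk.
move/cvgrPdist_le : (J0 k) => /(_ e e0) Jk.
near=> n.
have h1 : `|I n - J k n| <= e * b + e^-1 * r k.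
  by apply: IJ => //; near: n; exact: nbhs_infty_ge.
have h2 : `|J k n| <= e by rewrite -normrN -sub0r; near: n.
have h3 : e^-1 * r k <= e.
  rewrite ler_pdivrMl// -expr2; apply: le_trans rk.
  by rewrite sub0r normrN ler_norm.
rewrite -(subrK (J k n) (I n)); apply: (le_trans (ler_normD _ _)).
by move: h1 h2 h3; lra.
Unshelve. all: by end_near. Qed.

End vanishing.

Section closability.
Context {R : realType} {H : completeNormedModType R}.
Variable dot : {dot H for idfun}.
Hypothesis hil : is_hilbert dot.
Hypothesis sep : separable H.
Variables (DA : set H) (A : H -> H) (delta : R).
Hypothesis selfA : self_adjoint dot DA A.
Hypothesis delta0 : 0 < delta.
Hypothesis coercive : forall x, DA x -> delta * `|x| ^+ 2 <= dot (A x) x.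
Variable mu : probability (borel H) R.
Hypothesis gauss : gaussian_measure dot mu 0 (fun x : H => 2^-1 *: op_inverse DA A x).
Variables (Gam : set H) (chi : nat -> H -> R) (V : R).
Hypothesis exh : exhaustion dot mu Gam chi V.

Let mG : @measurable _ (borel H) Gam. Proof. by case: exh. Qed.

Let mi : measurable_fun [set: borel H] (\1_Gam : borel H -> R).
Proof. exact: measurable_indic. Qed.

Let ind01 x : 0 <= (\1_Gam x : R) <= 1.
Proof. by rewrite indicE ler0n lern1; case: (_ \in _). Qed.

Let ind_sqr x : (\1_Gam x : R) * \1_Gam x = \1_Gam x.
Proof. by rewrite indicE; case: (_ \in _); rewrite /= ?mulr1 ?mulr0. Qed.

Lemma integrable_on (f : borel H -> R) (M : R) : measurable_fun setT f ->
  (forall x, `|f x| <= M) ->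
  mu.-integrable setT (EFin \o (fun x => f x * \1_Gam x)).
Proof.
move=> mf fM; apply: (@integrable_bounded _ (borel H) R mu _ M).
  exact: measurable_funM.
move=> x; rewrite normrM; apply: le_trans (fM x).
by have /andP[h0 h1] := ind01 x; rewrite ler_piMr// ger0_norm.
Qed.

Lemma integrable_gradients (v w : H -> R) : Cb1 dot v -> Cb1 dot w ->
  mu.-integrable [set: borel H] (EFin \o (fun x : borel H =>
    dot (nabla dot v x) (nabla dot w x) * \1_Gam x)).
Proof.
move=> /Cb1E[_ _ cv [M vM]] /Cb1E[_ _ cw [M' wM]].
apply: (@integrable_on _ (M * M')).
  by apply: continuous_borel; exact: continuous_dot.
by move=> x; apply: (le_trans (cauchy_schwarz hil _ _)); exact: ler_pM.
Qed.

Section weak_convergence.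
Variable u : nat -> H -> R.
Hypothesis Cu : forall n, Cb1 dot (u n).
Hypothesis u_cvg0 : \int[mu]_x (u n x ^+ 2 * \1_Gam x) @[n --> \oo] --> 0.
Variables (b : R) (N : nat).
Hypothesis bounded_energy : forall n, (N <= n)%N ->
  \int[mu]_x (dot (nabla dot (u n) x) (nabla dot (u n) x) * \1_Gam x) <= b.

Let slope l n (x : borel H) : R := dot (nabla dot (u n) x) l * \1_Gam x.

Let slope_bounded l n : measurable_fun [set: borel H] (slope l n) /\
  exists M : R, forall x, `|slope l n x| <= M.
Proof.
have [cD [M bM]] := nabla_dot_bounded hil l (Cu n).
split; first by apply: measurable_funM => //; exact: continuous_borel.
exists M => x; rewrite /slope normrM; apply: le_trans (bM x).
by have /andP[h0 h1] := ind01 x; rewrite ler_piMr// ger0_norm.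
Qed.

Let slope_mul_integrable l n (f : borel H -> R) (M : R) : measurable_fun setT f ->
  (forall x, `|f x| <= M) ->
  mu.-integrable setT (EFin \o (fun x => slope l n x * f x)).
Proof.
move=> mf fM; have [ms [S sS]] := slope_bounded l n.
by apply: (integrable_mul_bounded _ mf fM); exact: integrable_bounded sS.
Qed.

Let sqr_integrable (f : borel H -> R) (M : R) : measurable_fun setT f ->
  (forall x, `|f x| <= M) -> mu.-integrable setT (EFin \o (fun x => f x ^+ 2)).
Proof.
move=> mf fM; apply: (@integrable_bounded _ (borel H) R mu _ (M ^+ 2)).
  exact: measurable_funX.
move=> x; rewrite normrX; apply: lerXn2r => //; rewrite nnegrE//.
exact: le_trans (fM x).
Qed.

Let slope_energy l n : (N <= n)%N ->
  \int[mu]_x (slope l n x ^+ 2) <= b * `|l| ^+ 2.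
Proof.
move=> Nn; have [ms [M sM]] := slope_bounded l n.
apply: (@le_trans _ _ (\int[mu]_x (`|l| ^+ 2 *
  (dot (nabla dot (u n) x) (nabla dot (u n) x) * \1_Gam x)))).
  apply: Rintegral_le => [||x].
  - exact: sqr_integrable sM.
  - exact: integrable_scale (integrable_gradients (Cu n) (Cu n)).
  - rewrite /slope exprMn [X in _ * X]expr2 ind_sqr mulrA.
    apply: ler_wpM2r; first by case/andP: (ind01 x).
    rewrite hil -[leLHS]real_normK ?num_real// mulrC -exprMn.
    apply: lerXn2r; rewrite ?nnegrE ?mulr_ge0//; exact: cauchy_schwarz.
rewrite (@RintegralZl _ (borel H) R mu setT _ _ measurableT (integrable_gradients (Cu n) (Cu n))).
by rewrite mulrC; apply: ler_wpM2r; [exact: sqr_ge0|exact: bounded_energy].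
Qed.

(** The slopes are bounded in [L^2], so that test functions may be replaced by
    [L^2] approximations. *)
Let slope_approx l (f : borel H -> R) (fk : nat -> borel H -> R) (M : R) :
  measurable_fun setT f -> (forall k, measurable_fun setT (fk k)) ->
  (forall x, `|f x| <= M) -> (forall k x, `|fk k x| <= M) ->
  \int[mu]_x ((f x - fk k x) ^+ 2) @[k --> \oo] --> 0 ->
  (forall k, \int[mu]_x (slope l n x * fk k x) @[n --> \oo] --> 0) ->
  \int[mu]_x (slope l n x * f x) @[n --> \oo] --> 0.
Proof.
move=> mf mfk fM fkM; apply: (@cvg0_approx _ _ _ _ (b * `|l| ^+ 2) N) => k n e e0 Nn.
have [ms [S sS]] := slope_bounded l n.
have i1 := slope_mul_integrable l n mf fM.
have i2 := slope_mul_integrable l n (mfk k) (fkM k).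
rewrite -RintegralB//.
have mB : measurable_fun setT (fun x => f x - fk k x) by exact: measurable_funB.
have bB x : `|f x - fk k x| <= M + M.
  by apply: (le_trans (ler_normB _ _)); apply: lerD.
have [_] := Rintegral_young e0 ms mB (sqr_integrable ms sS) (sqr_integrable mB bB).
under eq_Rintegral do rewrite mulrBr.
move=> /le_trans; apply; rewrite lerD2r; apply: ler_wpM2l; first exact: ltW.
exact: slope_energy.
Qed.

(** The key step.  After replacement of [psi] by [psi * chi k], whose product with
    [u n] can be integrated by parts on the whole space, the derivative is moved
    away from [u n]; what remains lives in [Gam], where [u n] tends to 0. *)
Let slope_test l (psi : H -> R) : DA l -> Cb1 dot psi -> (forall x, `|psi x| <= 1) ->
  \int[mu]_x (slope l n x * psi x) @[n --> \oo] --> 0.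
Proof.
move=> Dl Cpsi psi1; have [_ Cchi chi01 _ cvgG] := exh.
have cpsi := Cb1_continuous Cpsi.
have mpsi : measurable_fun [set: borel H] (psi : borel H -> R) by exact: continuous_borel.
have mchi k : measurable_fun [set: borel H] (chi k : borel H -> R).
  exact: continuous_borel (Cb1_continuous (Cchi k)).
rewrite (_ : (fun n => _) =
    fun n => \int[mu]_x (slope l n x * (psi x * \1_Gam x))); last first.
  apply/funext => n; apply: eq_Rintegral => x _.
  by rewrite /slope -{1}(ind_sqr x); ring.
have le_chi k x : 0 <= chi k x <= 1.
  have [/andP[c0 c1] _] := chi01 k x.
  by rewrite c0/= (le_trans c1)//; case/andP: (ind01 x).
have chiE k x : chi k x * \1_Gam x = chi k x.
  have [/andP[c0 c1] _] := chi01 k x.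
  move: c0 c1; rewrite indicE; case: (_ \in _) => /= c0 c1; first by rewrite mulr1.
  by rewrite mulr0; apply/eqP; rewrite eq_le c0 c1.
apply: (@slope_approx l _ (fun k x => psi x * chi k x) 1).
- exact: measurable_funM.
- by move=> k; exact: measurable_funM.
- move=> x; have /andP[i0 i1] := ind01 x.
  by rewrite normrM -[1]mulr1 ler_pM// ger0_norm.
- move=> k x; have /andP[i0 i1] := le_chi k x.
  by rewrite normrM -[1]mulr1 ler_pM// ger0_norm.
- have i1 : mu.-integrable [set: borel H] (EFin \o (fun=> 1 : R)).
    exact: finite_measure_integrable_cst.
  have c1 : \int[mu]_x chi k x @[k --> \oo] --> \int[mu]_x (\1_Gam x : R).
    have := cvgG _ i1; under eq_Rintegral do rewrite mul1r.
    by under eq_cvg do [under eq_Rintegral do rewrite mul1r].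
  have [iG _] := Rintegral_indic mu mG.
  have ichi k : mu.-integrable [set: borel H] (EFin \o (chi k : borel H -> R)).
    apply: (@integrable_bounded _ (borel H) R mu _ 1 (mchi k)) => x.
    by have /andP[? ?] := le_chi k x; rewrite ger0_norm.
  apply: (@squeeze_cvgr _ _ _ _ (cst 0)
    (fun k => \int[mu]_x (\1_Gam x : R) - \int[mu]_x chi k x)).
  + apply: nearW => k; apply/andP; split.
      by apply: Rintegral_ge0 => x _; exact: sqr_ge0.
    have d01 x : 0 <= \1_Gam x - chi k x <= 1.
      have [/andP[d0 d1] _] := chi01 k x; have /andP[_ i1'] := ind01 x.
      by rewrite subr_ge0 d1/= lerBlDr (le_trans i1')// lerDl.
    have md : measurable_fun [set: borel H] (fun x : borel H => \1_Gam x - chi k x).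
      exact: measurable_funB.
    have bd x : `|psi x * (\1_Gam x - chi k x)| <= 1.
      by have /andP[? ?] := d01 x; rewrite normrM -[1]mulr1 ler_pM// ger0_norm.
    rewrite -RintegralB//; apply: Rintegral_le => [||x].
    * under eq_fun do rewrite -mulrBr.
      by apply: (@sqr_integrable _ 1) => //; exact: measurable_funM.
    * apply: (@integrable_bounded _ (borel H) R mu _ 1 md) => x.
      by have /andP[? ?] := d01 x; rewrite ger0_norm.
    * have /andP[d0 d1] := d01 x; rewrite -mulrBr exprMn.
      apply: (@le_trans _ _ (1 * (\1_Gam x - chi k x) ^+ 2)).
        apply: ler_wpM2r; first exact: sqr_ge0.
        by rewrite -[leLHS]real_normK ?num_real// exprn_ile1.
      by rewrite mul1r expr2 ler_piMl.
  + exact: cvg_cst.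
  + move: (\int[mu]_x (\1_Gam x : R)) c1 => I0 c1.
    have h : I0 - \int[mu]_x chi k x @[k --> \oo] --> I0 - I0.
      by apply: cvgB => //; exact: cvg_cst.
    by move: h; rewrite subrr.
- move=> k; pose theta := psi \* chi k.
  have Ctheta : Cb1 dot theta := Cb1_mul hil Cpsi (Cchi k).
  have thetaE x : ~ Gam x -> theta x = 0 /\ nabla dot theta x = 0.
    move=> nG; have [_ /(_ nG) n0] := chi01 k x.
    have t0 : chi k x = 0 by rewrite -chiE indicE memNset ?mulr0.
    rewrite /theta/= t0 mulr0; split=> //.
    have /Cb1E[_ dpsi _ _] := Cpsi; have /Cb1E[_ dchi _ _] := Cchi k.
    by rewrite grad_mul// n0 t0 scaler0 scale0r addr0.
  pose c : borel H -> R := divergence_term dot A theta l.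
  have cE x : c x * \1_Gam x = c x.
    have [Gx|nG] := pselect (Gam x); first by rewrite indicE mem_set// mulr1.
    rewrite indicE memNset// mulr0 /c /divergence_term.
    by have [-> ->] := thetaE x nG; rewrite mul0r dot0l subr0.
  have cL := divergence_term_Lfun hil gauss l Ctheta.
  have mc : measurable_fun setT c := integrable_measurable (Lfun2_integrable cL).
  have ci := Lfun2_integrable_sqr cL.
  apply: (@cvg0_young _ _ _ (\int[mu]_x (c x ^+ 2)) _ u_cvg0) => e n e0.
  have mu1 : measurable_fun [set: borel H] (fun x : borel H => u n x * \1_Gam x).
    apply: measurable_funM => //; exact: continuous_borel (Cb1_continuous (Cu n)).
  have [M uM] : exists M : R, forall x, `|u n x| <= M by case: (Cu n).
  have u1M x : `|u n x * \1_Gam x| <= M.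
    rewrite normrM; apply: le_trans (uM x).
    by have /andP[h0 h1] := ind01 x; rewrite ler_piMr// ger0_norm.
  have [_] := Rintegral_young e0 mc mu1 ci (sqr_integrable mu1 u1M).
  have -> : \int[mu]_x ((u n x * \1_Gam x) ^+ 2) = \int[mu]_x (u n x ^+ 2 * \1_Gam x).
    by apply: eq_Rintegral => x _; rewrite exprMn [X in _ * X]expr2 ind_sqr.
  have -> // : \int[mu]_x (c x * (u n x * \1_Gam x)) =
    \int[mu]_x (slope l n x * (psi x * chi k x)).
  have [_ _ green] := ibp_product hil sep selfA delta0 coercive gauss Dl (Cu n) Ctheta.
  transitivity (\int[mu]_x (u n x * divergence_term dot A theta l x)).
    by apply: eq_Rintegral => x _; rewrite mulrCA cE.
  rewrite -green; apply: eq_Rintegral => x _.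
  by rewrite /slope /theta/= -{1}(chiE k x); ring.
Qed.

(** From trigonometric functions to indicators, by [trig_monotone_class]. *)
Let slope_weak l (B : set H) : DA l -> @measurable _ (borel H) B ->
  \int[mu]_x (slope l n x * \1_B x) @[n --> \oo] --> 0.
Proof.
move=> Dl; pose C (f : H -> R) := [/\ measurable_fun [set: borel H] (f : borel H -> R),
  exists M : R, forall x, `|f x| <= M &
  \int[mu]_x (slope l n x * f x) @[n --> \oo] --> 0].
suff CB : forall B, @measurable _ (borel H) B -> C \1_B.
  by move=> mB; have [] := CB B mB.
apply: (trig_monotone_class hil sep).
- move=> h; have Cc := Cb1_cos hil h; have c1 x : `|cos (dot h x)| <= 1.
    by rewrite ler_norml cos_geN1 cos_le1.
  split; [exact: continuous_borel (Cb1_continuous Cc)|by exists 1|exact: slope_test].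
- move=> h; have Cc := Cb1_sin hil h; have c1 x : `|sin (dot h x)| <= 1.
    by rewrite ler_norml sin_geN1 sin_le1.
  split; [exact: continuous_borel (Cb1_continuous Cc)|by exists 1|exact: slope_test].
- move=> a f g [mf [M fM] f0] [mg [M' gM'] g0]; split.
  + by apply: measurable_funD => //; exact: measurable_funM.
  + exists (`|a| * M + M') => x; apply: (le_trans (ler_normD _ _)).
    by rewrite normrM lerD// ler_wpM2l.
  + have fi n := slope_mul_integrable l n mf fM.
    have gi n := slope_mul_integrable l n mg gM'.
    rewrite (_ : (fun n => _) = fun n => a * \int[mu]_x (slope l n x * f x) +
        \int[mu]_x (slope l n x * g x)); last first.
      apply/funext => n; rewrite -Rintegral_lin//.
      by apply: eq_Rintegral => x _; ring.
    rewrite (_ : 0 = a * 0 + 0 :> R); last by rewrite mulr0 addr0.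
    by apply: cvgD => //; exact: cvgMl_tmp.
- move=> f g M Cf fM fg.
  have mf n : measurable_fun [set: borel H] (f n : borel H -> R) by case: (Cf n).
  have mg : measurable_fun [set: borel H] (g : borel H -> R).
    exact: (@measurable_fun_cvg _ (borel H) R setT f g mf (fun x _ => fg x)).
  have bg x : `|g x| <= M.
    apply: (cvgr_to_le (cvg_norm (fg x))); exact: nearW.
  split=> //; first by exists M.
  apply: (slope_approx mg mf bg fM); last by move=> k; case: (Cf k).
  have mgf k : measurable_fun [set: borel H] (fun x : borel H => (g x - f k x) ^+ 2).
    by apply: measurable_funX; exact: measurable_funB.
  have bgf k x : `|(g x - f k x) ^+ 2| <= (M + M) ^+ 2.
    have h : `|g x - f k x| <= M + M by apply: (le_trans (ler_normB _ _)); exact: lerD.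
    rewrite normrX; apply: lerXn2r => //; rewrite nnegrE//; exact: le_trans h.
  have := @Rintegral_bounded_cvg _ (borel H) R mu _ (fun=> 0) _ mgf bgf.
  rewrite Rintegral_cst// mul0r; apply => x.
  have h : g x - f k x @[k --> \oo] --> g x - g x.
    by apply: cvgB; [exact: cvg_cst|exact: fg].
  rewrite (_ : 0 = (g x - g x) * (g x - g x)); last by rewrite subrr mulr0.
  by under eq_cvg do rewrite expr2; exact: cvgM.
Qed.

(** Comparing with one term at a time makes a Borel field approximated in this way
    a finite combination of constant vectors of the sequence, with indicators of
    Borel sets as coefficients: this is what the induction of [field_weak] uses. *)
Fixpoint greedy (dir : nat -> H) (m : nat) (v : H) : H :=
  if m is k.+1 then
    if `|v - dir k| < `|v - greedy dir k v| then dir k else greedy dir k v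
  else 0.

Section weak_gradient.
Variables (dir : nat -> H) (v : H -> R).
Hypothesis Ddir : forall j, DA (dir j).
Hypothesis dense_dir : forall (x : H) (e : R), 0 < e -> exists j, `|x - dir j| < e.
Hypothesis Cv : Cb1 dot v.

Let gap m (x : borel H) : R := `|nabla dot v x - greedy dir m (nabla dot v x)|.

Let gapS m x : gap m.+1 x = Num.min `|nabla dot v x - dir m| (gap m x).
Proof. by rewrite /gap /= /Num.min; case: ifP. Qed.

Let measurable_gap m : measurable_fun setT (gap m).
Proof.
have /Cb1E[_ _ cD _] := Cv; elim: m => [|m IH].
  rewrite (_ : gap 0%N = fun x => `|nabla dot v x|).
    by apply: continuous_borel => x; apply: cvg_norm; exact: cD.
  by apply/funext => x; rewrite /gap/= subr0.
rewrite (_ : gap m.+1 = fun x => Num.min `|nabla dot v x - dir m| (gap m x)).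
  apply: measurable_minr => //; apply: continuous_borel => x.
  by apply: cvg_norm; apply: cvgB; [exact: cD|exact: cvg_cst].
by apply/funext => x; rewrite gapS.
Qed.

Let gap_le m x : 0 <= gap m x <= `|nabla dot v x|.
Proof.
rewrite normr_ge0/=; elim: m => [|m IH]; first by rewrite /gap/= subr0.
by rewrite gapS ge_min IH orbT.
Qed.

Let gap_cvg x : gap m x @[m --> \oo] --> 0.
Proof.
apply/cvgrPdist_le => e e0; have [j je] := dense_dir (nabla dot v x) e0.
exists j.+1 => // m /= jm; rewrite sub0r normrN ger0_norm; last by case/andP: (gap_le m x).
elim: m jm => // m IH; rewrite ltnS leq_eqVlt => /predU1P[<-|/IH h].
  by rewrite gapS ge_min (ltW je).
by rewrite gapS ge_min h orbT.
Qed.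

Let field m n (x : borel H) : R :=
  dot (nabla dot (u n) x) (greedy dir m (nabla dot v x)) * \1_Gam x.

Let field_weak m :
  (forall n, measurable_fun setT (field m n) /\ exists M : R, forall x, `|field m n x| <= M) /\
  forall B : set H, @measurable _ (borel H) B ->
    \int[mu]_x (field m n x * \1_B x) @[n --> \oo] --> 0.
Proof.
elim: m => [|m [IH1 IH2]].
  have f0 n : field 0 n = cst 0 by apply/funext => x; rewrite /field/= dot0r mul0r.
  split=> [n|B mB]; first by rewrite f0; split=> //; exists 0 => x /=; rewrite normr0.
  rewrite (_ : (fun n => _) = cst 0); first exact: cvg_cst.
  apply/funext => n; rewrite f0; under eq_Rintegral do rewrite mul0r.
  by rewrite Rintegral_cst// mul0r.
pose S : set H := [set x | `|nabla dot v x - dir m| < gap m x].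
have mS : @measurable _ (borel H) S.
  have /Cb1E[_ _ cD _] := Cv.
  have mg : measurable_fun [set: borel H]
      (fun x : borel H => gap m x - `|nabla dot v x - dir m|).
    apply: measurable_funB => //; apply: continuous_borel => x.
    by apply: cvg_norm; apply: cvgB; [exact: cD|exact: cvg_cst].
  rewrite (_ : S = (fun x : borel H => gap m x - `|nabla dot v x - dir m|) @^-1` `]0, +oo[).
    by rewrite -[_ @^-1` _]setTI; exact: mg.
  by apply/seteqP; split => x /=; rewrite in_itv/= andbT subr_gt0.
have fE n x : field m.+1 n x = slope (dir m) n x * \1_S x + field m n x * \1_(~` S) x.
  rewrite /field /= -/(gap m x) /slope.
  have [Sx|nSx] := pselect (S x).
    rewrite [LHS](_ : _ = dot (nabla dot (u n) x) (dir m) * \1_Gam x); last by rewrite ifT.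
    by rewrite !indicE (mem_set Sx) (@memNset _ (~` S))//= ?mulr1 ?mulr0 ?addr0//; exact.
  rewrite !indicE (memNset nSx) (@mem_set _ (~` S))//= mulr1 mulr0 add0r.
  by rewrite ifF//; apply/negP.
have mI (B : set H) : @measurable _ (borel H) B ->
    measurable_fun [set: borel H] (\1_B : borel H -> R) by exact: measurable_indic.
have bI (B : set H) x : `|\1_B x : R| <= 1.
  by rewrite indicE; case: (_ \in _); rewrite ?normr1 ?normr0.
have mS' : @measurable _ (borel H) (~` S) by exact: measurableC.
split=> [n|B mB].
  have [[ms [M sM]] [mf [M' fM']]] := (slope_bounded (dir m) n, IH1 n).
  rewrite (_ : field m.+1 n = fun x => slope (dir m) n x * \1_S x + field m n x * \1_(~` S) x).
    split.
      by apply: measurable_funD; apply: measurable_funM => //; exact: mI.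
    exists (M * 1 + M' * 1) => x; apply: (le_trans (ler_normD _ _)).
    by apply: lerD; rewrite normrM; apply: ler_pM.
  by apply/funext => x; exact: fE.
have w1 := slope_weak (Ddir m) (measurableI _ _ mS mB).
have w2 := IH2 _ (measurableI _ _ mS' mB).
rewrite (_ : (fun n => _) = fun n => \int[mu]_x (slope (dir m) n x * \1_(S `&` B) x) +
    \int[mu]_x (field m n x * \1_(~` S `&` B) x)); last first.
  apply/funext => n; have [[ms [M sM]] [mf [M' fM']]] := (slope_bounded (dir m) n, IH1 n).
  rewrite -RintegralD//.
  - by apply: eq_Rintegral => x _; rewrite fE !indicI/=; ring.
  - apply: (integrable_mul_bounded (integrable_bounded mu ms sM) (mI _ _) (bI _)).
    exact: measurableI.
  - apply: (integrable_mul_bounded (integrable_bounded mu mf fM') (mI _ _) (bI _)).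
    exact: measurableI.
by rewrite -[0]addr0; exact: cvgD.
Qed.

(** Approximate [D v] by a simple field with values in the domain of [A]. *)
Lemma gradient_weak_cvg0 :
  \int[mu]_x (dot (nabla dot (u n) x) (nabla dot v x) * \1_Gam x) @[n --> \oo] --> 0.
Proof.
have /Cb1E[_ _ cD [M vM]] := Cv.
have gapM m x : `|gap m x ^+ 2| <= M ^+ 2.
  have /andP[g0 g1] := gap_le m x.
  rewrite ger0_norm ?sqr_ge0//; apply: lerXn2r; rewrite ?nnegrE//.
    exact: le_trans (vM x).
  exact: le_trans (vM x).
have mgap2 m : measurable_fun [set: borel H] (fun x : borel H => gap m x ^+ 2).
  exact: measurable_funX.
apply: (@cvg0_approx _ _ (fun m => \int[mu]_x (gap m x ^+ 2))
  (fun m n => \int[mu]_x (field m n x * \1_[set: H] x)) b N).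
- move=> m n e e0 Nn.
  have /Cb1E[_ _ cDu [M' uM]] := Cu n.
  have i1 := integrable_gradients (Cu n) Cv.
  have [mf [M2 fM2]] := (field_weak m).1 n.
  have i2 : mu.-integrable [set: borel H] (EFin \o field m n).
    exact: integrable_bounded fM2.
  under [X in _ - X]eq_Rintegral do rewrite indicT mulr1.
  rewrite -RintegralB//.
  pose f (x : borel H) : R := `|nabla dot (u n) x| * \1_Gam x.
  have mf' : measurable_fun setT f.
    apply: measurable_funM => //; apply: continuous_borel => x.
    by apply: cvg_norm; exact: cDu.
  have fM' x : `|f x| <= M'.
    have /andP[h0 h1] := ind01 x.
    by rewrite /f normrM normr_id (ger0_norm h0) (le_trans _ (uM x))// ler_piMr.
  have gM x : `|gap m x| <= M.
    have /andP[g0 g1] := gap_le m x.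
    by rewrite ger0_norm// (le_trans g1).
  have [fgi] := Rintegral_young e0 mf' (measurable_gap m)
    (sqr_integrable mf' fM') (sqr_integrable (measurable_gap m) gM).
  have -> : \int[mu]_x (f x ^+ 2) = \int[mu]_x
      (dot (nabla dot (u n) x) (nabla dot (u n) x) * \1_Gam x).
    by apply: eq_Rintegral => x _; rewrite /f exprMn [X in _ * X]expr2 ind_sqr hil.
  move=> young.
  have dE x : dot (nabla dot (u n) x) (nabla dot v x) * \1_Gam x - field m n x =
      dot (nabla dot (u n) x) (nabla dot v x - greedy dir m (nabla dot v x)) * \1_Gam x.
    by rewrite /field dotBr; ring.
  have i3 : mu.-integrable [set: borel H] (EFin \o (fun x : borel H =>
      dot (nabla dot (u n) x) (nabla dot v x) * \1_Gam x - field m n x)).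
    rewrite (_ : (fun x => _) = fun x : borel H => (-1) * field m n x +
      dot (nabla dot (u n) x) (nabla dot v x) * \1_Gam x); first exact: integrable_lin.
    by apply/funext => x; rewrite mulN1r addrC.
  apply: (le_trans (le_normr_Rintegral measurableT i3)).
  apply: (@le_trans _ _ (\int[mu]_x (f x * gap m x))).
    apply: Rintegral_le => // [|x].
      exact: integrable_norm.
    rewrite dE normrM (ger0_norm (x := \1_Gam x)); last by case/andP: (ind01 x).
    rewrite /f mulrAC; apply: ler_wpM2r; first by case/andP: (ind01 x).
    exact: cauchy_schwarz.
  apply: (le_trans (ler_norm _)); apply: (le_trans young).
  rewrite lerD2r; apply: ler_wpM2l; first exact: ltW.
  exact: bounded_energy.
- have := @Rintegral_bounded_cvg _ (borel H) R mu _ (fun=> 0) _ mgap2 gapM.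
  rewrite Rintegral_cst// mul0r; apply => x.
  rewrite (_ : 0 = 0 * 0); last by rewrite mulr0.
  by under eq_cvg do rewrite expr2; apply: cvgM; exact: gap_cvg.
- by move=> m; apply: (field_weak m).2.
Qed.

End weak_gradient.

End weak_convergence.

Lemma dense_domain_seq : exists dir : nat -> H, (forall j, DA (dir j)) /\
  forall (x : H) (e : R), 0 < e -> exists j, `|x - dir j| < e.
Proof.
have [_ dD _] := selfA; have [DA0 _] := operator0 selfA.
have [s sP] := separable_dense_seq sep.
pose r m : R := m.+1%:R^-1.
have r0 m : 0 < r m by rewrite invr_gt0.
have near n m : exists l, DA l /\ `|s n - l| < r m.
  have bo : open (ball (s n) (r m)) by exact: ball_open.
  have [|l [bl Dl]] := dD _ _ bo; first by exists (s n); exact: ballxx.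
  by exists l; split=> //; move: bl; rewrite -ball_normE.
exists (fun j => if unpickle j is Some p then sval (cid (near p.1 p.2)) else 0); split.
  by move=> j; case: unpickle => // p; case: cid => l [].
move=> x e e0; have e2 : 0 < e / 2 by exact: divr_gt0.
have [n xn] := sP x (e / 2) e2.
have [m _ /(_ m (leqnn m)) rm] := near_infty_natSinv_lt (PosNum e2).
exists (pickle (n, m)); rewrite pickleK; case: cid => l [_ /= ln].
rewrite -(subrKA (s n)); apply: (le_lt_trans (ler_normD _ _)).
by rewrite (splitr e) ltrD// (lt_trans ln).
Qed.

Let energyE (v w : H -> R) : energy dot mu \1_Gam v w =
  2^-1 * \int[mu]_x (dot (nabla dot v x) (nabla dot w x) * \1_Gam x).
Proof. by rewrite nabla.unlock. Qed.

Let energy_sub (v w : H -> R) : Cb1 dot v -> Cb1 dot w ->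
  \int[mu]_x (dot (nabla dot (v \- w) x) (nabla dot (v \- w) x) * \1_Gam x) =
  \int[mu]_x (dot (nabla dot v x - nabla dot w x) (nabla dot v x - nabla dot w x)
    * \1_Gam x).
Proof.
move=> /Cb1E[_ dv _ _] /Cb1E[_ dw _ _].
by apply: eq_Rintegral => x _; rewrite grad_sub.
Qed.

(** From [|a|^2 <= 2 <a, b> + |a - b|^2], the energy of [u n] is controlled by its
    scalar product with a fixed [u N], which tends to 0 by weak convergence, and
    by the energy of [u n - u N], which is small. *)
Lemma closable_exhaustion : energy_closable dot mu \1_Gam.
Proof.
move=> u Cu u0 cauchy; pose F := weighted_supp mu \1_Gam; rewrite -/F in u0.
have [mF nF] := weighted_supp_full sep mu mG; rewrite -/F in mF nF.
have u_cvg0 : \int[mu]_x (u n x ^+ 2 * \1_Gam x) @[n --> \oo] --> 0.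
  move: u0; rewrite [X in X @ _](_ : _ = fun n => \int[mu]_x (u n x ^+ 2 * \1_Gam x))//.
  apply/funext => n; rewrite Rintegral_mkcond /Rintegral; congr fine.
  have mu2 : measurable_fun [set: borel H] (fun x : borel H => u n x ^+ 2 * \1_Gam x).
    apply: measurable_funM => //; apply: measurable_funX.
    exact: continuous_borel (Cb1_continuous (Cu n)).
  apply: ae_eq_integral => //.
  - apply/measurable_EFinP; rewrite patch_indic; exact: measurable_funM.
  - exact/measurable_EFinP.
  - exists (Gam `\` F); split; [exact: measurableD|exact: nF|].
    move=> x /= nE; apply: contrapT => nGF; apply: nE => _; congr (_%:E).
    rewrite patchE; case: ifPn => // /negP xF.
    rewrite indicE memNset ?mulr0// => Gx; apply: nGF; split=> // Fx.
    by apply: xF; rewrite inE.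
have diff_int n m : mu.-integrable [set: borel H] (EFin \o (fun x : borel H =>
    dot (nabla dot (u n) x - nabla dot (u m) x)
      (nabla dot (u n) x - nabla dot (u m) x) * \1_Gam x)).
  have := integrable_gradients (Cb1_sub hil (Cu n) (Cu m)) (Cb1_sub hil (Cu n) (Cu m)).
  rewrite [X in _.-integrable _ (EFin \o X)](_ : _ = fun x : borel H =>
    dot (nabla dot (u n) x - nabla dot (u m) x)
      (nabla dot (u n) x - nabla dot (u m) x) * \1_Gam x)//.
  have /Cb1E[_ dn _ _] := Cu n; have /Cb1E[_ dm _ _] := Cu m.
  by apply/funext => x; rewrite grad_sub.
have grad_int n m := integrable_gradients (Cu n) (Cu m).
have [N HN] := cauchy 1 ltr01.
pose b : R := 2 * (2 + \int[mu]_x (dot (nabla dot (u N) x) (nabla dot (u N) x) * \1_Gam x)).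
have bounded n : (N <= n)%N ->
    \int[mu]_x (dot (nabla dot (u n) x) (nabla dot (u n) x) * \1_Gam x) <= b.
  move=> Nn; have := HN n N Nn (leqnn N).
  rewrite energyE energy_sub// => lt1.
  have d1 := integrable_lin 1 (diff_int n N) (grad_int N N).
  apply: (@le_trans _ _ (\int[mu]_x (2 * (1 *
    (dot (nabla dot (u n) x - nabla dot (u N) x)
      (nabla dot (u n) x - nabla dot (u N) x) * \1_Gam x) +
    dot (nabla dot (u N) x) (nabla dot (u N) x) * \1_Gam x)))).
    apply: Rintegral_le => // [|x]; first exact: integrable_scale d1.
    rewrite mul1r -mulrDl mulrA; apply: ler_wpM2r; first by case/andP: (ind01 x).
    rewrite -[X in dot X X](subrK (nabla dot (u N) x)); exact: dot_sqrD_le.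
  rewrite RintegralZl// Rintegral_lin// /b mul1r.
  have arith (p q : R) : 2^-1 * p < 1 -> p + q <= 2 + q by lra.
  by rewrite ler_pM2l//; exact: arith lt1.
have [dir [Ddir dense_dir]] := dense_domain_seq.
apply/cvgrPdist_le => e e0; have e2 : 0 < e / 2 by exact: divr_gt0.
have [N' HN'] := cauchy (e / 2) e2.
have := gradient_weak_cvg0 Cu u_cvg0 bounded Ddir dense_dir (Cu N').
move/cvgrPdist_le => /(_ (e / 2) e2) weak.
near=> n.
have Nn : (N' <= n)%N by near: n; exact: nbhs_infty_ge.
have wn : `|0 - \int[mu]_x (dot (nabla dot (u n) x) (nabla dot (u N') x) * \1_Gam x)| <= e / 2.
  by near: n.
have := HN' n N' Nn (leqnn _); rewrite energyE energy_sub// => lte.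
have En0 : 0 <= energy dot mu \1_Gam (u n) (u n).
  rewrite energyE; apply: mulr_ge0 => //; apply: Rintegral_ge0 => x _.
  by apply: mulr_ge0; [exact: (dot_sqr_ge0 hil)|case/andP: (ind01 x)].
rewrite sub0r normrN ger0_norm// energyE.
have le : \int[mu]_x (dot (nabla dot (u n) x) (nabla dot (u n) x) * \1_Gam x) <=
    \int[mu]_x (2 * (dot (nabla dot (u n) x) (nabla dot (u N') x) * \1_Gam x) +
     dot (nabla dot (u n) x - nabla dot (u N') x)
      (nabla dot (u n) x - nabla dot (u N') x) * \1_Gam x).
  apply: Rintegral_le => // [|x]; first exact: integrable_lin.
  rewrite mulrA -mulrDl; apply: ler_wpM2r; first by case/andP: (ind01 x).
  rewrite dot_sqrB; have := dot_sqr_ge0 hil (nabla dot (u N') x); lra.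
move: wn lte le; rewrite Rintegral_lin// sub0r normrN ler_norml.
set I1 := \int[mu]_x (dot _ (nabla dot (u N') x) * _).
set I2 := Rintegral _ _ _; set I3 := Rintegral _ _ _.
by move=> /andP[h1 h2] h3 h4; lra.
Unshelve. all: by end_near. Qed.

Lemma QR_exhaustion : QR dot mu \1_Gam.
Proof.
split; last exact: closable_exhaustion.
  by move=> x; case/andP: (ind01 x).
exact: (Rintegral_indic mu mG).1.
Qed.

End closability.

(** * Regular convex sets *)

Theorem theorem5p3 (R : realType) (H : completeNormedModType R)
    (dot : {dot H for idfun}) (DA : set H) (A : H -> H) (delta : R)
    (mu : probability (borel H) R) (Gam : set H) :
  is_hilbert dot -> separable H ->
  self_adjoint dot DA A ->
  0 < delta -> (forall x, DA x -> delta * `|x| ^+ 2 <= dot (A x) x) ->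
  trace_class dot (op_inverse DA A) ->
  let Q := fun x : H => 2^-1 *: op_inverse DA A x in
  gaussian_measure dot mu 0 Q ->
  regular_convex dot mu Q Gam ->
  BV dot mu DA \1_Gam /\ QR dot mu \1_Gam.

Proof.
move=> hil sep selfA delta0 coercive _ Q gauss.
move=> [g [[convg smoothg] [g00 dg00] [gam gam0 hess] [-> _] [[M bM] _]]].
have dg0 : nabla dot g 0 = 0 by rewrite nabla.unlock.
have g_ge0 := smooth_ge0 hil smoothg gam0 hess g00 dg0.
have [K K0 bK] := nabla_bounded_sublevel hil smoothg gam0 hess g00 dg0 convg bM.
have [_ dDA _] := selfA.
have dirs l : DA l -> l != 0 -> exists2 k, cameron_martin dot mu l k & 0 < dot l k.
  move=> Dl l0; exists (2 *: A l); last exact: (domain_dual_gt0 delta0 coercive).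
  exact: (cameron_martin_domain selfA delta0 coercive gauss Dl).
have [C HC] := shell_measure hil sep gauss gam0 (continuous_smooth hil smoothg) g_ge0
  (strong_midpoint hil smoothg hess) (convex_smooth convg) g00 dDA dirs.
have exh := sublevel_exhaustion hil (diff_smooth hil smoothg)
  (continuous_nabla_smooth hil smoothg) K0 bK HC.
split; first exact: (BV_exhaustion hil sep selfA delta0 coercive gauss exh).
exact: (QR_exhaustion hil sep selfA delta0 coercive gauss exh).
Qed.
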